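(* Let $\lambda,\mu\in\mathbb{R}$. The space $\mathrm{H}^1_{\mathrm{diff}}(\mathfrak{osp}(2|2),\mathfrak{D}^2_{\lambda,\mu})$ is purely even, and $$\mathrm{H}^1_{\mathrm{diff}}(\mathfrak{osp}(2|2),\mathfrak{D}^2_{\lambda,\mu})\simeq\begin{cases}\mathbb{R}^2&\text{if }\mu-\lambda=0,\\ \mathbb{R}^3&\text{if }(\lambda,\mu)=(-\tfrac{k}{2},\tfrac{k}{2})\text{ with }k\in\mathbb{N}\setminus\{0\},\\ 0&\text{otherwise.}\end{cases}$$ Moreover, the following maps are 1-cocycles whose classes span the corresponding cohomology spaces. For $\mu=\lambda$: $\Upsilon_{\lambda,\lambda}(X_G)=G'$ and $$\widetilde{\Upsilon}_{\lambda,\lambda}(X_G)=\begin{cases}\overline{\eta}_1\overline{\eta}_2(G)&\text{if }\lambda=0,\\ 2\lambda\,\overline{\eta}_1(\partial_2(G))-(-1)^{|G|}\left(\partial_2(G)\,\overline{\eta}_1+\theta_2\,\overline{\eta}_2\overline{\eta}_1(G)\,\overline{\eta}_2\right)&\text{if }\lambda\neq0.\end{cases}$$ For $(\lambda,\mu)=(-\frac{k}{2},\frac{k}{2})$ with $k\in\mathbb{N}\setminus\{0\}$: $$\Upsilon_{-\frac{k}{2},\frac{k}{2}}(X_G)=G'\,\overline{\eta}_1\overline{\eta}_2^{2k-1},$$ $$\widetilde{\Upsilon}_{-\frac{k}{2},\frac{k}{2}}(X_G)=k\,\overline{\eta}_1(\partial_2(G))\,\overline{\eta}_1\overline{\eta}_2^{2k-1}-(-1)^{|G|}\left(\partial_2(G)\,\overline{\eta}_2^{2k+1}-\overline{\eta}_1(\theta_2\partial_2(G))\,\overline{\eta}_1^{2k+1}\right),$$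 $$\overline{\Upsilon}_{-\frac{k}{2},\frac{k}{2}}(X_G)=(k-1)G''\,\overline{\eta}_1\overline{\eta}_2^{2k-3}+(-1)^{|G|}\left(\overline{\eta}_2(G')\,\overline{\eta}_1^{2k-1}-\overline{\eta}_1(G')\,\overline{\eta}_2^{2k-1}\right).$$
   Context: $C^\infty(\mathbb{R}^{1|2})$ is the superalgebra of functions $F=f_0(x)+f_1(x)\theta_1+f_2(x)\theta_2+f_{12}(x)\theta_1\theta_2$, with $f_0,f_1,f_2,f_{12}\in C^\infty(\mathbb{R})$, $x$ even, $\theta_1,\theta_2$ odd, $\theta_i\theta_j=-\theta_j\theta_i$; $|F|$ is the parity of a homogeneous $F$. Put $\partial_x=\partial/\partial x$, $F'=\partial_x F$, $\partial_i=\partial/\partial\theta_i$ (left derivatives), $\overline{\eta}_i=\partial_i-\theta_i\partial_x$ (so $\overline{\eta}_i^2=-\partial_x$), and $\alpha_2=dx+\theta_1d\theta_1+\theta_2d\theta_2$. For $F\in C^\infty(\mathbb{R}^{1|2})$ the contact vector field is $X_F=F\partial_x-\frac12(-1)^{|F|}\sum_{i=1}^2\overline{\eta}_i(F)\overline{\eta}_i$. The contact vector fields form the Lie superalgebra $\mathcal{K}(2)$, with $[X_F,X_G]=X_{\{F,G\}}$, $\{F,G\}=FG'-F'G-\frac12(-1)^{|F|}\sum_{i=1}^2\overline{\eta}_i(F)\overline{\eta}_i(G)$. Here $$\mathfrak{osp}(2|2)=\mathrm{Span}(X_1,X_x,X_{x^2},X_{x\theta_1},X_{x\theta_2},X_{\theta_1},X_{\theta_2},X_{\theta_1\theta_2})\subset\mathcal{K}(2).$$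 For $\lambda\in\mathbb{R}$, the space of $\lambda$-densities is $\mathfrak{F}^2_\lambda=\{F\alpha_2^\lambda\mid F\in C^\infty(\mathbb{R}^{1|2})\}$, with action $\mathfrak{L}_{X_F}(G\alpha_2^\lambda)=\mathfrak{L}^\lambda_{X_F}(G)\alpha_2^\lambda$, $\mathfrak{L}^\lambda_{X_F}(G)=X_F(G)+\lambda F'G$. $\mathfrak{D}^2_{\lambda,\mu}$ is the superspace of linear differential operators $\mathfrak{F}^2_\lambda\to\mathfrak{F}^2_\mu$, i.e. operators $A(F\alpha_2^\lambda)=\sum_{\ell,m}a_{\ell,m}(x,\theta)\overline{\eta}_1^\ell\overline{\eta}_2^m(F)\alpha_2^\mu$ (finite sum), with action $X_F\cdot A=\mathfrak{L}^\mu_{X_F}\circ A-(-1)^{|A||F|}A\circ\mathfrak{L}^\lambda_{X_F}$. For a Lie superalgebra $\mathfrak{g}$ and a $\mathfrak{g}$-module $V$: $\delta v(g)=(-1)^{|g||v|}g\cdot v$ for $v\in V$; for linear $\Upsilon:\mathfrak{g}\to V$, $\delta\Upsilon(g,h)=(-1)^{|g||\Upsilon|}g\cdot\Upsilon(h)-(-1)^{|h|(|g|+|\Upsilon|)}h\cdot\Upsilon(g)-\Upsilon([g,h])$ (homogeneous elements, extended linearly). 1-cocycles are the $\Upsilon$ with $\delta\Upsilon=0$, 1-coboundaries are the $\delta v$, and $\mathrm{H}^1$ is their quotient. $\mathrm{H}^1_{\mathrm{diff}}$ means that only cochains given by differential operators are considered. ''Purely even'' means that the odd part of the cohomology vanishes.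 Formulas for $\Upsilon(X_G)$ are for homogeneous $G$ (extended linearly); they denote the operator $P$ in $\Upsilon(X_G)(F\alpha_2^\lambda)=P(F)\alpha_2^\mu$: functions written as results of applying an operator to $G$ act by left multiplication, and the remaining $\overline{\eta}_i$'s act on $F$. A term whose numerical coefficient is $0$ (such as $(k-1)G''\overline{\eta}_1\overline{\eta}_2^{2k-3}$ when $k=1$) is understood to be zero. $\mathbb{N}$ includes $0$. *)

(* Defs.v *)
From HB Require Import structures.
From mathcomp Require Import all_boot all_order all_algebra.
From mathcomp Require Import ring lra.
From mathcomp Require Import all_classical all_reals all_analysis.

Set Implicit Arguments.
Unset Strict Implicit.
Unset Printing Implicit Defensive.

Import Order.TTheory GRing.Theory Num.Theory.
Import numFieldNormedType.Exports.
Local Open Scope classical_set_scope.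
Local Open Scope ring_scope.
Local Open Scope quotient_scope.

Section QuotientModule.
Variables (R : pzRingType) (V : lmodType R) (W : submodClosed V).

Let W0 : {pred V} := [pred v | v \in W].

Let W0_zmod_closed : zmod_closed W0.
Proof.
split=> [|u v]; rewrite !inE ?rpred0// => uW vW.
by rewrite -scaleN1r rpredD ?rpredZ.
Qed.

HB.instance Definition _ := GRing.isZmodClosed.Build V W0 W0_zmod_closed.

Definition quotmod : Type := Quotient.quot W0.
HB.instance Definition _ := GRing.Zmodule.on quotmod.

Definition quotmod_pi (v : V) : quotmod := \pi_(Quotient.quot W0) v.

Lemma quotmod_piE u v : (quotmod_pi u = quotmod_pi v) <-> (u - v \in W).
Proof.
have E : (u - v \in W) = (quotmod_pi u == quotmod_pi v) := Quotient.idealrBE W0 u v.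
by rewrite E; split=> [->|/eqP].
Qed.

Lemma quotmod_piB : {morph quotmod_pi : x y / x - y}.
Proof. exact: (raddfB (\pi_(Quotient.quot W0))). Qed.

Lemma quotmod_piD : {morph quotmod_pi : x y / x + y}.
Proof. exact: (raddfD (\pi_(Quotient.quot W0))). Qed.

Lemma quotmod_pi_repr (x : quotmod) :
  quotmod_pi (repr (x : Quotient.quot W0)) = x.
Proof. exact: reprK. Qed.

Definition quotmod_scale (a : R) (x : quotmod) : quotmod :=
  quotmod_pi (a *: repr (x : Quotient.quot W0)).

Lemma quotmod_scale_pi a v : quotmod_scale a (quotmod_pi v) = quotmod_pi (a *: v).
Proof.
by apply/quotmod_piE; rewrite -scalerBr rpredZ//; apply/quotmod_piE/quotmod_pi_repr.
Qed.

Lemma quotmod_scalerA a b x :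
  quotmod_scale a (quotmod_scale b x) = quotmod_scale (a * b) x.
Proof. by rewrite -(quotmod_pi_repr x) !quotmod_scale_pi scalerA. Qed.

Lemma quotmod_scale1r : left_id 1 quotmod_scale.
Proof. by move=> x; rewrite -(quotmod_pi_repr x) quotmod_scale_pi scale1r. Qed.

Lemma quotmod_scalerDr : right_distributive quotmod_scale +%R.
Proof.
move=> a x y; rewrite -(quotmod_pi_repr x) -(quotmod_pi_repr y).
by rewrite -quotmod_piD !quotmod_scale_pi -quotmod_piD scalerDr.
Qed.

Lemma quotmod_scalerDl x : {morph quotmod_scale^~ x : a b / a + b}.
Proof.
move=> a b; rewrite -(quotmod_pi_repr x).
by rewrite !quotmod_scale_pi -quotmod_piD scalerDl.
Qed.

HB.instance Definition _ := GRing.Zmodule_isLmodule.Build R quotmod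
  quotmod_scalerA quotmod_scale1r quotmod_scalerDr quotmod_scalerDl.

Lemma quotmod_pi_linear : linear quotmod_pi.
Proof. by move=> a u v; rewrite quotmod_piD -quotmod_scale_pi. Qed.

HB.instance Definition _ :=
  GRing.isLinear.Build R V quotmod _ quotmod_pi quotmod_pi_linear.

End QuotientModule.

(* Parities are booleans (true is odd), [gpart p] and [vpart p] are the
   projections on the components of parity p.  The formulas for the coboundary
   operator are given on homogeneous elements; their multilinear extension is
   the sum of their values on the homogeneous components.  [C] is the space of
   admissible 1-cochains.  The axioms of Lie superalgebras and of their modules
   play no role in these definitions. *)
Section SuperCohomology.
Variables (R : pzRingType) (g V : lmodType R).
Variables (gpart : bool -> g -> g) (vpart : bool -> {linear V -> V}).
Variables (bracket : g -> g -> g) (act : g -> {linear V -> V}).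
Variable C : submodClosed (g -> V).

Definition hom_part (r : bool) (U : g -> V) (x : g) : V :=
  \sum_(p : bool) vpart (p (+) r) (U (gpart p x)).

Definition delta0 (v : V) (x : g) : V :=
  \sum_(p : bool) \sum_(r : bool)
    (-1) ^+ (p && r) *: act (gpart p x) (vpart r v).

Definition delta1 (U : g -> V) (x y : g) : V :=
  \sum_(p : bool) \sum_(q : bool) \sum_(r : bool)
    ((-1) ^+ (p && r) *: act (gpart p x) (hom_part r U (gpart q y))
     - (-1) ^+ (q && (p (+) r)) *: act (gpart q y) (hom_part r U (gpart p x))
     - hom_part r U (bracket (gpart p x) (gpart q y))).

Let fct_linE a (U W : g -> V) x : (a *: U + W) x = a *: U x + W x.
Proof. by []. Qed.

Lemma hom_part_linear r : linear (hom_part r).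
Proof.
move=> a U W; apply/funext => x; rewrite fct_linE /hom_part scaler_sumr -big_split.
by apply: eq_bigr => p _; rewrite fct_linE linearP.
Qed.

Lemma delta0_linear : linear delta0.
Proof.
move=> a u v; apply/funext => x; rewrite fct_linE /delta0 scaler_sumr -big_split /=.
apply: eq_bigr => p _; rewrite scaler_sumr -big_split /=.
apply: eq_bigr => r _; rewrite !linearP scalerDr !scalerA.
by case: (p && r); rewrite ?expr0 ?expr1 ?mul1r ?mulr1 ?mulN1r ?mulrN1.
Qed.

Definition is_cocycle (U : g -> V) := forall x y, delta1 U x y = 0.

Definition cocycle_pred : {pred (g -> V)} :=
  [pred U | (U \in C) && `[< is_cocycle U >]].

Let subrDB (x1 x2 y1 y2 z1 z2 : V) :
  (x1 + x2) - (y1 + y2) - (z1 + z2) = (x1 - y1 - z1) + (x2 - y2 - z2).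
Proof. by rewrite !opprD (addrACA x1) (addrACA (x1 - y1)). Qed.

Lemma delta1_linear a U W x y :
  delta1 (a *: U + W) x y = a *: delta1 U x y + delta1 W x y.
Proof.
rewrite /delta1 scaler_sumr -big_split; apply: eq_bigr => p _ /=.
rewrite scaler_sumr -big_split; apply: eq_bigr => q _ /=.
rewrite scaler_sumr -big_split; apply: eq_bigr => r _ /=.
rewrite !hom_part_linear !fct_linE !(linearP (act _)).
have sgnA (b : bool) (v : V) : (-1) ^+ b *: (a *: v) = a *: ((-1) ^+ b *: v) :> V.
  by rewrite !scalerA; case: b; rewrite ?expr0 ?expr1 ?mul1r ?mulr1 ?mulN1r ?mulrN1.
by rewrite !scalerDr !sgnA subrDB !scalerN.
Qed.

Lemma cocycle_submod_closed : submod_closed cocycle_pred.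
Proof.
split=> [|a U W]; rewrite !inE.
  rewrite rpred0; apply/asboolP => x y.
  have := delta1_linear (-1) 0 0 x y.
  by rewrite scaler0 addr0 scaleN1r addNr.
move=> /andP[CU /asboolP zU] /andP[CW /asboolP zW].
rewrite rpredD ?rpredZ//; apply/asboolP => x y.
by rewrite delta1_linear zU zW scaler0 addr0.
Qed.

HB.instance Definition _ :=
  GRing.isSubmodClosed.Build R (g -> V) cocycle_pred cocycle_submod_closed.

Record cocycle := Cocycle
  { cocycle_val :> g -> V; _ : cocycle_val \in cocycle_pred }.
HB.instance Definition _ := [isSub for cocycle_val].
HB.instance Definition _ := [Choice of cocycle by <:].
HB.instance Definition _ := [SubChoice_isSubLmodule of cocycle by <:].

Definition coboundary_pred : {pred cocycle} :=
  [pred z : cocycle | `[< exists v, cocycle_val z = delta0 v >]].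

Lemma coboundary_submod_closed : submod_closed coboundary_pred.
Proof.
split=> [|a z w]; rewrite !inE.
  exists 0; apply/esym.
  have := delta0_linear (-1) 0 0.
  by rewrite scaler0 addr0 scaleN1r addNr.
move=> [u zu] [v wv]; exists (a *: u + v).
by rewrite delta0_linear -zu -wv.
Qed.

HB.instance Definition _ :=
  GRing.isSubmodClosed.Build R cocycle coboundary_pred coboundary_submod_closed.

Definition H1 : lmodType R := quotmod coboundary_pred.

Definition H1_class (z : cocycle) : H1 := quotmod_pi coboundary_pred z.

Definition H1_homogeneous (r : bool) (h : H1) : Prop :=
  exists2 z : cocycle, hom_part r z = z & H1_class z = h.

End SuperCohomology.

Section SmoothFunctions.
Variable R : realType.
Implicit Types f g : R -> R.

Definition smooth f := forall (n : nat) (x : R), derivable (derive1n n f) x 1.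

Let nsmooth n f :=
  forall k, (k <= n)%N -> forall x : R, derivable (derive1n k f) x 1.

Let nsmoothS n f : nsmooth n.+1 f <->
  (forall x : R, derivable f x 1) /\ nsmooth n (derive1 f).
Proof.
split=> [sf|[df sf] [|k] kn x]; last by rewrite derive1Sn; apply: sf.
  split=> [x|k kn x]; first exact: (sf 0%N).
  by rewrite -derive1Sn; apply: sf.
exact: df.
Qed.

Let nsmoothW n f : nsmooth n.+1 f -> nsmooth n f.
Proof. by move=> sf k kn x; apply: sf; apply: leqW. Qed.

Lemma derive1_linE (a : R) f g : (forall x : R, derivable f x 1) ->
  (forall x : R, derivable g x 1) ->
  derive1 (a *: f + g) = a *: derive1 f + derive1 g.
Proof.
move=> df dg; apply/funext => x.
rewrite derive1E (deriveD (derivableZ (k := a) (df x)) (dg x)).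
by rewrite (deriveZ _ (df x)) -!derive1E.
Qed.

Lemma derive1_mulE f g : (forall x : R, derivable f x 1) ->
  (forall x : R, derivable g x 1) ->
  derive1 (f * g) = derive1 f * g + f * derive1 g.
Proof.
move=> df dg; apply/funext => x.
rewrite derive1E (deriveM (df x) (dg x)) addrC -!derive1E /=.
by rewrite [g x *: _]mulrC.
Qed.

Let nsmooth_lin n a f g : nsmooth n f -> nsmooth n g -> nsmooth n (a *: f + g).
Proof.
elim: n f g => [|n IH] f g sf sg.
  move=> k; rewrite leqn0 => /eqP-> x.
  by apply: derivableD; [apply: derivableZ; exact: (sf 0%N)|exact: (sg 0%N)].
have /nsmoothS[df sf'] := sf; have /nsmoothS[dg sg'] := sg.
apply/nsmoothS; split.
  by move=> x; apply: derivableD; [exact: derivableZ|].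
by rewrite (derive1_linE _ df dg); apply: IH.
Qed.

Let nsmooth_mul n f g : nsmooth n f -> nsmooth n g -> nsmooth n (f * g).
Proof.
elim: n f g => [|n IH] f g sf sg.
  move=> k; rewrite leqn0 => /eqP-> x.
  by apply: derivableM; [exact: (sf 0%N)|exact: (sg 0%N)].
have /nsmoothS[df sf'] := sf; have /nsmoothS[dg sg'] := sg.
apply/nsmoothS; split; first by move=> x; exact: derivableM.
rewrite (derive1_mulE df dg) -[derive1 f * g]scale1r.
apply: nsmooth_lin; apply: IH; [exact: sf'|exact: nsmoothW|exact: nsmoothW|exact: sg'].
Qed.

Let smoothP f : smooth f <-> forall n, nsmooth n f.
Proof. by split=> [sf n k _|sf n x]; [exact: sf|exact: (sf n)]. Qed.

Lemma smooth_cst (c : R) : smooth (cst c).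
Proof.
suff H n (d : R) : nsmooth n (cst d) by apply/smoothP => n; exact: H.
elim: n d => [|n IH] d.
  by move=> k; rewrite leqn0 => /eqP-> x; exact: derivable_cst.
apply/nsmoothS; split; first by move=> x; exact: derivable_cst.
rewrite (_ : derive1 _ = cst (0 : R)); first exact: IH.
by apply/funext => x; rewrite derive1_cst.
Qed.

Lemma smooth_id : smooth id.
Proof.
move=> [|n] x; first exact: derivable_id.
rewrite derive1Sn (_ : derive1 _ = cst (1 : R)); first exact: smooth_cst.
by apply/funext => y; rewrite derive1_id.
Qed.

Lemma smooth_lin a f g : smooth f -> smooth g -> smooth (a *: f + g).
Proof. by move=> /smoothP sf /smoothP sg; apply/smoothP => n; apply: nsmooth_lin. Qed.

Lemma smooth_mul f g : smooth f -> smooth g -> smooth (f * g).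
Proof. by move=> /smoothP sf /smoothP sg; apply/smoothP => n; apply: nsmooth_mul. Qed.

Lemma smooth_derive1 f : smooth f -> smooth (derive1 f).
Proof. by move=> sf n x; rewrite -derive1Sn; exact: sf. Qed.

Let fct_cst0 : cst (0 : R) = 0 :> (R -> R).
Proof. by apply/funext. Qed.

Let fct_cst1 : cst (1 : R) = 1 :> (R -> R).
Proof. by apply/funext. Qed.

Definition smooth_pred : {pred (R -> R)} := [pred f | `[< smooth f >]].

Lemma smooth_submod_closed : submod_closed smooth_pred.
Proof.
split=> [|a f g]; first by rewrite -fct_cst0; apply/asboolP; exact: smooth_cst.
by move=> /asboolP sf /asboolP sg; apply/asboolP; exact: smooth_lin.
Qed.

HB.instance Definition _ :=
  GRing.isSubmodClosed.Build R (R -> R) smooth_pred smooth_submod_closed.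

Lemma smooth_subring_closed : subring_closed smooth_pred.
Proof.
split=> [|f g|f g]; first by rewrite -fct_cst1; apply/asboolP; exact: smooth_cst.
  move=> /asboolP sf /asboolP sg; apply/asboolP.
  by rewrite addrC -scaleN1r; exact: smooth_lin.
by move=> /asboolP sf /asboolP sg; apply/asboolP; exact: smooth_mul.
Qed.

HB.instance Definition _ :=
  GRing.isSubringClosed.Build (R -> R) smooth_pred smooth_subring_closed.

Record Cinf := MkCinf { Cinf_val :> R -> R; _ : Cinf_val \in smooth_pred }.
HB.instance Definition _ := [isSub for Cinf_val].
HB.instance Definition _ := [Choice of Cinf by <:].
HB.instance Definition _ := [SubChoice_isSubComNzRing of Cinf by <:].
HB.instance Definition _ := [SubZmodule_isSubLmodule of Cinf by <:].

Definition Cinf_of f (sf : smooth f) : Cinf := MkCinf (asboolT sf).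

Lemma Cinf_smooth (f : Cinf) : smooth f.
Proof. by case: f => f /= /asboolP. Qed.

Definition Cinf_id : Cinf := Cinf_of smooth_id.
Definition Cinf_deriv (f : Cinf) : Cinf := Cinf_of (smooth_derive1 (@Cinf_smooth f)).

Lemma Cinf_scaleAl (a : R) (f g : Cinf) : a *: (f * g) = a *: f * g.
Proof. by apply/val_inj/funext => x; exact: mulrA. Qed.

HB.instance Definition _ := GRing.Lmodule_isLalgebra.Build R Cinf Cinf_scaleAl.
HB.instance Definition _ := GRing.Lalgebra_isComAlgebra.Build R Cinf.

Let Cinf_derivable (f : Cinf) (x : R) : derivable f x 1.
Proof. exact: (@Cinf_smooth f 0%N). Qed.

Lemma Cinf_deriv_linear : linear Cinf_deriv.
Proof.
move=> a f g; apply: val_inj.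
rewrite -[LHS]/(derive1 (a *: Cinf_val f + Cinf_val g)).
by rewrite (derive1_linE _ (@Cinf_derivable f) (@Cinf_derivable g)).
Qed.

HB.instance Definition _ :=
  GRing.isLinear.Build R Cinf Cinf _ Cinf_deriv Cinf_deriv_linear.

Lemma Cinf_derivM (f g : Cinf) : Cinf_deriv (f * g) = Cinf_deriv f * g + f * Cinf_deriv g.
Proof.
apply: val_inj; rewrite -[LHS]/(derive1 (Cinf_val f * Cinf_val g)).
by rewrite (derive1_mulE (@Cinf_derivable f) (@Cinf_derivable g)).
Qed.

Lemma CinfP (f g : Cinf) : f =1 g -> f = g.
Proof. by move=> fg; apply/val_inj/funext. Qed.

Lemma Cinf_valD (f g : Cinf) x : (f + g) x = f x + g x. Proof. by []. Qed.
Lemma Cinf_valN (f : Cinf) x : (- f) x = - f x. Proof. by []. Qed.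
Lemma Cinf_valM (f g : Cinf) x : (f * g) x = f x * g x. Proof. by []. Qed.
Lemma Cinf_valZ (a : R) (f : Cinf) x : (a *: f) x = a * f x. Proof. by []. Qed.
Lemma Cinf_val0 x : (0 : Cinf) x = 0. Proof. by []. Qed.
Lemma Cinf_val1 x : (1 : Cinf) x = 1. Proof. by []. Qed.
Lemma Cinf_val_id x : Cinf_id x = x. Proof. by []. Qed.

Definition Cinf_valE := (Cinf_valD, Cinf_valN, Cinf_valM, Cinf_valZ,
  Cinf_val0, Cinf_val1, Cinf_val_id).

Lemma Cinf_deriv1 : Cinf_deriv 1 = 0.
Proof. by apply/val_inj/funext => x; exact: derive1_cst. Qed.

Lemma Cinf_deriv_id : Cinf_deriv Cinf_id = 1.
Proof. by apply/val_inj/funext => x; exact: derive1_id. Qed.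

Lemma Cinf_deriv0 : Cinf_deriv 0 = 0.
Proof. exact: linear0. Qed.

Lemma Cinf_derivD (f g : Cinf) : Cinf_deriv (f + g) = Cinf_deriv f + Cinf_deriv g.
Proof. exact: linearD. Qed.

Lemma Cinf_derivN (f : Cinf) : Cinf_deriv (- f) = - Cinf_deriv f.
Proof. exact: linearN. Qed.

Lemma Cinf_derivZ (a : R) (f : Cinf) : Cinf_deriv (a *: f) = a *: Cinf_deriv f.
Proof. exact: linearZ. Qed.

Definition Cinf_derivE :=
  (Cinf_derivM, Cinf_derivD, Cinf_derivN, Cinf_derivZ,
   Cinf_deriv0, Cinf_deriv1, Cinf_deriv_id).

End SmoothFunctions.

(* [SFun f0 f1 f2 f12] is f0 + f1 theta1 + f2 theta2 + f12 theta1 theta2. *)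
Record superfun (R : realType) :=
  SFun { sf0 : Cinf R; sf1 : Cinf R; sf2 : Cinf R; sf12 : Cinf R }.

Section Superfunctions.
Variable R : realType.
Local Notation superfun := (superfun R).
Implicit Types F G H : superfun.

Definition superfun_tuple F := (sf0 F, sf1 F, sf2 F, sf12 F).
Definition tuple_superfun (t : Cinf R * Cinf R * Cinf R * Cinf R) : superfun :=
  let: (f0, f1, f2, f12) := t in SFun f0 f1 f2 f12.
Lemma superfun_tupleK : cancel superfun_tuple tuple_superfun.
Proof. by case. Qed.

HB.instance Definition _ := Choice.copy superfun (can_type superfun_tupleK).

Definition sf_zero : superfun := SFun 0 0 0 0.
Definition sf_opp F := SFun (- sf0 F) (- sf1 F) (- sf2 F) (- sf12 F).
Definition sf_add F G :=
  SFun (sf0 F + sf0 G) (sf1 F + sf1 G) (sf2 F + sf2 G) (sf12 F + sf12 G).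

Let sfA : associative sf_add.
Proof. by move=> [????] [????] [????]; congr SFun; exact: addrA. Qed.
Let sfC : commutative sf_add.
Proof. by move=> [????] [????]; congr SFun; exact: addrC. Qed.
Let sf0D : left_id sf_zero sf_add.
Proof. by move=> [????]; congr SFun; exact: add0r. Qed.
Let sfND : left_inverse sf_zero sf_opp sf_add.
Proof. by move=> [????]; congr SFun; exact: addNr. Qed.

HB.instance Definition _ := GRing.isZmodule.Build superfun sfA sfC sf0D sfND.

Definition sf_scale (a : R) F :=
  SFun (a *: sf0 F) (a *: sf1 F) (a *: sf2 F) (a *: sf12 F).

Let sfZA a b F : sf_scale a (sf_scale b F) = sf_scale (a * b) F.
Proof. by congr SFun; exact: scalerA. Qed.
Let sf1Z : left_id 1 sf_scale.
Proof. by move=> [????]; congr SFun; exact: scale1r. Qed.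
Let sfZDr : right_distributive sf_scale +%R.
Proof. by move=> a [????] [????]; congr SFun; exact: scalerDr. Qed.
Let sfZDl F : {morph sf_scale^~ F : a b / a + b}.
Proof. by move=> a b; congr SFun; exact: scalerDl. Qed.

HB.instance Definition _ :=
  GRing.Zmodule_isLmodule.Build R superfun sfZA sf1Z sfZDr sfZDl.

Definition sf_one : superfun := SFun 1 0 0 0.
Definition sf_mul F G := SFun
  (sf0 F * sf0 G)
  (sf0 F * sf1 G + sf1 F * sf0 G)
  (sf0 F * sf2 G + sf2 F * sf0 G)
  (sf0 F * sf12 G + sf12 F * sf0 G + sf1 F * sf2 G - sf2 F * sf1 G).

Lemma superfunP F G :
  sf0 F = sf0 G -> sf1 F = sf1 G -> sf2 F = sf2 G -> sf12 F = sf12 G -> F = G.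
Proof. by move: F G => [????] [????] /= -> -> -> ->. Qed.

Let sfMA : associative sf_mul.
Proof. by move=> F G H; apply: superfunP => /=; ring. Qed.
Let sf1M : left_id sf_one sf_mul.
Proof. by move=> F; apply: superfunP => /=; ring. Qed.
Let sfM1 : right_id sf_one sf_mul.
Proof. by move=> F; apply: superfunP => /=; ring. Qed.
Let sfMDl : left_distributive sf_mul +%R.
Proof. by move=> F G H; apply: superfunP => /=; ring. Qed.
Let sfMDr : right_distributive sf_mul +%R.
Proof. by move=> F G H; apply: superfunP => /=; ring. Qed.
Let sf1_neq0 : sf_one != 0.
Proof. by apply/eqP => /(congr1 (@sf0 R)) /eqP; rewrite oner_eq0. Qed.

HB.instance Definition _ :=
  GRing.Zmodule_isNzRing.Build superfun sfMA sf1M sfM1 sfMDl sfMDr sf1_neq0.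

Let sfZAl (a : R) F G : a *: (F * G) = a *: F * G.
Proof.
by apply: superfunP => /=; rewrite ?scalerBr ?scalerDr !scalerAl.
Qed.

HB.instance Definition _ := GRing.Lmodule_isLalgebra.Build R superfun sfZAl.

Definition sf_x : superfun := SFun (Cinf_id R) 0 0 0.
Definition theta1 : superfun := SFun 0 1 0 0.
Definition theta2 : superfun := SFun 0 0 1 0.

Definition sf_part (p : bool) F : superfun :=
  if p then SFun 0 (sf1 F) (sf2 F) 0 else SFun (sf0 F) 0 0 (sf12 F).

(* [sf_sign F] is the linear extension of (-1)^|F| F; hence (-1)^|F| T(F),
   extended linearly, is [T (sf_sign F)] for any linear T. *)
Definition sf_sign F : superfun := SFun (sf0 F) (- sf1 F) (- sf2 F) (sf12 F).

Lemma sf_signE F : sf_sign F = \sum_(p : bool) (-1) ^+ p *: sf_part p F.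
Proof.
rewrite big_bool /= expr0 expr1 scale1r scaleN1r.
by apply: superfunP => /=; rewrite ?oppr0 ?add0r ?addr0.
Qed.

Definition dx F : superfun := SFun (Cinf_deriv (sf0 F)) (Cinf_deriv (sf1 F))
  (Cinf_deriv (sf2 F)) (Cinf_deriv (sf12 F)).
Definition d1 F : superfun := SFun (sf1 F) 0 (sf12 F) 0.
Definition d2 F : superfun := SFun (sf2 F) (- sf12 F) 0 0.
Definition etab1 F : superfun := d1 F - theta1 * dx F.
Definition etab2 F : superfun := d2 F - theta2 * dx F.

Definition contact G F : superfun :=
  G * dx F
  - 2^-1 *: (etab1 (sf_sign G) * etab1 F + etab2 (sf_sign G) * etab2 F).

Definition contact_bracket F G : superfun :=
  F * dx G - dx F * G
  - 2^-1 *: (etab1 (sf_sign F) * etab1 G + etab2 (sf_sign F) * etab2 G).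

(* The density F alpha_2^lam is represented by its coefficient F. *)
Definition dens_act (lam : R) G F : superfun :=
  contact G F + lam *: (dx G * F).

Lemma sf_part_linear p : linear (sf_part p).
Proof.
by move=> a F G; case: p; apply: superfunP; rewrite //= scaler0 addr0.
Qed.
HB.instance Definition _ p := GRing.isLinear.Build R superfun superfun _
  (sf_part p) (sf_part_linear p).

Lemma sf_sign_linear : linear sf_sign.
Proof.
by move=> a F G; apply: superfunP; rewrite //= opprD scalerN.
Qed.
HB.instance Definition _ :=
  GRing.isLinear.Build R superfun superfun _ sf_sign sf_sign_linear.

Lemma dx_linear : linear dx.
Proof. by move=> a F G; apply: superfunP; exact: linearP. Qed.
HB.instance Definition _ := GRing.isLinear.Build R superfun superfun _ dx dx_linear.

Lemma d1_linear : linear d1.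
Proof. by move=> a F G; apply: superfunP; rewrite //= scaler0 addr0. Qed.
HB.instance Definition _ := GRing.isLinear.Build R superfun superfun _ d1 d1_linear.

Lemma d2_linear : linear d2.
Proof.
by move=> a F G; apply: superfunP; rewrite //= ?scaler0 ?addr0// opprD scalerN.
Qed.
HB.instance Definition _ := GRing.isLinear.Build R superfun superfun _ d2 d2_linear.

Lemma sf_scaleAr (a : R) F G : a *: (F * G) = F * (a *: G).
Proof. by apply: superfunP => /=; rewrite ?scalerBr ?scalerDr !scalerAr. Qed.

Lemma etab1_linear : linear etab1.
Proof.
move=> a F G; rewrite /etab1 !linearP /= mulrDr -sf_scaleAr scalerBr opprD.
by rewrite addrACA.
Qed.
HB.instance Definition _ :=
  GRing.isLinear.Build R superfun superfun _ etab1 etab1_linear.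

Lemma etab2_linear : linear etab2.
Proof.
move=> a F G; rewrite /etab2 !linearP /= mulrDr -sf_scaleAr scalerBr opprD.
by rewrite addrACA.
Qed.
HB.instance Definition _ :=
  GRing.isLinear.Build R superfun superfun _ etab2 etab2_linear.

Lemma etab1M F G : etab1 (F * G) = etab1 F * G + sf_sign F * etab1 G.
Proof. by apply: superfunP => /=; rewrite !Cinf_derivE; ring. Qed.

Lemma etab2M F G : etab2 (F * G) = etab2 F * G + sf_sign F * etab2 G.
Proof. by apply: superfunP => /=; rewrite !Cinf_derivE; ring. Qed.

Lemma etab1_etab1 F : etab1 (etab1 F) = - dx F.
Proof. by apply: superfunP => /=; rewrite ?Cinf_derivE; ring. Qed.

Lemma etab2_etab2 F : etab2 (etab2 F) = - dx F.
Proof. by apply: superfunP => /=; rewrite ?Cinf_derivE; ring. Qed.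

Lemma etab2_etab1 F : etab2 (etab1 F) = - etab1 (etab2 F).
Proof. by apply: superfunP => /=; rewrite ?Cinf_derivE; ring. Qed.

Lemma contact_inj F G : contact F =1 contact G -> F = G.
Proof.
have h0 : (2^-1 : R) != 0 by rewrite invr_neq0// pnatr_eq0.
have E0 H : sf0 (contact H sf_x) = sf0 H.
  by rewrite /= !Cinf_derivE; apply: CinfP => t; rewrite !Cinf_valE; ring.
have E1 H : sf0 (contact H theta1) = 2^-1 *: sf1 H.
  by rewrite /= !Cinf_derivE; apply: CinfP => t; rewrite !Cinf_valE; ring.
have E2 H : sf0 (contact H theta2) = 2^-1 *: sf2 H.
  by rewrite /= !Cinf_derivE; apply: CinfP => t; rewrite !Cinf_valE; ring.
have E12 H : sf2 (contact H theta1) = - (2^-1 *: sf12 H).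
  by rewrite /= !Cinf_derivE; apply: CinfP => t; rewrite !Cinf_valE; ring.
move=> FG; apply: superfunP.
- by rewrite -(E0 F) -(E0 G) FG.
- by apply: (scalerI h0); rewrite -(E1 F) -(E1 G) FG.
- by apply: (scalerI h0); rewrite -(E2 F) -(E2 G) FG.
- by apply/(scalerI h0)/oppr_inj; rewrite -(E12 F) -(E12 G) FG.
Qed.

End Superfunctions.

Section DifferentialOperators.
Variable R : realType.
Local Notation superfun := (superfun R).
Implicit Types (F G : superfun) (A B : superfun -> superfun).

Definition eta_mono (lm : nat * nat) F : superfun :=
  iter lm.1 (@etab1 R) (iter lm.2 (@etab2 R) F).

Definition is_diffop A : Prop := exists s : seq (superfun * (nat * nat)),
  forall F, A F = \sum_(t <- s) t.1 * eta_mono t.2 F.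

Lemma is_diffop_eq A B : A =1 B -> is_diffop A -> is_diffop B.
Proof. by move=> AB [s As]; exists s => F; rewrite -AB. Qed.

Lemma is_diffopD A B : is_diffop A -> is_diffop B -> is_diffop (fun F => A F + B F).
Proof. by move=> [s As] [t Bt]; exists (s ++ t) => F; rewrite big_cat As Bt. Qed.

Lemma is_diffop0 : is_diffop (fun=> 0).
Proof. by exists [::] => F; rewrite big_nil. Qed.

Lemma is_diffop_sum (I : Type) (r : seq I) (A : I -> superfun -> superfun) :
  (forall i, is_diffop (A i)) -> is_diffop (fun F => \sum_(i <- r) A i F).
Proof.
move=> dA; elim: r => [|i r IH].
  by apply: is_diffop_eq is_diffop0 => F; rewrite big_nil.
by apply: is_diffop_eq (is_diffopD (dA i) IH) => F; rewrite big_cons.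
Qed.

Lemma is_diffopMl a A : is_diffop A -> is_diffop (fun F => a * A F).
Proof.
move=> [s As]; exists [seq (a * t.1, t.2) | t <- s] => F.
by rewrite As mulr_sumr big_map; apply: eq_bigr => t _; rewrite mulrA.
Qed.

Lemma is_diffopZ (a : R) A : is_diffop A -> is_diffop (fun F => a *: A F).
Proof.
move/(is_diffopMl (a%:A)); apply: is_diffop_eq => F; exact: mulr_algl.
Qed.

Lemma is_diffopN A : is_diffop A -> is_diffop (fun F => - A F).
Proof.
by move/(is_diffopMl (-1)); apply: is_diffop_eq => F; rewrite mulN1r.
Qed.

Lemma is_diffopB A B : is_diffop A -> is_diffop B -> is_diffop (fun F => A F - B F).
Proof. by move=> dA dB; apply: is_diffopD => //; exact: is_diffopN. Qed.

Lemma is_diffop_term a lm : is_diffop (fun F => a * eta_mono lm F).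
Proof. by exists [:: (a, lm)] => F; rewrite big_seq1. Qed.

Lemma is_diffop_id : is_diffop id.
Proof.
by apply: is_diffop_eq (is_diffop_term 1 (0, 0)%N) => F; rewrite mul1r.
Qed.

Lemma etab1_mono l m F : etab1 (eta_mono (l, m) F) = eta_mono (l.+1, m) F.
Proof. by []. Qed.

Lemma etab2_mono l m F :
  etab2 (eta_mono (l, m) F) = (-1) ^+ l *: eta_mono (l, m.+1) F.
Proof.
rewrite /eta_mono /=; elim: l => [|l IH]; first by rewrite expr0 scale1r.
by rewrite iterS etab2_etab1 IH linearZ exprS mulN1r scaleNr.
Qed.

Lemma is_diffop_etab1 A : is_diffop A -> is_diffop (fun F => etab1 (A F)).
Proof.
move=> [s As]; apply: (@is_diffop_eq (fun F => \sum_(t <- s)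
   (etab1 t.1 * eta_mono t.2 F + sf_sign t.1 * eta_mono (t.2.1.+1, t.2.2) F))).
  move=> F; rewrite As linear_sum; apply: eq_bigr => -[a [l m]] _ /=.
  by rewrite etab1M etab1_mono.
by apply: is_diffop_sum => t; apply: is_diffopD; exact: is_diffop_term.
Qed.

Lemma is_diffop_etab2 A : is_diffop A -> is_diffop (fun F => etab2 (A F)).
Proof.
move=> [s As]; apply: (@is_diffop_eq (fun F => \sum_(t <- s)
   (etab2 t.1 * eta_mono t.2 F +
    ((-1) ^+ t.2.1 *: sf_sign t.1) * eta_mono (t.2.1, t.2.2.+1) F))).
  move=> F; rewrite As linear_sum; apply: eq_bigr => -[a [l m]] _ /=.
  by rewrite etab2M etab2_mono -sf_scaleAr scalerAl.
by apply: is_diffop_sum => t; apply: is_diffopD; exact: is_diffop_term.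
Qed.

Lemma is_diffop_comp A B : is_diffop A -> is_diffop B -> is_diffop (fun F => A (B F)).
Proof.
move=> [s As] dB.
apply: (@is_diffop_eq (fun F => \sum_(t <- s) t.1 * eta_mono t.2 (B F))).
  by move=> F; rewrite As.
apply: is_diffop_sum => -[a [l m]]; apply: is_diffopMl; rewrite /eta_mono /=.
elim: l => [|l IH]; last by rewrite /=; exact: is_diffop_etab1.
elim: m => [|m IH] //; exact: is_diffop_etab2.
Qed.

Lemma is_diffop_linear A : is_diffop A -> linear A.
Proof.
move=> [s As] a F G; rewrite !As scaler_sumr -big_split.
apply: eq_bigr => -[b [l m]] _ /=.
suff -> : eta_mono (l, m) (a *: F + G) = a *: eta_mono (l, m) F + eta_mono (l, m) G.
  by rewrite mulrDr sf_scaleAr.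
rewrite /eta_mono /=; have -> : iter m (@etab2 R) (a *: F + G) =
    a *: iter m (@etab2 R) F + iter m (@etab2 R) G.
  by elim: m => [//|m IH]; rewrite !iterS IH linearP.
by elim: l => [//|l IH]; rewrite !iterS IH linearP.
Qed.

Lemma is_diffop_dx : is_diffop (@dx R).
Proof.
apply: is_diffop_eq (is_diffopN (is_diffop_etab1 (is_diffop_etab1 is_diffop_id))).
by move=> F; rewrite etab1_etab1 opprK.
Qed.

Lemma is_diffop_part p : is_diffop (sf_part p).
Proof.
have dsign : is_diffop (@sf_sign R).
  pose S1 F := F - (theta1 R * etab1 F + theta1 R * etab1 F).
  pose S2 F := F - (theta2 R * etab2 F + theta2 R * etab2 F).
  have d1 : is_diffop S1.
    apply: is_diffopB; first exact: is_diffop_id.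
    by apply: is_diffopD; apply: is_diffopMl; exact/is_diffop_etab1/is_diffop_id.
  have d2 : is_diffop S2.
    apply: is_diffopB; first exact: is_diffop_id.
    by apply: is_diffopD; apply: is_diffopMl; exact/is_diffop_etab2/is_diffop_id.
  have S1E F : S1 F = SFun (sf0 F) (- sf1 F) (sf2 F) (- sf12 F).
    by apply: superfunP => /=; ring.
  have S2E F : S2 F = SFun (sf0 F) (sf1 F) (- sf2 F) (- sf12 F).
    by apply: superfunP => /=; ring.
  apply: is_diffop_eq (is_diffop_comp d1 d2) => F.
  by rewrite S1E S2E /= opprK.
have h2 (f : Cinf R) : 2^-1 *: (f + f) = f.
  by rewrite scalerDr -scalerDl (_ : _ + _ = 1) ?scale1r//; field.
case: p.
  apply: is_diffop_eq (is_diffopZ 2^-1 (is_diffopB is_diffop_id dsign)) => F.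
  by apply: superfunP; rewrite /= ?opprK ?subrr ?scaler0 ?h2.
apply: is_diffop_eq (is_diffopZ 2^-1 (is_diffopD is_diffop_id dsign)) => F.
by apply: superfunP; rewrite /= ?subrr ?scaler0 ?h2.
Qed.

Lemma is_diffop_dens lam G : is_diffop (dens_act lam G).
Proof.
apply: is_diffopD; last by apply/is_diffopZ/is_diffopMl/is_diffop_id.
apply: is_diffopB; first by apply/is_diffopMl/is_diffop_dx.
apply/is_diffopZ/is_diffopD; apply/is_diffopMl.
  exact/is_diffop_etab1/is_diffop_id.
exact/is_diffop_etab2/is_diffop_id.
Qed.

Definition diffop_pred : {pred (superfun -> superfun)} := [pred A | `[< is_diffop A >]].

Lemma diffop_submod_closed : submod_closed diffop_pred.
Proof.
split=> [|a A B]; first by apply/asboolP; exact: is_diffop0.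
move=> /asboolP dA /asboolP dB; apply/asboolP.
by apply: is_diffopD => //; exact: is_diffopZ.
Qed.

HB.instance Definition _ := GRing.isSubmodClosed.Build R (superfun -> superfun)
  diffop_pred diffop_submod_closed.

Record diffop := MkDiffop
  { diffop_val :> superfun -> superfun; _ : diffop_val \in diffop_pred }.
HB.instance Definition _ := [isSub for diffop_val].
HB.instance Definition _ := [Choice of diffop by <:].
HB.instance Definition _ := [SubChoice_isSubLmodule of diffop by <:].

Definition diffop_of A (dA : is_diffop A) : diffop := MkDiffop (asboolT dA).

Lemma diffop_is_diffop (A : diffop) : is_diffop A.
Proof. by case: A => A /= /asboolP. Qed.

Lemma diffopP (A B : diffop) : A =1 B -> A = B.
Proof. by move=> AB; apply/val_inj/funext. Qed.

Definition diffop_comp (A B : diffop) : diffop :=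
  diffop_of (is_diffop_comp (diffop_is_diffop A) (diffop_is_diffop B)).

Definition part_op (p : bool) : diffop := diffop_of (is_diffop_part p).

Definition dens_op (lam : R) G : diffop := diffop_of (is_diffop_dens lam G).

Lemma diffop_compDl (a : R) (A B C : diffop) :
  diffop_comp (a *: A + B) C = a *: diffop_comp A C + diffop_comp B C.
Proof. exact: diffopP. Qed.

Lemma diffop_compDr (a : R) (A B C : diffop) :
  diffop_comp C (a *: A + B) = a *: diffop_comp C A + diffop_comp C B.
Proof.
apply: diffopP => F; exact: (is_diffop_linear (diffop_is_diffop C)).
Qed.

Definition diffop_part (r : bool) (A : diffop) : diffop :=
  \sum_(q : bool) diffop_comp (part_op (q (+) r)) (diffop_comp A (part_op q)).

Lemma diffop_part_linear r : linear (diffop_part r).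
Proof.
move=> a A B; rewrite /diffop_part scaler_sumr -big_split; apply: eq_bigr => q _.
by rewrite diffop_compDl diffop_compDr.
Qed.
HB.instance Definition _ r := GRing.isLinear.Build R diffop diffop _
  (diffop_part r) (diffop_part_linear r).

(* The action of X_G on operators F_lam -> F_mu; as coefficients represent
   densities, lam and mu enter only through this action. *)
Definition diffop_act (lam mu : R) G (A : diffop) : diffop :=
  \sum_(p : bool) \sum_(r : bool)
    (diffop_comp (dens_op mu (sf_part p G)) (diffop_part r A)
     - (-1) ^+ (r && p) *:
         diffop_comp (diffop_part r A) (dens_op lam (sf_part p G))).

Lemma diffop_act_linear lam mu G : linear (diffop_act lam mu G).
Proof.
move=> a A B; rewrite /diffop_act scaler_sumr -big_split; apply: eq_bigr => p _ /=.
rewrite scaler_sumr -big_split; apply: eq_bigr => r _ /=.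
rewrite diffop_part_linear diffop_compDl diffop_compDr scalerDr opprD addrACA.
by congr (_ + _); rewrite scalerBr !scalerA mulrC.
Qed.
HB.instance Definition _ lam mu G := GRing.isLinear.Build R diffop diffop _
  (diffop_act lam mu G) (diffop_act_linear lam mu G).

End DifferentialOperators.

Section Osp22.
Variable R : realType.
Local Notation superfun := (superfun R).
Local Notation diffop := (diffop R).
Implicit Types F G : superfun.

(* The contact field X_G is represented by its generating function G, which it
   determines ([contact_inj]); the bracket is then [contact_bracket]. *)
Definition osp_gen : seq superfun :=
  let x := sf_x R in let t1 := theta1 R in let t2 := theta2 R in
  [:: 1; x; x ^+ 2; x * t1; x * t2; t1; t2; t1 * t2].

Definition in_osp G : Prop :=
  exists c : 'I_8 -> R, G = \sum_(i < 8) c i *: osp_gen`_i.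

Definition osp_pred : {pred superfun} := [pred G | `[< in_osp G >]].

Lemma osp_submod_closed : submod_closed osp_pred.
Proof.
split=> [|a F G]; first apply/asboolP.
  by exists (fun=> 0); rewrite big1// => i _; rewrite scale0r.
move=> /asboolP[c ->] /asboolP[d ->]; apply/asboolP.
exists (fun i => a * c i + d i); rewrite scaler_sumr -big_split.
by apply: eq_bigr => i _; rewrite scalerA scalerDl.
Qed.

HB.instance Definition _ :=
  GRing.isSubmodClosed.Build R superfun osp_pred osp_submod_closed.

Record osp22 := MkOsp { osp_val :> superfun; _ : osp_val \in osp_pred }.
HB.instance Definition _ := [isSub for osp_val].
HB.instance Definition _ := [Choice of osp22 by <:].
HB.instance Definition _ := [SubChoice_isSubLmodule of osp22 by <:].

Definition osp_coord (a b c q1 q2 p1 p2 d : R) : superfun :=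
  let x := Cinf_id R in
  SFun (a *: 1 + b *: x + c *: (x * x)) (p1 *: 1 + q1 *: x)
       (p2 *: 1 + q2 *: x) (d *: 1).

Lemma osp_coordE a b c q1 q2 p1 p2 d :
  let x := sf_x R in let t1 := theta1 R in let t2 := theta2 R in
  a *: 1 + (b *: x + (c *: x ^+ 2 + (q1 *: (x * t1) + (q2 *: (x * t2)
  + (p1 *: t1 + (p2 *: t2 + (d *: (t1 * t2) + 0))))))) =
  osp_coord a b c q1 q2 p1 p2 d.
Proof.
by cbv zeta; rewrite expr2; apply: superfunP; rewrite /=; apply: CinfP => t;
   rewrite !Cinf_valE; ring.
Qed.

Lemma in_ospP G : in_osp G <->
  exists a b c q1 q2 p1 p2 d, G = osp_coord a b c q1 q2 p1 p2 d.
Proof.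
split=> [[c ->]|[a [b [c [q1 [q2 [p1 [p2 [d ->]]]]]]]]].
  by rewrite !big_ord_recl big_ord0; do 8!eexists; exact: osp_coordE.
exists (fun i => [:: a; b; c; q1; q2; p1; p2; d]`_i).
by rewrite !big_ord_recl big_ord0; apply/esym; exact: osp_coordE.
Qed.

Lemma in_osp_part p G : in_osp G -> in_osp (sf_part p G).
Proof.
move=> /in_ospP[a [b [c [q1 [q2 [p1 [p2 [d ->]]]]]]]]; apply/in_ospP.
case: p.
  exists 0, 0, 0, q1, q2, p1, p2, 0.
  by rewrite /osp_coord !scale0r !addr0.
exists a, b, c, 0, 0, 0, 0, d.
by rewrite /osp_coord !scale0r !addr0.
Qed.

Lemma in_osp_bracket F G : in_osp F -> in_osp G -> in_osp (contact_bracket F G).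
Proof.
move=> /in_ospP[a [b [c [q1 [q2 [p1 [p2 [d ->]]]]]]]].
move=> /in_ospP[a' [b' [c' [q1' [q2' [p1' [p2' [d' ->]]]]]]]].
apply/in_ospP.
exists (a * b' - b * a' + 2^-1 * (p1 * p1' + p2 * p2')).
exists (2 * (a * c' - c * a') + 2^-1 * (q1 * p1' + q2 * p2' + p1 * q1' + p2 * q2')).
exists (b * c' - c * b' + 2^-1 * (q1 * q1' + q2 * q2')).
exists (p1 * c' - c * p1' + 2^-1 * (b * q1' - q1 * b' - q2 * d' + d * q2')).
exists (p2 * c' - c * p2' + 2^-1 * (b * q2' - q2 * b' + q1 * d' - d * q1')).
exists (a * q1' - q1 * a' + 2^-1 * (p1 * b' - b * p1' - p2 * d' + d * p2')).
exists (a * q2' - q2 * a' + 2^-1 * (p2 * b' - b * p2' + p1 * d' - d * p1')).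
exists (2^-1 * (q2 * p1' - q1 * p2' + p1 * q2' - p2 * q1')).
by apply: superfunP; rewrite /= !Cinf_derivE; apply: CinfP => t;
   rewrite !Cinf_valE; field.
Qed.

Definition osp_of G (oG : in_osp G) : osp22 := MkOsp (asboolT oG).

Lemma osp22_in (G : osp22) : in_osp G.
Proof. by case: G => G /= /asboolP. Qed.

Definition osp_part (p : bool) (G : osp22) : osp22 :=
  osp_of (in_osp_part p (osp22_in G)).

Definition osp_bracket (F G : osp22) : osp22 :=
  osp_of (in_osp_bracket (osp22_in F) (osp22_in G)).

(* Here [t] is (a, (p, q), (l, m)): the term is
   a(x,theta) etabar_1^p etabar_2^q(G) etabar_1^l etabar_2^m(F). *)
Definition is_diffcochain (U : osp22 -> diffop) : Prop :=
  exists s : seq (superfun * (nat * nat) * (nat * nat)), forall (G : osp22) F,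
    U G F = \sum_(t <- s) t.1.1 * eta_mono t.1.2 G * eta_mono t.2 F.

Definition cochain_pred : {pred (osp22 -> diffop)} :=
  [pred U | `[< linear U /\ is_diffcochain U >]].

Lemma cochain_submod_closed : submod_closed cochain_pred.
Proof.
split=> [|a U W].
  apply/asboolP; split=> [a F G|]; first by rewrite scaler0 addr0.
  by exists [::] => G F; rewrite big_nil.
move=> /asboolP[lU [s Us]] /asboolP[lW [t Wt]]; apply/asboolP; split.
  move=> b F G; rewrite -[LHS]/(a *: U (b *: F + G) + W (b *: F + G)).
  rewrite lU lW -[(a *: U + W) F]/(a *: U F + W F) -[(a *: U + W) G]/(a *: U G + W G).
  rewrite [in LHS]scalerDr [in RHS]scalerDr !scalerA [b * a]mulrC; exact: addrACA.
exists ([seq (a *: u.1.1, u.1.2, u.2) | u <- s] ++ t) => G F.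
rewrite big_cat big_map -Wt /=.
rewrite -[LHS]/(a *: U G F + W G F) Us scaler_sumr; congr (_ + _).
by apply: eq_bigr => u _; rewrite !scalerAl.
Qed.

HB.instance Definition _ := GRing.isSubmodClosed.Build R (osp22 -> diffop)
  cochain_pred cochain_submod_closed.

Variables lam mu : R.

Definition Z1diff : Type := cocycle osp_part
  (fun r => diffop_part r : {linear diffop -> diffop}) osp_bracket
  (fun G : osp22 => diffop_act lam mu G : {linear diffop -> diffop})
  cochain_pred.

HB.instance Definition _ := GRing.Lmodule.on Z1diff.

Definition Z1diff_fun (z : Z1diff) : osp22 -> diffop := cocycle_val z.

Definition H1diff : lmodType R := H1 osp_part
  (fun r => diffop_part r : {linear diffop -> diffop}) osp_bracket
  (fun G : osp22 => diffop_act lam mu G : {linear diffop -> diffop})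
  cochain_pred.

Definition H1diff_class (z : Z1diff) : H1diff := H1_class z.

Definition H1diff_homogeneous (r : bool) (h : H1diff) : Prop := H1_homogeneous r h.

Definition purely_even : Prop := forall h, H1diff_homogeneous true h -> h = 0.

End Osp22.

Coercion Z1diff_fun : Z1diff >-> Funclass.

Definition lmod_isomorphic (R : pzRingType) (V W : lmodType R) : Prop :=
  exists f : {linear V -> W}, bijective f.

Section Cocycles.
Variable R : realType.
Implicit Types G F : superfun R.

Definition Upsilon_diag G F := dx G * F.

Definition tUpsilon_diag (lam : R) G F :=
  if lam == 0 then etab1 (etab2 G) * F
  else (2 * lam) *: (etab1 (d2 G) * F)
       - (d2 (sf_sign G) * etab1 F
          + theta2 R * etab2 (etab1 (sf_sign G)) * etab2 F).

Definition Upsilon_k (k : nat) G F := dx G * eta_mono (1, 2 * k - 1)%N F.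

Definition tUpsilon_k (k : nat) G F :=
  k%:R *: (etab1 (d2 G) * eta_mono (1, 2 * k - 1)%N F)
  - (d2 (sf_sign G) * eta_mono (0, 2 * k + 1)%N F
     - etab1 (theta2 R * d2 (sf_sign G)) * eta_mono (2 * k + 1, 0)%N F).

(* For k = 1 the exponent [2 * k - 3] is truncated to 0, but the coefficient of
   that term vanishes. *)
Definition bUpsilon_k (k : nat) G F :=
  (k%:R - 1) *: (dx (dx G) * eta_mono (1, 2 * k - 3)%N F)
  + (etab2 (dx (sf_sign G)) * eta_mono (2 * k - 1, 0)%N F
     - etab1 (dx (sf_sign G)) * eta_mono (0, 2 * k - 1)%N F).

End Cocycles.

(* Main.v *)
From HB Require Import structures.
Require Import Defs.
From mathcomp Require Import all_boot all_order all_algebra.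
From mathcomp Require Import ring lra.
From mathcomp Require Import all_classical all_reals all_analysis.
Import Order.TTheory GRing.Theory Num.Theory.
Import numFieldNormedType.Exports.
Local Open Scope ring_scope.

Set Implicit Arguments.
Unset Strict Implicit.
Unset Printing Implicit Defensive.

(** Call translations the fields X_1, X_theta1, X_theta2 and isotropy fields
    those of the span of X_x, X_theta1theta2, X_xtheta1, X_xtheta2, X_xx, which
    vanish at the origin.  The translations act by d/dx and by the two operators
    half_eta_i = (d_i + theta_i d/dx)/2, so the module of differential operators
    behaves like a coinduced module, and its cohomology is controlled by what
    happens at the origin.

    Concretely, a cocycle U is first changed by a coboundary so that it
    vanishes on the translations ([normalization]): for X_1 one takes
    antiderivatives of the coefficients, for X_theta_i one multiplies by
    theta_i. Every operator A has a germ, the finitely supported array of the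
    values at the origin of A on the monomials x^j theta_1^a theta_2^b. A
    normalized cocycle is determined by the germs of its values on X_x,
    X_theta1theta2, X_xtheta1, X_xtheta2 ([Z_eq0]). Conversely every finitely
    supported array is the germ of an operator commuting with the translations
    ([nilinvariant_interpolation]), and the coboundary of such an operator is
    again normalized. Hence U is a coboundary as soon as its four germs are
    those of the coboundary of a single array.

    That is a problem of linear algebra, solved by [resonance].  The field X_x
    multiplies the array entry at x^j theta_1^a theta_2^b by
    mu - lam - j - (a + b)/2, so the germ of U(X_x) prescribes the primitive where
    this number is not zero, and the cocycle equations do the rest.  Where it is
    zero, the entry of the primitive is read from the germ of U(X_theta1theta2) or
    of U(X_xtheta1), except at two places.  At the monomial 1, when mu = lam, the
    values of U(X_x) and of U(X_theta1theta2) cannot be modified.  At x^(k-1) theta_1 theta_2, when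
    mu = lam + k, the entry of the primitive is multiplied by lam + k/2 in the
    germ of U(X_xtheta1); so there is an obstruction only if lam = - k/2 and
    mu = k/2, and it consists of the values of U(X_x) and U(X_theta1theta2) on
    x^(k-1) theta_1 theta_2 and of U(X_xtheta1) on x^(k-1) theta_2.  These two or
    three linear forms on cocycles vanish on coboundaries, and a cocycle on which
    they vanish is a coboundary ([coboundary_predP]).  They vanish on odd
    cocycles, which is why the cohomology is purely even.

    It remains to see that the explicit cocycles form a dual basis, up to
    nonzero factors ([quotmod_dual_basis]).  For mu = lam, multiplication by G'
    and by etabar_1 etabar_2 (G) are cocycles, and for nonzero lam the second
    cocycle of the statement is 2 lam times the latter plus the coboundary of
    2 theta_2 etabar_1.  The
    operator I = etabar_1 etabar_2^(2k-1) from densities of weight - k/2 to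
    densities of weight k/2 is invariant ([inv_op_coboundary]), so that composing
    a cocycle with I gives a cocycle.  The first two are the compositions
    with I of the cocycles of weight k/2, and the third one is the commutator of
    G' with I. *)

(** * Antiderivatives of smooth functions *)
Section Antiderivatives.
Variable R : realType.
Local Notation mu := (@lebesgue_measure R).
Implicit Types (f : R -> R) (a b x u : R).

Lemma continuous_integrable_itv f a u : continuous f ->
  mu.-integrable [set` `]a, u]] (EFin \o f).
Proof.
move=> cf.
apply: (@integrableS _ _ _ mu [set` `[a, u]]) => //.
  by apply: subset_itvr; rewrite bnd_simp.
apply: continuous_compact_integrable; first exact: segment_compact.
exact: continuous_subspaceT.
Qed.

Let int f a x := (\int[mu]_(t in [set` `]a, x]]) f t)%R.

Let int_indep f a b x : continuous f -> a <= b -> b <= x -> b <= 0 ->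
  int f a x - int f a 0 = int f b x - int f b 0.
Proof.
move=> cf ab bx b0.
have H u : b <= u -> int f b u = int f a u - int f a b.
  move=> bu; rewrite /int.
  rewrite (@Rintegral_itvB _ f (BRight a) (BRight u) b) ?bnd_simp //.
  exact: continuous_integrable_itv.
by rewrite (H x) // (H 0) //; ring.
Qed.

Lemma antiderivative_exists f : continuous f ->
  exists F : R -> R, forall x, is_derive x 1 F (f x).
Proof.
move=> cf.
(* The primitive is the integral from 0 to x, written as a difference of two
   integrals from a point below both 0 and x. *)
pose low x := Num.min x 0 - 1.
exists (fun x => int f (low x) x - int f (low x) 0) => x.
pose a := low x - 1.
have [dF dFE] : derivable (int f a) x 1 /\ derive1 (int f a) x = f x.
  apply: (@continuous_FTC1 _ f (BRight a) x (x + 1)).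
  - by rewrite ltrDl.
  - exact: continuous_integrable_itv.
  - rewrite /a /low /=; have := ge_min x x 0; rewrite lexx /= => h; rewrite lte_fin; lra.
  - exact: cf.
have D1 : is_derive x 1 (int f a - cst (int f a 0)) (f x).
  have D0 : is_derive x 1 (int f a) (f x).
    by apply: DeriveDef; [exact: dF|rewrite -dFE derive1E].
  by apply: is_derive_eq; rewrite subr0.
apply: (near_eq_is_derive _ D1).
near=> y => /=.
have ylt : `|x - y| < 1.
  by near: y; exists 1 => //=.
rewrite -(@int_indep f a (low y) y) //.
- have [] := leP x 0 => hx; have [] := leP y 0 => hy; rewrite /a /low;
  rewrite ?(min_l hx) ?(min_l hy) ?(min_r (ltW hx)) ?(min_r (ltW hy));
  move: ylt; rewrite ltr_norml => /andP[]; lra.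
- by rewrite /low; have := ge_min y y 0; rewrite lexx /=; lra.
- by rewrite /low; have := ge_min 0 y 0; rewrite lexx orbT /=; lra.
Unshelve. all: by end_near.
Qed.

Lemma smooth_continuous f : smooth f -> continuous f.
Proof. by move=> sf x; apply/differentiable_continuous/derivable1_diffP/(sf 0%N). Qed.

Lemma Cinf_antideriv (f : Cinf R) : exists F : Cinf R, Cinf_deriv F = f.
Proof.
have [F dF] := antiderivative_exists (smooth_continuous (@Cinf_smooth _ f)).
have dFE : derive1 F = f by apply/funext => x; rewrite derive1E; apply: derive_val.
have sF : smooth F.
  case=> [|n] x; first by apply: (@ex_derive _ _ _ _ _ _ _ (dF x)).
  by rewrite derive1Sn dFE; apply: Cinf_smooth.
by exists (Cinf_of sF); apply: val_inj.
Qed.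

End Antiderivatives.

(** * Pointwise computation with smooth functions *)
Section Evaluation.
Variables (R : realType) (t : R).
Implicit Types f g : Cinf R.

Lemma Cinf_evalD f g a b : f t = a -> g t = b -> (f + g) t = a + b.
Proof. by rewrite Cinf_valD => -> ->. Qed.

Lemma Cinf_evalN f a : f t = a -> (- f) t = - a.
Proof. by rewrite Cinf_valN => ->. Qed.

Lemma Cinf_evalM f g a b : f t = a -> g t = b -> (f * g) t = a * b.
Proof. by rewrite Cinf_valM => -> ->. Qed.

Lemma Cinf_evalZ c f a : f t = a -> (c *: f) t = c * a.
Proof. by rewrite Cinf_valZ => ->. Qed.

Lemma Cinf_eval_eq f g a : f = g -> g t = a -> f t = a.
Proof. by move=> ->. Qed.

Lemma Cinf_eval_trans f g a b : f t = a -> g t = b -> a = b -> f t = g t.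
Proof. by move=> -> ->. Qed.

Lemma Cinf_diffD f g f' g' : Cinf_deriv f = f' -> Cinf_deriv g = g' ->
  Cinf_deriv (f + g) = f' + g'.
Proof. by rewrite Cinf_derivD => -> ->. Qed.

Lemma Cinf_diffN f f' : Cinf_deriv f = f' -> Cinf_deriv (- f) = - f'.
Proof. by rewrite Cinf_derivN => ->. Qed.

Lemma Cinf_diffM f g f' g' : Cinf_deriv f = f' -> Cinf_deriv g = g' ->
  Cinf_deriv (f * g) = f' * g + f * g'.
Proof. by rewrite Cinf_derivM => -> ->. Qed.

Lemma Cinf_diffZ c f f' : Cinf_deriv f = f' -> Cinf_deriv (c *: f) = c *: f'.
Proof. by rewrite Cinf_derivZ => ->. Qed.

Lemma Cinf_diff_comp f f' g : Cinf_deriv f = f' -> Cinf_deriv f' = g ->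
  Cinf_deriv (Cinf_deriv f) = g.
Proof. by move=> ->. Qed.

End Evaluation.

Ltac Cinf_atom f :=
  lazymatch f with
  | (_ + _) => fail
  | (- _) => fail
  | (_ * _) => fail
  | (_ *: _) => fail
  | 0 => fail
  | 1 => fail
  | Cinf_id _ => fail
  | Cinf_deriv ?g => Cinf_atom g
  | _ => idtac
  end.

(** Solves [Cinf_deriv f = ?g], pushing the derivation to the atoms of [f]. *)
Ltac Cinf_diff :=
  lazymatch goal with
  | |- Cinf_deriv (?f + ?g) = _ => eapply Cinf_diffD; Cinf_diff
  | |- Cinf_deriv (- ?f) = _ => eapply Cinf_diffN; Cinf_diff
  | |- Cinf_deriv (?f * ?g) = _ => eapply Cinf_diffM; Cinf_diff
  | |- Cinf_deriv (?c *: ?f) = _ => eapply Cinf_diffZ; Cinf_diff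
  | |- Cinf_deriv 0 = _ => exact: Cinf_deriv0
  | |- Cinf_deriv 1 = _ => exact: Cinf_deriv1
  | |- Cinf_deriv (Cinf_id _) = _ => exact: Cinf_deriv_id
  | |- Cinf_deriv ?f = _ =>
      tryif Cinf_atom f then reflexivity
      else (eapply Cinf_diff_comp; [Cinf_diff | Cinf_diff])
  end.

(** Solves [f t = ?a], where [?a] becomes a polynomial expression in the values
    at [t] of the atoms of [f] and of their derivatives. *)
Ltac Cinf_eval :=
  lazymatch goal with
  | |- Cinf_val (?f + ?g) ?t = _ => eapply Cinf_evalD; Cinf_eval
  | |- Cinf_val (- ?f) ?t = _ => eapply Cinf_evalN; Cinf_eval
  | |- Cinf_val (?f * ?g) ?t = _ => eapply Cinf_evalM; Cinf_eval
  | |- Cinf_val (?c *: ?f) ?t = _ => eapply Cinf_evalZ; Cinf_eval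
  | |- Cinf_val 0 ?t = _ => exact: Cinf_val0
  | |- Cinf_val 1 ?t = _ => exact: Cinf_val1
  | |- Cinf_val (Cinf_id _) ?t = _ => exact: Cinf_val_id
  | |- Cinf_val (Cinf_deriv ?f) ?t = _ =>
      tryif Cinf_atom f then reflexivity
      else (eapply Cinf_eval_eq; [Cinf_diff | Cinf_eval])
  | |- _ => reflexivity
  end.

(** At each point, both sides of an identity between smooth functions are
    polynomials in the values of the atoms and of their derivatives; it is
    enough to compare these polynomials. *)
Ltac Cinf_field :=
  apply: CinfP => ?; eapply Cinf_eval_trans; [Cinf_eval|Cinf_eval|];
  repeat match goal with
  | |- context [Cinf_val ?f ?t] => generalize (Cinf_val f t) => ?
  end; field.

(** * Jets of superfunctions *)

Section Jets.
Variable R : realType.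
Implicit Types (f g : Cinf R) (F H : superfun R) (p : {poly R}) (t : R).

Definition Cinf_poly p : Cinf R := (map_poly (in_alg (Cinf R)) p).[Cinf_id R].

Lemma Cinf_poly0 : Cinf_poly 0 = 0.
Proof. by rewrite /Cinf_poly rmorph0 horner0. Qed.

Lemma Cinf_polyMXaddC p c :
  Cinf_poly (p * 'X + c%:P) = Cinf_poly p * Cinf_id R + c *: 1.
Proof. by rewrite /Cinf_poly rmorphD rmorphM /= map_polyX map_polyC hornerMXaddC. Qed.

Lemma Cinf_polyD p q : Cinf_poly (p + q) = Cinf_poly p + Cinf_poly q.
Proof. by rewrite /Cinf_poly rmorphD hornerD. Qed.

Lemma Cinf_polyN p : Cinf_poly (- p) = - Cinf_poly p.
Proof. by rewrite /Cinf_poly rmorphN hornerN. Qed.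

Lemma Cinf_polyXn j : Cinf_poly 'X^j = Cinf_id R ^+ j.
Proof. by rewrite /Cinf_poly map_polyXn hornerXn. Qed.

Lemma Cinf_polyE p : Cinf_poly p = \sum_(i < size p) p`_i *: Cinf_id R ^+ i.
Proof.
rewrite /Cinf_poly horner_coef size_map_poly; apply: eq_bigr => i _.
by rewrite coef_map /= mulr_algl.
Qed.

Lemma Cinf_polyZ c p : Cinf_poly (c *: p) = c *: Cinf_poly p.
Proof. by rewrite /Cinf_poly map_polyZ hornerZ /= mulr_algl. Qed.

Lemma Cinf_poly_val p t : Cinf_poly p t = p.[t].
Proof.
elim/poly_ind: p => [|p c IH]; first by rewrite Cinf_poly0 horner0.
by rewrite Cinf_polyMXaddC !Cinf_valE IH !hornerE.
Qed.

Lemma Cinf_poly_deriv p : Cinf_deriv (Cinf_poly p) = Cinf_poly p^`().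
Proof.
elim/poly_ind: p => [|p c IH]; first by rewrite deriv0 Cinf_poly0 Cinf_deriv0.
rewrite Cinf_polyMXaddC !Cinf_derivE IH scaler0 addr0 mulr1.
by rewrite derivMXaddC Cinf_polyD -[_ * 'X]addr0 -[0]polyC0 Cinf_polyMXaddC
   scale0r addr0 addrC.
Qed.

Lemma poly_antideriv p : exists q, q^`() = p.
Proof.
elim/poly_ind: p => [|p c [q <-]]; first by exists 0; rewrite deriv0.
pose r := \poly_(i < (size (q^`() * 'X + c%:P)%R).+1)
  (if i is j.+1 then (q^`() * 'X + c%:P)`_j / j.+1%:R else 0).
exists r; apply/polyP => i; rewrite coef_deriv coef_poly ltnS.
case: ltnP => [_|/leq_sizeP->//]; last by rewrite mul0rn.
by rewrite -[_ *+ _]mulr_natr divfK ?pnatr_eq0.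
Qed.

(** A Taylor polynomial, obtained by integrating the one of the derivative. *)
Lemma jet_interpolation n f t :
  exists p, forall i, (i < n)%N -> iter i (@Cinf_deriv R) (f - Cinf_poly p) t = 0.
Proof.
elim: n f => [|n IH] f; first by exists 0.
have [p' Hp'] := IH (Cinf_deriv f).
have [q qE] := poly_antideriv p'.
exists (q + (f t - q.[t])%:P) => -[_|i ilt].
  rewrite -[LHS]/((f - Cinf_poly (q + (f t - q.[t])%:P)) t).
  by rewrite Cinf_valD Cinf_valN Cinf_poly_val hornerD hornerC; ring.
rewrite iterSr Cinf_derivD Cinf_derivN Cinf_poly_deriv derivD derivC addr0 qE.
exact: Hp'.
Qed.

Definition vanishes t F :=
  [/\ sf0 F t = 0, sf1 F t = 0, sf2 F t = 0 & sf12 F t = 0].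

Let valD f g t : f t = 0 -> g t = 0 -> (f + g) t = 0.
Proof. by rewrite Cinf_valD => -> ->; rewrite addr0. Qed.

Let valN f t : f t = 0 -> (- f) t = 0.
Proof. by rewrite Cinf_valN => ->; rewrite oppr0. Qed.

Let valM f g t : g t = 0 -> (f * g) t = 0.
Proof. by rewrite Cinf_valM => ->; rewrite mulr0. Qed.

Lemma vanishesD t F H : vanishes t F -> vanishes t H -> vanishes t (F + H).
Proof. by case=> ? ? ? ? [? ? ? ?]; split; apply: valD. Qed.

Lemma vanishesN t F : vanishes t F -> vanishes t (- F).
Proof. by case=> ? ? ? ?; split; apply: valN. Qed.

Lemma vanishesMl t F H : vanishes t H -> vanishes t (F * H).
Proof.
by case=> ? ? ? ?; split; do ?apply: valD; do ?apply: valN; apply: valM.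
Qed.

Lemma vanishes_eq0 F : (forall t, vanishes t F) -> F = 0.
Proof. by move=> vF; apply: superfunP; apply: CinfP => t; case: (vF t). Qed.

Lemma etab1E F :
  etab1 F = SFun (sf1 F) (- Cinf_deriv (sf0 F)) (sf12 F) (- Cinf_deriv (sf2 F)).
Proof. by apply: superfunP => /=; ring. Qed.

Lemma etab2E F :
  etab2 F = SFun (sf2 F) (- sf12 F) (- Cinf_deriv (sf0 F)) (Cinf_deriv (sf1 F)).
Proof. by apply: superfunP => /=; ring. Qed.

Lemma dens_actE (lam : R) g0 g1 g2 g12 f0 f1 f2 f12 :
  let D := @Cinf_deriv R in
  dens_act lam (SFun g0 g1 g2 g12) (SFun f0 f1 f2 f12) =
  SFun (g0 * D f0 + 2^-1 *: (g1 * f1 + g2 * f2) + lam *: (D g0 * f0))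
    (g0 * D f1 + 2^-1 *: (g1 * D f0 + D g0 * f1 - g2 * f12 + g12 * f2)
      + lam *: (D g0 * f1 + D g1 * f0))
    (g0 * D f2 + 2^-1 *: (g2 * D f0 + D g0 * f2 + g1 * f12 - g12 * f1)
      + lam *: (D g0 * f2 + D g2 * f0))
    (g0 * D f12 + D g0 * f12
      + 2^-1 *: (g1 * D f2 - g2 * D f1 + D g1 * f2 - D g2 * f1)
      + lam *: (D g0 * f12 + D g12 * f0 + D g1 * f2 - D g2 * f1)).
Proof.
move=> D; rewrite {}/D /dens_act /contact !etab1E !etab2E.
by apply: superfunP; rewrite /=; Cinf_field.
Qed.

Lemma contact_bracketE g0 g1 g2 g12 h0 h1 h2 h12 :
  let D := @Cinf_deriv R in
  contact_bracket (SFun g0 g1 g2 g12) (SFun h0 h1 h2 h12) =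
  SFun (g0 * D h0 - D g0 * h0 + 2^-1 *: (g1 * h1 + g2 * h2))
   (g0 * D h1 - D g1 * h0 - 2^-1 *: (D g0 * h1 - g1 * D h0 + g2 * h12 - g12 * h2))
   (g0 * D h2 - D g2 * h0 - 2^-1 *: (D g0 * h2 - g2 * D h0 + g12 * h1 - g1 * h12))
   (g0 * D h12 - D g12 * h0
    + 2^-1 *: (g1 * D h2 - g2 * D h1 - D g1 * h2 + D g2 * h1)).
Proof.
move=> D; rewrite {}/D /contact_bracket !etab1E !etab2E.
by apply: superfunP; rewrite /=; Cinf_field.
Qed.

Lemma dx_etab1 F : dx (etab1 F) = etab1 (dx F).
Proof. by apply: superfunP; rewrite /= ?Cinf_derivE; ring. Qed.

Lemma dx_etab2 F : dx (etab2 F) = etab2 (dx F).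
Proof. by apply: superfunP; rewrite /= ?Cinf_derivE; ring. Qed.

Lemma iter_dx_etab1 i F : iter i (@dx R) (etab1 F) = etab1 (iter i (@dx R) F).
Proof. by elim: i => //= i ->; rewrite dx_etab1. Qed.

Lemma iter_dx_etab2 i F : iter i (@dx R) (etab2 F) = etab2 (iter i (@dx R) F).
Proof. by elim: i => //= i ->; rewrite dx_etab2. Qed.

Definition flat n t F := forall i, (i < n)%N -> vanishes t (iter i (@dx R) F).

Lemma flat_le n m t F : (n <= m)%N -> flat m t F -> flat n t F.
Proof. by move=> nm fF i il; apply: fF; apply: leq_trans nm. Qed.

Lemma flat_etab1 n t F : flat n.+1 t F -> flat n t (etab1 F).
Proof.
move=> fF i il; rewrite iter_dx_etab1 /etab1.
apply: vanishesD; last by apply/vanishesN/vanishesMl; exact: (fF i.+1).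
by have [? ? ? ?] := fF i (leqW il); split.
Qed.

Lemma flat_etab2 n t F : flat n.+1 t F -> flat n t (etab2 F).
Proof.
move=> fF i il; rewrite iter_dx_etab2 /etab2.
apply: vanishesD; last by apply/vanishesN/vanishesMl; exact: (fF i.+1).
by have [? ? ? ?] := fF i (leqW il); split => //; apply: valN.
Qed.

Lemma flat_eta_mono lm n t F :
  flat (lm.1 + lm.2 + n) t F -> flat n t (eta_mono lm F).
Proof.
case: lm => l m /=; rewrite /eta_mono /= -addnA.
elim: l n => [|l IHl] n; last first.
  move=> fF; apply: flat_etab1; apply: IHl.
  by rewrite !addnS -addSn.
rewrite !add0n; elim: m n => [|m IHm] n; first by rewrite add0n.
by move=> fF; apply: flat_etab2; apply: IHm; rewrite addnS -addSn.
Qed.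

(** A differential operator of order less than [n] only sees jets of order
    less than [n]; each etabar_i lowers flatness by at most one. *)
Lemma is_diffop_flat A : is_diffop A ->
  exists n, forall t F, flat n t F -> vanishes t (A F).
Proof.
case=> s As; exists (\max_(u <- s) (u.2.1 + u.2.2 + 1))%N => t F fF; rewrite As.
rewrite big_seq; elim/big_ind: _ => //.
- by move=> *; exact: vanishesD.
- move=> u us; apply: vanishesMl.
  suff H : flat 1 t (eta_mono u.2 F) by exact: (H 0%N).
  apply: flat_eta_mono.
  by apply: flat_le fF; apply: (@leq_bigmax_seq _ s predT (fun u => u.2.1 + u.2.2 + 1)%N).
Qed.

Definition sf_in (a b : bool) f : superfun R :=
  match a, b with
  | false, false => SFun f 0 0 0
  | true, false => SFun 0 f 0 0
  | false, true => SFun 0 0 f 0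
  | true, true => SFun 0 0 0 f
  end.

Lemma sf_in_linear a b : linear (sf_in a b).
Proof.
by move=> c f g; case: a; case: b; apply: superfunP; rewrite //= scaler0 addr0.
Qed.
HB.instance Definition _ a b := GRing.isLinear.Build R (Cinf R) (superfun R) _
  (sf_in a b) (sf_in_linear a b).

Lemma sf_in_decomp F : F = sf_in false false (sf0 F) + sf_in true false (sf1 F)
  + sf_in false true (sf2 F) + sf_in true true (sf12 F).
Proof. by apply: superfunP; rewrite /= ?addr0 ?add0r. Qed.

Definition sf_mono (a b : bool) j : superfun R := sf_in a b (Cinf_id R ^+ j).

HB.instance Definition _ (A : diffop R) :=
  GRing.isLinear.Build R (superfun R) (superfun R) _ (diffop_val A)
    (is_diffop_linear (diffop_is_diffop A)).

(** Near a point, any superfunction may be replaced by its Taylor polynomial,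
    so that an operator is determined by its values on monomials. *)
Lemma diffop_eq0 (A : diffop R) : (forall a b j, A (sf_mono a b j) = 0) -> A = 0.
Proof.
move=> A0; apply: diffopP => F; apply: vanishes_eq0 => t.
have Apoly a b p : A (sf_in a b (Cinf_poly p)) = 0.
  rewrite Cinf_polyE !linear_sum big1 // => i _.
  by rewrite !linearZ /= A0 scaler0.
have [n nP] := is_diffop_flat (diffop_is_diffop A).
have [p0 h0] := jet_interpolation n (sf0 F) t.
have [p1 h1] := jet_interpolation n (sf1 F) t.
have [p2 h2] := jet_interpolation n (sf2 F) t.
have [p3 h3] := jet_interpolation n (sf12 F) t.
pose P := SFun (Cinf_poly p0) (Cinf_poly p1) (Cinf_poly p2) (Cinf_poly p3).
have AP : A P = 0.
  rewrite (sf_in_decomp P) 3!linearD.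
  by rewrite [X in X + _ + _ + _]Apoly [X in _ + X + _ + _]Apoly
    [X in _ + X + _]Apoly [X in _ + X]Apoly !addr0.
have -> : A F = A (F - P) by rewrite linearB /= AP subr0.
apply: nP => i il.
have -> : iter i (@dx R) (F - P) = SFun (iter i (@Cinf_deriv R) (sf0 F - Cinf_poly p0))
   (iter i (@Cinf_deriv R) (sf1 F - Cinf_poly p1)) (iter i (@Cinf_deriv R) (sf2 F - Cinf_poly p2))
   (iter i (@Cinf_deriv R) (sf12 F - Cinf_poly p3)).
  by elim: i {il} => //= i ->.
by split; [exact: h0|exact: h1|exact: h2|exact: h3].
Qed.

End Jets.

(** * The cocycle equation on homogeneous elements *)
Arguments dens_act : simpl never.
Arguments contact_bracket : simpl never.

Section Homogeneous.
Variable R : realType.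
Local Notation superfun := (superfun R).
Local Notation diffop := (diffop R).
Implicit Types (A B v : diffop) (F : superfun) (G H : osp22 R).

Lemma diffop_valD A B F : (A + B) F = A F + B F. Proof. by []. Qed.
Lemma diffop_valN A F : (- A) F = - A F. Proof. by []. Qed.
Lemma diffop_valZ a A F : (a *: A) F = a *: A F. Proof. by []. Qed.
Lemma diffop_val0 F : (0 : diffop) F = 0. Proof. by []. Qed.
Lemma diffop_val_comp A B F : diffop_comp A B F = A (B F). Proof. by []. Qed.
Lemma part_opE p F : part_op R p F = sf_part p F. Proof. by []. Qed.

Definition diffop_valE :=
  (diffop_valD, diffop_valN, diffop_valZ, diffop_val0, diffop_val_comp, part_opE).

Lemma sf_part_sum F : sf_part false F + sf_part true F = F.
Proof. by apply: superfunP; rewrite /= ?addr0 ?add0r. Qed.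

Lemma diffop_partE r A F : diffop_part r A F =
  sf_part r (A (sf_part false F)) + sf_part (~~ r) (A (sf_part true F)).
Proof. by rewrite /diffop_part big_bool addrC !diffop_valE. Qed.

Lemma diffop_part_sum A : diffop_part false A + diffop_part true A = A.
Proof.
apply: diffopP => F; rewrite diffop_valE !diffop_partE addrACA.
by rewrite sf_part_sum [X in _ + X]addrC sf_part_sum -linearD sf_part_sum.
Qed.

(** The linear extension of [(-1)^|A| A].  It turns all signs of the theory
    that depend on the parity of an operator into a conjugation by
    [sf_sign] ([twistE]), so that operators need not be homogeneous. *)
Definition twist A : diffop := diffop_part false A - diffop_part true A.

Arguments twist : simpl never.

Lemma twistE A F : twist A F = sf_sign (A (sf_sign F)).
Proof.
have -> : sf_sign F = sf_part false F - sf_part true F.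
  by apply: superfunP; rewrite /= ?subr0 ?sub0r.
rewrite linearB /twist !diffop_valE !diffop_partE.
by apply: superfunP => /=; ring.
Qed.

Lemma twist_linear : linear twist.
Proof.
move=> a A B; apply: diffopP => F.
by rewrite !twistE [RHS]diffop_valD diffop_valZ !twistE !diffop_valE linearP.
Qed.
HB.instance Definition _ := GRing.isLinear.Build R diffop diffop _ twist twist_linear.

Definition tw (p : bool) A := if p then twist A else A.

Lemma sf_signK : involutive (@sf_sign R).
Proof. by move=> F; apply: superfunP; rewrite /= ?opprK. Qed.

Lemma twistK : involutive twist.
Proof. by move=> A; apply: diffopP => F; rewrite !twistE !sf_signK. Qed.

Lemma twK p : involutive (tw p).
Proof. by case: p => // A; exact: twistK. Qed.

Lemma tw_linear p : linear (tw p).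
Proof. by case: p => //; exact: twist_linear. Qed.
HB.instance Definition _ p := GRing.isLinear.Build R diffop diffop _ (tw p) (tw_linear p).

Lemma twE p A F : tw p A F = if p then sf_sign (A (sf_sign F)) else A F.
Proof. by case: p => //; exact: twistE. Qed.

(** Two instances of the signs of the coboundary operators, summed over the
    homogeneous components of an operator. *)
Lemma tw_parts p q A :
  \sum_(r : bool) (-1) ^+ (p && r) *: diffop_part (q (+) r) A
  = (-1) ^+ (p && q) *: tw p A.
Proof.
rewrite big_bool; case: p; case: q; rewrite /tw /twist /= ?expr0 ?expr1 ?scale1r ?scaleN1r.
- rewrite opprB addrC; reflexivity.
- rewrite addrC; reflexivity.
- exact: diffop_part_sum.
- rewrite addrC; exact: diffop_part_sum.
Qed.

Lemma tw_parts2 p q A :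
  \sum_(r : bool) (-1) ^+ (q && (p (+) r)) *: diffop_part (p (+) r) A = tw q A.
Proof.
rewrite big_bool; case: p; case: q; rewrite /tw /twist /= ?expr0 ?expr1 ?scale1r ?scaleN1r.
- reflexivity.
- exact: diffop_part_sum.
- rewrite addrC; reflexivity.
- rewrite addrC; exact: diffop_part_sum.
Qed.

Definition homog (p : bool) G := osp_part p G = G.

Lemma homog_sf p G : homog p G -> sf_part p G = G.
Proof. by move=> pG; rewrite -[in RHS]pG. Qed.

Lemma homog_sfN p G : homog p G -> sf_part (~~ p) G = 0.
Proof. by move=> /homog_sf <-; case: p; apply: superfunP. Qed.

Lemma homog_partN p G : homog p G -> osp_part (~~ p) G = 0.
Proof. by move=> /homog_sfN pG; apply: val_inj. Qed.

Lemma homog_part p G : homog p (osp_part p G).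
Proof. by apply: val_inj; case: p. Qed.

Lemma osp_part_sum G : osp_part false G + osp_part true G = G.
Proof. by apply: val_inj; apply: superfunP; rewrite /= ?addr0 ?add0r. Qed.

Lemma dens_act_linear lam K : linear (dens_act lam K : superfun -> superfun).
Proof. exact: (is_diffop_linear (is_diffop_dens lam K)). Qed.
HB.instance Definition _ lam K := GRing.isLinear.Build R superfun superfun _
  (dens_act lam K) (dens_act_linear lam K).

Lemma dens_act_lin lam a K L F :
  dens_act lam (a *: K + L) F = a *: dens_act lam K F + dens_act lam L F.
Proof.
case: K => k0 k1 k2 k12; case: L => l0 l1 l2 l12; case: F => f0 f1 f2 f12.
rewrite -[_ *: SFun k0 _ _ _ + _]/(SFun (a *: k0 + l0) (a *: k1 + l1)
  (a *: k2 + l2) (a *: k12 + l12)).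
by rewrite !dens_actE; apply: superfunP; rewrite /=; Cinf_field.
Qed.

Lemma dens_act0 lam F : dens_act lam 0 F = 0.
Proof.
by have := dens_act_lin lam (-1) 0 0 F; rewrite scaler0 addr0 scaleN1r addNr.
Qed.

Lemma diffop_act_homog lam mu p G A F : homog p G ->
  diffop_act lam mu G A F = dens_act mu G (A F) - tw p A (dens_act lam G F).
Proof.
move=> pG.
pose a q r := dens_act mu (sf_part q G) (diffop_part r A F)
     - (-1) ^+ (r && q) *: diffop_part r A (dens_act lam (sf_part q G) F).
pose D q r := diffop_comp (dens_op mu (sf_part q G)) (diffop_part r A) -
  (-1) ^+ (r && q) *: diffop_comp (diffop_part r A) (dens_op lam (sf_part q G)).
have aE q r : D q r F = a q r.
  by rewrite /D diffop_valD diffop_valN diffop_valZ !diffop_val_comp.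
have -> : diffop_act lam mu G A = D true true + D true false + (D false true + D false false).
  by rewrite /diffop_act big_bool 2!big_bool.
clearbody D; rewrite !diffop_valD !aE.
have az r : a (~~ p) r = 0.
  by rewrite /a (homog_sfN pG) !dens_act0 linear0 scaler0 subr0.
have ap : a p true + a p false = dens_act mu G (A F) - tw p A (dens_act lam G F).
  rewrite /a (homog_sf pG) addrACA -linearD -opprD; congr (_ - _).
    by rewrite -[in RHS](diffop_part_sum A) addrC.
  case: (p); rewrite /= ?expr0 ?expr1 ?scale1r ?scaleN1r; last first.
    by rewrite -[in RHS](diffop_part_sum A) addrC.
  by rewrite addrC /twist.
by case: (p) az ap => az ap; rewrite ?(az true) ?(az false) ap ?addr0 ?add0r.
Qed.

Section Cochains.
Variables lam mu : R.
Local Notation gpart := (@osp_part R).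
Local Notation vpart := (fun r => diffop_part r : {linear diffop -> diffop}).
Local Notation act := (fun G : osp22 R => diffop_act lam mu G : {linear diffop -> diffop}).
Implicit Types U : osp22 R -> diffop.

Lemma delta0E v G F : delta0 gpart vpart act v G F =
  (dens_act mu (sf_part true G) (twist v F) - v (dens_act lam (sf_part true G) F))
  + (dens_act mu (sf_part false G) (v F) - v (dens_act lam (sf_part false G) F)).
Proof.
have H q K : homog q K -> (\sum_(r : bool) (-1) ^+ (q && r) *:
    diffop_act lam mu K (diffop_part r v)) F
    = dens_act mu K (tw q v F) - v (dens_act lam K F).
  move=> qK.
  under eq_bigr => r _ do rewrite -linearZ.
  rewrite -linear_sum (tw_parts q false) andbF expr0 scale1r (diffop_act_homog _ _ _ _ qK).
  by rewrite twK.
by rewrite /delta0 big_bool diffop_valD !(H _ _ (homog_part _ _)).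
Qed.

Lemma delta0_homog v p G F : homog p G ->
  delta0 gpart vpart act v G F =
  dens_act mu G (tw p v F) - v (dens_act lam G F).
Proof.
move=> pG; rewrite delta0E.
have z w F0 : dens_act mu 0 (w F0) - v (dens_act lam 0 F0) = 0.
  by rewrite !dens_act0 linear0 subr0.
case: p pG => pG; rewrite (homog_sf pG) (homog_sfN pG) z ?addr0 ?add0r //.
Qed.

Lemma delta0_linear_osp v : linear (delta0 gpart vpart act v).
Proof.
move=> a G H; apply: diffopP => F; rewrite diffop_valD diffop_valZ !delta0E.
rewrite -[osp_val (a *: G + H)]/(a *: osp_val G + osp_val H) !linearP !dens_act_lin.
have linD (x1 x2 y1 y2 : superfun) :
    (a *: x1 + x2) + (a *: y1 + y2) = a *: (x1 + y1) + (x2 + y2).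
  by rewrite scalerDr addrACA.
by rewrite !linearP !linD.
Qed.

Definition delta1_term (p q : bool) U G H F : superfun :=
  (-1) ^+ (p && q) *: (dens_act mu G (tw p (U H) F) - U H (dens_act lam G F))
  - (dens_act mu H (tw q (U G) F) - U G (dens_act lam H F))
  - U (osp_bracket G H) F.

Lemma osp_bracket0r G : osp_bracket G 0 = 0.
Proof.
apply: val_inj => /=.
by rewrite /contact_bracket !linear0 !mulr0 addr0 scaler0 !subr0.
Qed.

Lemma osp_bracket0l G : osp_bracket 0 G = 0.
Proof.
apply: val_inj => /=.
by rewrite /contact_bracket !linear0 !mul0r addr0 scaler0 !subr0.
Qed.

Lemma hom_partE U r H : hom_part gpart vpart r U H =
  diffop_part (~~ r) (U (osp_part true H)) + diffop_part r (U (osp_part false H)).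
Proof. by rewrite /hom_part big_bool addTb addFb. Qed.

Lemma hom_part_homog U r q H : linear U -> homog q H ->
  hom_part gpart vpart r U H = diffop_part (q (+) r) (U H).
Proof.
move=> lU qH.
have U0 : U 0 = 0 by have := lU (-1) 0 0; rewrite scaler0 addr0 scaleN1r addNr.
have z s : diffop_part s (U 0) = 0 by rewrite U0 linear0.
by rewrite hom_partE; case: q qH => qH; rewrite qH (homog_partN qH) z ?addr0 ?add0r.
Qed.

Lemma hom_part_sum U : linear U ->
  hom_part gpart vpart true U + hom_part gpart vpart false U = U.
Proof.
move=> lU; apply/funext => G.
rewrite -[LHS]/(hom_part gpart vpart true U G + hom_part gpart vpart false U G).
rewrite !hom_partE addrACA diffop_part_sum [X in _ + X]addrC diffop_part_sum.
by rewrite -[U (osp_part true G)]scale1r -lU scale1r addrC osp_part_sum.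
Qed.

Lemma delta1_summand p q U G H F : linear U -> homog p G -> homog q H ->
  (\sum_(r : bool)
    ((-1) ^+ (p && r) *: diffop_act lam mu G (hom_part gpart vpart r U H)
     - (-1) ^+ (q && (p (+) r)) *: diffop_act lam mu H (hom_part gpart vpart r U G)
     - hom_part gpart vpart r U (osp_bracket G H))) F
  = delta1_term p q U G H F.
Proof.
move=> lU pG qH; rewrite 2!sumrB 2!diffop_valD 2!diffop_valN.
congr (_ - _ - _).
- transitivity (((-1) ^+ (p && q) *: diffop_act lam mu G (tw p (U H))) F).
    rewrite -[_ *: diffop_act _ _ _ _]linearZ -tw_parts linear_sum.
    congr (diffop_val _ F); apply: eq_bigr => r _.
    by rewrite (hom_part_homog _ lU qH) -linearZ.
  by rewrite diffop_valZ (diffop_act_homog _ _ _ _ pG) twK.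
- transitivity (diffop_act lam mu H (tw q (U G)) F).
    rewrite -(tw_parts2 p) linear_sum.
    congr (diffop_val _ F); apply: eq_bigr => r _.
    by rewrite (hom_part_homog _ lU pG) -linearZ.
  by rewrite (diffop_act_homog _ _ _ _ qH) twK.
- by rewrite big_bool -[in RHS](hom_part_sum lU).
Qed.

(** On homogeneous fields, the sum over the parities in the cocycle equation
    collapses to [delta1_term], whose signs are carried by [tw]. *)
Lemma is_cocycleP U : linear U ->
  is_cocycle gpart vpart (@osp_bracket R) act U <->
  (forall p q G H F, homog p G -> homog q H -> delta1_term p q U G H F = 0).
Proof.
move=> lU.
have U0 : U 0 = 0 by have := lU (-1) 0 0; rewrite scaler0 addr0 scaleN1r addNr.
have E G H F : delta1 gpart vpart (@osp_bracket R) act U G H F =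
    delta1_term true true U (osp_part true G) (osp_part true H) F
    + delta1_term true false U (osp_part true G) (osp_part false H) F
    + (delta1_term false true U (osp_part false G) (osp_part true H) F
    + delta1_term false false U (osp_part false G) (osp_part false H) F).
  pose S p q : diffop := \sum_(r : bool)
    ((-1) ^+ (p && r) *: diffop_act lam mu (osp_part p G) (hom_part gpart vpart r U (osp_part q H))
     - (-1) ^+ (q && (p (+) r)) *: diffop_act lam mu (osp_part q H) (hom_part gpart vpart r U (osp_part p G))
     - hom_part gpart vpart r U (osp_bracket (osp_part p G) (osp_part q H))).
  have SE p q : S p q F = delta1_term p q U (osp_part p G) (osp_part q H) F.
    exact: (delta1_summand _ lU (homog_part _ _) (homog_part _ _)).
  have -> : delta1 gpart vpart (@osp_bracket R) act U G H =
      S true true + S true false + (S false true + S false false).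
    by rewrite /delta1 big_bool; congr (_ + _); exact: big_bool.
  by clearbody S; rewrite !diffop_valD !SE.
split=> [cU p q G H F pG qH | cU G H]; last first.
  by apply: diffopP => F; rewrite E !cU ?addr0 //; exact: homog_part.
have tw0 s : tw s 0 = 0 by exact: linear0.
have dens0 K : dens_act mu K (0 : superfun) = 0 by exact: linear0.
have UK0 K : U K 0 = 0 by exact: linear0.
have z1 p' q' K : delta1_term p' q' U 0 K F = 0.
  rewrite /delta1_term osp_bracket0l U0 !dens_act0 tw0 UK0 !diffop_val0 dens0.
  by rewrite !subr0 scaler0.
have z2 p' q' K : delta1_term p' q' U K 0 F = 0.
  rewrite /delta1_term osp_bracket0r U0 !dens_act0 tw0 UK0 !diffop_val0 dens0.
  by rewrite !subr0 scaler0.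
have := E G H F; rewrite cU diffop_val0.
case: p pG => pG; case: q qH => qH; rewrite !pG !(homog_partN pG) !qH !(homog_partN qH) !(z1,z2);
by rewrite ?addr0 ?add0r.
Qed.

End Cochains.
End Homogeneous.

(** * Generators of osp(2|2), and coboundaries *)
Section OspElements.
Variable R : realType.
Local Notation superfun := (superfun R).
Local Notation diffop := (diffop R).
Implicit Types (F K : superfun) (G H : osp22 R).

Lemma in_osp_coord a b c q1 q2 p1 p2 d : in_osp (@osp_coord R a b c q1 q2 p1 p2 d).
Proof. by apply/in_ospP; exists a, b, c, q1, q2, p1, p2, d. Qed.

Definition osp_vec a b c q1 q2 p1 p2 d : osp22 R :=
  osp_of (in_osp_coord a b c q1 q2 p1 p2 d).

Lemma osp_vecP G : exists a b c q1 q2 p1 p2 d, G = osp_vec a b c q1 q2 p1 p2 d.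
Proof.
have /in_ospP[a [b [c [q1 [q2 [p1 [p2 [d GE]]]]]]]] := osp22_in G.
by exists a, b, c, q1, q2, p1, p2, d; apply: val_inj.
Qed.

Lemma osp_vec_lin k a b c q1 q2 p1 p2 d a' b' c' q1' q2' p1' p2' d' :
  k *: osp_vec a b c q1 q2 p1 p2 d + osp_vec a' b' c' q1' q2' p1' p2' d' =
  osp_vec (k * a + a') (k * b + b') (k * c + c') (k * q1 + q1') (k * q2 + q2')
    (k * p1 + p1') (k * p2 + p2') (k * d + d').
Proof. by apply: val_inj; apply: superfunP; rewrite /=; Cinf_field. Qed.

Lemma osp_vecZ k a b c q1 q2 p1 p2 d :
  k *: osp_vec a b c q1 q2 p1 p2 d =
  osp_vec (k * a) (k * b) (k * c) (k * q1) (k * q2) (k * p1) (k * p2) (k * d).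
Proof. by apply: val_inj; apply: superfunP; rewrite /=; Cinf_field. Qed.

Lemma osp_vec_eq a b c q1 q2 p1 p2 d a' b' c' q1' q2' p1' p2' d' :
  a = a' -> b = b' -> c = c' -> q1 = q1' -> q2 = q2' -> p1 = p1' -> p2 = p2' ->
  d = d' ->
  osp_vec a b c q1 q2 p1 p2 d = osp_vec a' b' c' q1' q2' p1' p2' d'.
Proof. by do 8!move=> ->. Qed.

Lemma osp_vec0 : osp_vec 0 0 0 0 0 0 0 0 = 0.
Proof. by apply: val_inj; apply: superfunP; rewrite /=; Cinf_field. Qed.

Lemma osp_bracket_vec a b c q1 q2 p1 p2 d a' b' c' q1' q2' p1' p2' d' :
  osp_bracket (osp_vec a b c q1 q2 p1 p2 d) (osp_vec a' b' c' q1' q2' p1' p2' d') =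
  osp_vec (a * b' - b * a' + 2^-1 * (p1 * p1' + p2 * p2'))
    (2 * (a * c' - c * a') + 2^-1 * (q1 * p1' + q2 * p2' + p1 * q1' + p2 * q2'))
    (b * c' - c * b' + 2^-1 * (q1 * q1' + q2 * q2'))
    (p1 * c' - c * p1' + 2^-1 * (b * q1' - q1 * b' - q2 * d' + d * q2'))
    (p2 * c' - c * p2' + 2^-1 * (b * q2' - q2 * b' + q1 * d' - d * q1'))
    (a * q1' - q1 * a' + 2^-1 * (p1 * b' - b * p1' - p2 * d' + d * p2'))
    (a * q2' - q2 * a' + 2^-1 * (p2 * b' - b * p2' + p1 * d' - d * p1'))
    (2^-1 * (q2 * p1' - q1 * p2' + p1 * q2' - p2 * q1')).
Proof.
apply: val_inj; rewrite /= /contact_bracket !etab1E !etab2E.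
by apply: superfunP; rewrite /=; Cinf_field.
Qed.

Definition osp_1 := osp_vec 1 0 0 0 0 0 0 0.
Definition osp_x := osp_vec 0 1 0 0 0 0 0 0.
Definition osp_xx := osp_vec 0 0 1 0 0 0 0 0.
Definition osp_xt1 := osp_vec 0 0 0 1 0 0 0 0.
Definition osp_xt2 := osp_vec 0 0 0 0 1 0 0 0.
Definition osp_t1 := osp_vec 0 0 0 0 0 1 0 0.
Definition osp_t2 := osp_vec 0 0 0 0 0 0 1 0.
Definition osp_t12 := osp_vec 0 0 0 0 0 0 0 1.

Lemma osp_vec_decomp a b c q1 q2 p1 p2 d : osp_vec a b c q1 q2 p1 p2 d =
  a *: osp_1 + (b *: osp_x + (c *: osp_xx + (q1 *: osp_xt1 + (q2 *: osp_xt2 + (p1 *: osp_t1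
    + (p2 *: osp_t2 + (d *: osp_t12 + 0))))))).
Proof.
have <- := osp_vec0; rewrite /osp_1 /osp_x /osp_xx /osp_xt1 /osp_xt2 /osp_t1 /osp_t2 /osp_t12 !osp_vec_lin.
by apply: osp_vec_eq; ring.
Qed.

Lemma homog_even a b c d : homog false (osp_vec a b c 0 0 0 0 d).
Proof. by apply: val_inj; apply: superfunP; rewrite /=; Cinf_field. Qed.

Lemma homog_odd q1 q2 p1 p2 : homog true (osp_vec 0 0 0 q1 q2 p1 p2 0).
Proof. by apply: val_inj; apply: superfunP; rewrite /=; Cinf_field. Qed.

(** Densities form a representation of the contact bracket. *)
Lemma dens_act_bracket (lam : R) p q G H F : homog p G -> homog q H ->
  dens_act lam (osp_bracket G H) F =
  dens_act lam G (dens_act lam H F) - (-1) ^+ (p && q) *: dens_act lam H (dens_act lam G F).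
Proof.
move=> /homog_sf pG /homog_sf qH.
rewrite -[osp_val (osp_bracket _ _)]/(contact_bracket G H) -pG -qH.
case: (osp_val G) => g0 g1 g2 g12; case: (osp_val H) => h0 h1 h2 h12.
case: F => f0 f1 f2 f12 {pG qH}.
case: p; case: q; cbn [sf_part sf0 sf1 sf2 sf12 andb];
rewrite contact_bracketE ?expr0 ?expr1 ?scale1r ?scaleN1r !dens_actE;
by apply: superfunP; rewrite /=; Cinf_field.
Qed.

Lemma osp_1E : osp_1 = osp_vec 1 0 0 0 0 0 0 0. Proof. by []. Qed.
Lemma osp_xE : osp_x = osp_vec 0 1 0 0 0 0 0 0. Proof. by []. Qed.
Lemma osp_xxE : osp_xx = osp_vec 0 0 1 0 0 0 0 0. Proof. by []. Qed.
Lemma osp_xt1E : osp_xt1 = osp_vec 0 0 0 1 0 0 0 0. Proof. by []. Qed.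
Lemma osp_xt2E : osp_xt2 = osp_vec 0 0 0 0 1 0 0 0. Proof. by []. Qed.
Lemma osp_t1E : osp_t1 = osp_vec 0 0 0 0 0 1 0 0. Proof. by []. Qed.
Lemma osp_t2E : osp_t2 = osp_vec 0 0 0 0 0 0 1 0. Proof. by []. Qed.
Lemma osp_t12E : osp_t12 = osp_vec 0 0 0 0 0 0 0 1. Proof. by []. Qed.

Lemma homog_1 : homog false osp_1. Proof. exact: homog_even. Qed.
Lemma homog_x : homog false osp_x. Proof. exact: homog_even. Qed.
Lemma homog_t12 : homog false osp_t12. Proof. exact: homog_even. Qed.
Lemma homog_xt1 : homog true osp_xt1. Proof. exact: homog_odd. Qed.
Lemma homog_xt2 : homog true osp_xt2. Proof. exact: homog_odd. Qed.
Lemma homog_t1 : homog true osp_t1. Proof. exact: homog_odd. Qed.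
Lemma homog_t2 : homog true osp_t2. Proof. exact: homog_odd. Qed.

End OspElements.

(** Two generators are to be distinguished by their names; unfolded, they
    would be compared through their real coordinates. *)
Global Opaque osp_1 osp_x osp_xx osp_xt1 osp_xt2 osp_t1 osp_t2 osp_t12.

Section Cochains.
Variables (R : realType) (lam mu : R).
Local Notation superfun := (superfun R).
Local Notation diffop := (diffop R).
Implicit Types (F K : superfun) (G H : osp22 R) (v A : diffop).
Local Notation gpart := (@osp_part R).
Local Notation vpart := (fun r => diffop_part r : {linear diffop -> diffop}).
Local Notation act := (fun G : osp22 R => diffop_act lam mu G : {linear diffop -> diffop}).
Local Notation coboundary v := (delta0 gpart vpart act v).
Local Notation cocycle_of := (is_cocycle gpart vpart (@osp_bracket R) act).

Lemma sf_signB F K : sf_sign (F - K) = sf_sign F - sf_sign K.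
Proof. exact: linearB. Qed.

Lemma sf_signN F : sf_sign (- F) = - sf_sign F.
Proof. exact: linearN. Qed.

Lemma sf_signZ a F : sf_sign (a *: F) = a *: sf_sign F.
Proof. exact: linearZ. Qed.

Lemma diffopZ A a F : A (a *: F) = a *: A F.
Proof. exact: linearZ. Qed.

Lemma diffopN A F : A (- F) = - A F.
Proof. exact: linearN. Qed.

Lemma diffopD A F K : A (F + K) = A F + A K.
Proof. exact: linearD. Qed.

Lemma diffopB A F K : A (F - K) = A F - A K.
Proof. exact: linearB. Qed.

Lemma dens_actZ nu G a F : dens_act nu G (a *: F) = a *: dens_act nu G F.
Proof. exact: linearZ. Qed.

Lemma dens_actB nu G F K : dens_act nu G (F - K) = dens_act nu G F - dens_act nu G K.
Proof. exact: linearB. Qed.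

Lemma sf_sign_dens nu p G F : homog p G ->
  sf_sign (dens_act nu G F) = (-1) ^+ p *: dens_act nu G (sf_sign F).
Proof.
move=> /homog_sf <-.
case: (osp_val G) => g0 g1 g2 g12; case: F => f0 f1 f2 f12.
case: p; rewrite /sf_sign; cbn [sf_part sf0 sf1 sf2 sf12];
rewrite ?expr0 ?expr1 !dens_actE;
by apply: superfunP; rewrite /=; Cinf_field.
Qed.

Lemma tw_tw p q A : tw p (tw q A) = tw q (tw p A).
Proof. by case: p; case: q. Qed.

Lemma tw_coboundary v p q G F : homog p G ->
  tw q (coboundary v G) F = (-1) ^+ (p && q) *:
    (dens_act mu G (tw p (tw q v) F) - tw q v (dens_act lam G F)).
Proof.
move=> pG; case: q; last first.
  by rewrite andbF expr0 scale1r; exact: delta0_homog.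
rewrite andbT twE (delta0_homog _ _ _ _ pG) sf_signB (sf_sign_dens _ _ pG).
have -> : dens_act lam G (sf_sign F) = (-1) ^+ p *: sf_sign (dens_act lam G F).
  by rewrite (sf_sign_dens _ _ pG) scalerA -signr_addb addbb scale1r.
rewrite diffopZ sf_signZ -scalerBr.
by rewrite -!(twE true) (tw_tw p true).
Qed.

Lemma osp_part_bracket p q G H : homog p G -> homog q H -> homog (p (+) q) (osp_bracket G H).
Proof.
move=> /homog_sf pG /homog_sf qH; apply: val_inj.
rewrite /= -[osp_val G]pG -[osp_val H]qH /contact_bracket !etab1E !etab2E.
case: (osp_val G) => g0 g1 g2 g12; case: (osp_val H) => h0 h1 h2 h12.
by case: p {pG}; case: q {qH}; apply: superfunP; rewrite /=; Cinf_field.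
Qed.

(** The square of the differential vanishes: the terms cancel in pairs by
    [dens_act_bracket], for the weights [lam] and [mu]. *)
Lemma coboundary_cocycle v : cocycle_of (coboundary v).
Proof.
apply/is_cocycleP; first exact: delta0_linear_osp.
move=> p q G H F pG qH.
rewrite /delta1_term (@tw_coboundary v q p H F qH) (@tw_coboundary v p q G F pG).
rewrite (@delta0_homog _ lam mu v q H _ qH) (@delta0_homog _ lam mu v p G _ pG).
rewrite (@delta0_homog _ lam mu v _ _ F (osp_part_bracket pG qH)).
rewrite !(dens_act_bracket _ _ pG qH).
have -> : tw (p (+) q) v = tw p (tw q v).
  by clear; case: p; case: q => //; rewrite /tw twistK.
rewrite (tw_tw q p) andbC.
have alg (b : bool) (x1 x2 x3 x4 x5 x6 : superfun) :
    (-1) ^+ b *: ((-1) ^+ b *: (x1 - x2) - (x3 - x4))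
    - ((-1) ^+ b *: (x5 - x3) - (x2 - x6))
    - (x1 - (-1) ^+ b *: x5 - (x6 - (-1) ^+ b *: x4)) = 0.
  by case: b; rewrite ?expr0 ?expr1 ?scale1r ?scaleN1r; apply: superfunP => /=; ring.
rewrite !dens_actZ !dens_actB diffopB diffopZ; exact: alg.
Qed.

End Cochains.

(** * Linear cochains are differential *)
Section LinearCochains.
Variable R : realType.
Local Notation superfun := (superfun R).
Local Notation diffop := (diffop R).
Implicit Types (F K : superfun) (G H : osp22 R) (v A : diffop).

Lemma is_diffcochainD (U W : osp22 R -> diffop) :
  is_diffcochain U -> is_diffcochain W -> is_diffcochain (fun G => U G + W G).
Proof.
by move=> [s Us] [t Wt]; exists (s ++ t) => G F; rewrite diffop_valD big_cat Us Wt.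
Qed.

Lemma is_diffcochain_coord (k : osp22 R -> R) (K : superfun -> superfun) A :
  is_diffop K -> (forall G, K G = k G *: 1) -> is_diffcochain (fun G => k G *: A).
Proof.
move=> [s Ks] Kk; have [r Ar] := diffop_is_diffop A.
exists [seq (w.1 * u.1, u.2, w.2) | u <- s, w <- r] => G F.
rewrite diffop_valZ Ar big_allpairs_dep exchange_big scaler_sumr.
apply: eq_bigr => w _ /=.
transitivity (w.1 * K G * eta_mono w.2 F).
  by rewrite Kk -sf_scaleAr mulr1 scalerAl.
rewrite Ks mulr_sumr mulr_suml; apply: eq_bigr => u _.
by rewrite mulrA.
Qed.

(** The part of [H] free of thetas, as a differential operator in [H]: the
    even part minus its component in theta_1 theta_2, which is extracted by
    [- etabar_1 etabar_2]. *)
Definition sf_body (H : superfun) : superfun :=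
  sf_part false H + theta1 R * (theta2 R * etab1 (etab2 H)).

Lemma is_diffop_body B : is_diffop B -> is_diffop (fun F => sf_body (B F)).
Proof.
move=> dB; apply: is_diffopD; first exact: (@is_diffop_comp R (sf_part false) B (is_diffop_part _ _) dB).
by do 2!apply: is_diffopMl; apply/is_diffop_etab1/is_diffop_etab2.
Qed.

Lemma is_diffop_dx_comp (B : superfun -> superfun) : is_diffop B -> is_diffop (fun F => dx (B F)).
Proof. exact: (is_diffop_comp (is_diffop_dx R)). Qed.

Lemma sf_bodyE (H : superfun) : sf_body H = SFun (sf0 H) 0 0 0.
Proof. by rewrite /sf_body !etab1E !etab2E; apply: superfunP => /=; ring. Qed.

(** The eight coordinates of [G] in osp(2|2) are constant functions obtained
    from [G] by differential operators, and a linear map on osp(2|2) is a sum of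
    coordinates times fixed operators.  Thus being differential is no
    restriction on cochains. *)
Lemma linear_cochain (U : osp22 R -> diffop) : linear U -> U \in @cochain_pred R.
Proof.
move=> lU; apply/asboolP; split=> //.
have U0 : U 0 = 0 by have := lU (-1) 0 0; rewrite scaler0 addr0 scaleN1r addNr.
have did := @is_diffop_id R.
pose Kd F := - sf_body (etab1 (etab2 F)).
have dKd : is_diffop Kd by apply/is_diffopN/is_diffop_body/is_diffop_etab1/is_diffop_etab2.
pose P1 F := sf_body (etab1 F); have dP1 : is_diffop P1 by apply/is_diffop_body/is_diffop_etab1.
pose P2 F := sf_body (etab2 F); have dP2 : is_diffop P2 by apply/is_diffop_body/is_diffop_etab2.
have dB : is_diffop sf_body by apply: is_diffop_body.
pose x := sf_x R.
(* When P F is affine in x, this is its constant term. *)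
pose L (P : superfun -> superfun) F := P F - x * dx (P F).
have dL P : is_diffop P -> is_diffop (L P).
  by move=> dP; apply: is_diffopB => //; apply/is_diffopMl/is_diffop_dx_comp.
pose Kc F := 2^-1 *: dx (dx (sf_body F)).
have dKc : is_diffop Kc by apply/is_diffopZ/is_diffop_dx_comp/is_diffop_dx_comp.
pose Ka F := L sf_body F + x * (x * Kc F).
have dKa : is_diffop Ka by apply: is_diffopD; [exact: dL|do 2!apply: is_diffopMl].
pose k (K : superfun -> superfun) (G : osp22 R) : R := sf0 (K G) 0.
pose dxP P F := dx (P F) : superfun.
have ddx P : is_diffop P -> is_diffop (dxP P) by exact: is_diffop_dx_comp.
have E G : [/\ Ka G = k Ka G *: 1, L (dxP sf_body) G = k (L (dxP sf_body)) G *: 1,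
    Kc G = k Kc G *: 1, dxP P1 G = k (dxP P1) G *: 1 & dxP P2 G = k (dxP P2) G *: 1] /\
    [/\ L P1 G = k (L P1) G *: 1, L P2 G = k (L P2) G *: 1, Kd G = k Kd G *: 1 &
    U G = k Ka G *: U (osp_1 R) + (k (L (dxP sf_body)) G *: U (osp_x R) + (k Kc G *: U (osp_xx R) +
     (k (dxP P1) G *: U (osp_xt1 R) + (k (dxP P2) G *: U (osp_xt2 R) + (k (L P1) G *: U (osp_t1 R)
     + (k (L P2) G *: U (osp_t2 R) + k Kd G *: U (osp_t12 R)))))))].
  have [a [b [c [q1 [q2 [p1 [p2 [d GE]]]]]]]] := osp_vecP G.
  have kE (K : superfun -> superfun) r : K G = r *: 1 -> k K G = r.
    by rewrite /k => ->; rewrite -[LHS]/((r *: 1 : Cinf R) 0) Cinf_valZ Cinf_val1 mulr1.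
  have GE' : osp_val G = osp_coord a b c q1 q2 p1 p2 d by rewrite GE.
  have Ea : Ka G = a *: 1.
    rewrite /Ka /L /Kc !sf_bodyE GE'.
    by apply: superfunP; rewrite /=; Cinf_field.
  have Eb : L (dxP sf_body) G = b *: 1.
    rewrite /L /dxP !sf_bodyE GE'.
    by apply: superfunP; rewrite /=; Cinf_field.
  have Ec : Kc G = c *: 1.
    rewrite /Kc !sf_bodyE GE'.
    by apply: superfunP; rewrite /=; Cinf_field.
  have Eq1 : dxP P1 G = q1 *: 1.
    rewrite -[LHS]/(dx (sf_body (etab1 G))) sf_bodyE etab1E GE'.
    by apply: superfunP; rewrite /=; Cinf_field.
  have Eq2 : dxP P2 G = q2 *: 1.
    rewrite -[LHS]/(dx (sf_body (etab2 G))) sf_bodyE etab2E GE'.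
    by apply: superfunP; rewrite /=; Cinf_field.
  have Ep1 : L P1 G = p1 *: 1.
    rewrite -[LHS]/(sf_body (etab1 G) - x * dx (sf_body (etab1 G))) !sf_bodyE etab1E GE'.
    by apply: superfunP; rewrite /=; Cinf_field.
  have Ep2 : L P2 G = p2 *: 1.
    rewrite -[LHS]/(sf_body (etab2 G) - x * dx (sf_body (etab2 G))) !sf_bodyE etab2E GE'.
    by apply: superfunP; rewrite /=; Cinf_field.
  have Ed : Kd G = d *: 1.
    rewrite /Kd !sf_bodyE etab1E etab2E GE'.
    by apply: superfunP; rewrite /=; Cinf_field.
  rewrite (kE _ _ Ea) (kE _ _ Eb) (kE _ _ Ec) (kE _ _ Eq1) (kE _ _ Eq2) (kE _ _ Ep1)
    (kE _ _ Ep2) (kE _ _ Ed); split; split=> //.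
  by rewrite GE osp_vec_decomp !lU U0 addr0.
suff [s sP] : is_diffcochain (fun G => k Ka G *: U (osp_1 R) + (k (L (dxP sf_body)) G *: U (osp_x R)
     + (k Kc G *: U (osp_xx R) +
     (k (dxP P1) G *: U (osp_xt1 R) + (k (dxP P2) G *: U (osp_xt2 R) + (k (L P1) G *: U (osp_t1 R)
     + (k (L P2) G *: U (osp_t2 R) + k Kd G *: U (osp_t12 R)))))))).
  by exists s => G F; rewrite -sP; have [_ [_ _ _ {1}->]] := E G.
repeat apply: is_diffcochainD.
- by apply: (@is_diffcochain_coord (k Ka) Ka _ dKa) => H; case: (E H) => -[].
- by apply: (@is_diffcochain_coord (k (L (dxP sf_body))) _ _ (dL _ (ddx _ dB))) => H;
    case: (E H) => -[].
- by apply: (@is_diffcochain_coord (k Kc) Kc _ dKc) => H; case: (E H) => -[].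
- by apply: (@is_diffcochain_coord (k (dxP P1)) _ _ (ddx _ dP1)) => H; case: (E H) => -[].
- by apply: (@is_diffcochain_coord (k (dxP P2)) _ _ (ddx _ dP2)) => H; case: (E H) => -[].
- apply: (@is_diffcochain_coord (k (L P1)) _ _ (dL _ dP1)) => H.
  by case: (E H) => _ [e _ _ _]; exact: e.
- apply: (@is_diffcochain_coord (k (L P2)) _ _ (dL _ dP2)) => H.
  by case: (E H) => _ [_ e _ _]; exact: e.
- apply: (@is_diffcochain_coord (k Kd) _ _ dKd) => H.
  by case: (E H) => _ [_ _ e _]; exact: e.
Qed.

End LinearCochains.

(** * Operators commuting with the translations *)
Ltac osp_eq :=
  rewrite ?osp_1E ?osp_xE ?osp_xxE ?osp_xt1E ?osp_xt2E ?osp_t1E ?osp_t2E ?osp_t12E osp_bracket_vec osp_vecZ;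
  by apply: osp_vec_eq; field.

Section Brackets.
Variable R : realType.
Local Notation br := (@osp_bracket R).
Local Notation osp_1 := (osp_1 R).
Local Notation osp_x := (osp_x R).
Local Notation osp_xx := (osp_xx R).
Local Notation osp_xt1 := (osp_xt1 R).
Local Notation osp_xt2 := (osp_xt2 R).
Local Notation osp_t1 := (osp_t1 R).
Local Notation osp_t2 := (osp_t2 R).
Local Notation osp_t12 := (osp_t12 R).

Lemma br_1_t1 : br osp_1 osp_t1 = 0 *: osp_1. Proof. osp_eq. Qed.
Lemma br_1_t2 : br osp_1 osp_t2 = 0 *: osp_1. Proof. osp_eq. Qed.
Lemma br_t1_t1 : br osp_t1 osp_t1 = 2^-1 *: osp_1. Proof. osp_eq. Qed.
Lemma br_t2_t2 : br osp_t2 osp_t2 = 2^-1 *: osp_1. Proof. osp_eq. Qed.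
Lemma br_t1_t2 : br osp_t1 osp_t2 = 0 *: osp_1. Proof. osp_eq. Qed.
Lemma br_1_x : br osp_1 osp_x = 1 *: osp_1. Proof. osp_eq. Qed.
Lemma br_t1_x : br osp_t1 osp_x = 2^-1 *: osp_t1. Proof. osp_eq. Qed.
Lemma br_t2_x : br osp_t2 osp_x = 2^-1 *: osp_t2. Proof. osp_eq. Qed.
Lemma br_1_t12 : br osp_1 osp_t12 = 0 *: osp_1. Proof. osp_eq. Qed.
Lemma br_t1_t12 : br osp_t1 osp_t12 = 2^-1 *: osp_t2. Proof. osp_eq. Qed.
Lemma br_t2_t12 : br osp_t2 osp_t12 = - 2^-1 *: osp_t1. Proof. osp_eq. Qed.
Lemma br_1_xt1 : br osp_1 osp_xt1 = 1 *: osp_t1. Proof. osp_eq. Qed.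
Lemma br_1_xt2 : br osp_1 osp_xt2 = 1 *: osp_t2. Proof. osp_eq. Qed.
Lemma br_t1_xt1 : br osp_t1 osp_xt1 = 2^-1 *: osp_x. Proof. osp_eq. Qed.
Lemma br_t2_xt1 : br osp_t2 osp_xt1 = - 2^-1 *: osp_t12. Proof. osp_eq. Qed.
Lemma br_t1_xt2 : br osp_t1 osp_xt2 = 2^-1 *: osp_t12. Proof. osp_eq. Qed.
Lemma br_t2_xt2 : br osp_t2 osp_xt2 = 2^-1 *: osp_x. Proof. osp_eq. Qed.
Lemma br_xt1_xt1 : br osp_xt1 osp_xt1 = 2^-1 *: osp_xx. Proof. osp_eq. Qed.
Lemma br_x_t12 : br osp_x osp_t12 = 0 *: osp_1. Proof. osp_eq. Qed.
Lemma br_x_xt1 : br osp_x osp_xt1 = 2^-1 *: osp_xt1. Proof. osp_eq. Qed.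
Lemma br_x_xt2 : br osp_x osp_xt2 = 2^-1 *: osp_xt2. Proof. osp_eq. Qed.
Lemma br_t12_xt1 : br osp_t12 osp_xt1 = - 2^-1 *: osp_xt2. Proof. osp_eq. Qed.
Lemma br_t12_xt2 : br osp_t12 osp_xt2 = 2^-1 *: osp_xt1. Proof. osp_eq. Qed.

End Brackets.

Section Determination.
Variable R : realType.
Local Notation superfun := (superfun R).
Local Notation diffop := (diffop R).
Implicit Types (F K : superfun) (A : diffop).

(** The fields X_theta_i act on densities of any weight by
    [(d_i + theta_i d/dx)/2] ([dens_act_t1], [dens_act_t2]). *)
Definition half_eta1 F : superfun := SFun (2^-1 *: sf1 F) (2^-1 *: Cinf_deriv (sf0 F))
  (2^-1 *: sf12 F) (2^-1 *: Cinf_deriv (sf2 F)).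
Definition half_eta2 F : superfun := SFun (2^-1 *: sf2 F) (- (2^-1 *: sf12 F))
  (2^-1 *: Cinf_deriv (sf0 F)) (- (2^-1 *: Cinf_deriv (sf1 F))).

Lemma dens_act_1 nu F : dens_act nu (osp_1 R) F = dx F.
Proof.
case: F => f0 f1 f2 f12; rewrite osp_1E -[osp_val _]/(osp_coord _ _ _ _ _ _ _ _) dens_actE.
by apply: superfunP; rewrite /=; Cinf_field.
Qed.

Lemma dens_act_t1 nu F : dens_act nu (osp_t1 R) F = half_eta1 F.
Proof.
case: F => f0 f1 f2 f12; rewrite osp_t1E -[osp_val _]/(osp_coord _ _ _ _ _ _ _ _) dens_actE.
by apply: superfunP; rewrite /=; Cinf_field.
Qed.

Lemma dens_act_t2 nu F : dens_act nu (osp_t2 R) F = half_eta2 F.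
Proof.
case: F => f0 f1 f2 f12; rewrite osp_t2E -[osp_val _]/(osp_coord _ _ _ _ _ _ _ _) dens_actE.
by apply: superfunP; rewrite /=; Cinf_field.
Qed.

Definition ev0 F : R := sf0 F 0.

Lemma ev0_linear : linear_for *%R ev0.
Proof.
by move=> a F K; rewrite -[LHS]/((a *: sf0 F + sf0 K) 0) Cinf_valD Cinf_valZ.
Qed.
HB.instance Definition _ := GRing.isLinear.Build R superfun R _ ev0 ev0_linear.

Lemma ev0D F K : ev0 (F + K) = ev0 F + ev0 K. Proof. exact: linearD. Qed.
Lemma ev0B F K : ev0 (F - K) = ev0 F - ev0 K. Proof. exact: linearB. Qed.
Lemma ev0N F : ev0 (- F) = - ev0 F. Proof. exact: linearN. Qed.
Lemma ev0Z a F : ev0 (a *: F) = a * ev0 F. Proof. exact: linearZ. Qed.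

Lemma Cinf_deriv_eq0 (f : Cinf R) : Cinf_deriv f = 0 -> f 0 = 0 -> f = 0.
Proof.
move=> df f0; apply: CinfP => t; rewrite Cinf_val0 -f0.
apply: (@is_derive_0_is_cst R f) => x.
have dfx : derivable f x 1 by exact: (@Cinf_smooth _ f 0%N).
apply: DeriveDef => //; rewrite -derive1E.
by rewrite -[LHS]/(Cinf_deriv f x) df Cinf_val0.
Qed.

Lemma sf_sign_half_eta1 F : sf_sign (half_eta1 F) = - half_eta1 (sf_sign F).
Proof. by apply: superfunP; rewrite /=; Cinf_field. Qed.

Lemma sf_sign_half_eta2 F : sf_sign (half_eta2 F) = - half_eta2 (sf_sign F).
Proof. by apply: superfunP; rewrite /=; Cinf_field. Qed.

Lemma half_eta1_twist A : (forall F, half_eta1 (twist A F) = A (half_eta1 F)) ->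
  forall F, half_eta1 (A F) = twist A (half_eta1 F).
Proof.
move=> A1 F; rewrite twistE sf_sign_half_eta1 diffopN -A1 twistE sf_signK.
by rewrite sf_signN sf_sign_half_eta1 sf_signK opprK.
Qed.

Lemma half_eta2_twist A : (forall F, half_eta2 (twist A F) = A (half_eta2 F)) ->
  forall F, half_eta2 (A F) = twist A (half_eta2 F).
Proof.
move=> A2 F; rewrite twistE sf_sign_half_eta2 diffopN -A2 twistE sf_signK.
by rewrite sf_signN sf_sign_half_eta2 sf_signK opprK.
Qed.

(** Supercommutation with the translations; these are the operators with
    constant coefficients in terms of the etabar_i. *)
Definition nilinvariant A := [/\ forall F, dx (A F) = A (dx F),
  forall F, half_eta1 (twist A F) = A (half_eta1 F) &
  forall F, half_eta2 (twist A F) = A (half_eta2 F)].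

Definition in_poly F := exists p0 p1 p2 p12,
  F = SFun (Cinf_poly p0) (Cinf_poly p1) (Cinf_poly p2) (Cinf_poly p12) :> superfun.

(** Translating a value of [A F] to the origin: the components of [A F] at 0 are
    values at the origin of [A] on images of [F] under the [half_eta_i], and the
    derivative of [A F] is [A] of the derivative of [F].  Induction on the degree
    of [F] concludes. *)
Lemma nilinvariant_eq0 A : nilinvariant A ->
  (forall a b j, ev0 (A (sf_mono R a b j)) = 0) -> A = 0.
Proof.
move=> [Adx A1 A2] A0.
have ev_poly a b p : ev0 (A (sf_in a b (Cinf_poly p))) = 0.
  rewrite Cinf_polyE !linear_sum big1 // => i _.
  by rewrite !linearZ /= A0 mulr0.
have ev_in F : in_poly F -> ev0 (A F) = 0.
  move=> [p0 [p1 [p2 [p12 ->]]]].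
  rewrite (sf_in_decomp (SFun _ _ _ _)) !diffopD !ev0D.
  by rewrite 4!ev_poly !addr0.
have in_mono a b j : in_poly (sf_mono R a b j).
  case: a; case: b; [exists 0, 0, 0, 'X^j|exists 0, 'X^j, 0, 0|exists 0, 0, 'X^j, 0
    |exists 'X^j, 0, 0, 0]; by rewrite /sf_mono Cinf_polyXn !Cinf_poly0.
have in_sign F : in_poly F -> in_poly (sf_sign F).
  move=> [p0 [p1 [p2 [p12 ->]]]]; exists p0, (- p1), (- p2), p12.
  by rewrite !Cinf_polyN.
have in_h1 F : in_poly F -> in_poly (half_eta1 F).
  move=> [p0 [p1 [p2 [p12 ->]]]].
  exists (2^-1 *: p1), (2^-1 *: p0^`()), (2^-1 *: p12), (2^-1 *: p2^`()).
  by rewrite /half_eta1 /= !Cinf_poly_deriv !Cinf_polyZ.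
have in_h2 F : in_poly F -> in_poly (half_eta2 F).
  move=> [p0 [p1 [p2 [p12 ->]]]].
  exists (2^-1 *: p2), (- (2^-1 *: p12)), (2^-1 *: p0^`()), (- (2^-1 *: p1^`())).
  by rewrite /half_eta2 /= !Cinf_poly_deriv !Cinf_polyN !Cinf_polyZ.
have h0 (x : R) : 2^-1 * x = 0 -> x = 0.
  by move=> /eqP; rewrite mulf_eq0 invr_eq0 pnatr_eq0 /= => /eqP.
have A1' := half_eta1_twist A1; have A2' := half_eta2_twist A2.
have ev1 F : in_poly F -> sf1 (A F) 0 = 0.
  move=> pF; apply: h0; rewrite -[LHS]/(ev0 (half_eta1 (A F))) A1' twistE.
  by rewrite -[LHS]/(ev0 (A _)); apply/ev_in/in_sign/in_h1.
have ev2 F : in_poly F -> sf2 (A F) 0 = 0.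
  move=> pF; apply: h0; rewrite -[LHS]/(ev0 (half_eta2 (A F))) A2' twistE.
  by rewrite -[LHS]/(ev0 (A _)); apply/ev_in/in_sign/in_h2.
have ev12 F : in_poly F -> sf12 (A F) 0 = 0.
  move=> pF; apply: (h0); apply: (h0).
  rewrite -[LHS]/(ev0 (half_eta2 (half_eta1 (A F)))) A1' A2.
  by apply/ev_in/in_h2/in_h1.
have step F : in_poly F -> A (dx F) = 0 -> A F = 0.
  move=> pF; rewrite -Adx => dA.
  have := (congr1 (@sf0 R) dA, congr1 (@sf1 R) dA, congr1 (@sf2 R) dA, congr1 (@sf12 R) dA).
  move=> [[[d0 d1] d2] d12]; apply: superfunP; apply: Cinf_deriv_eq0 => //;
    [exact: ev_in|exact: ev1|exact: ev2|exact: ev12].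
apply: diffop_eq0 => a b; elim=> [|j IH]; apply: step => //.
  have -> : dx (sf_mono R a b 0) = 0.
    by case: a; case: b; apply: superfunP; rewrite /= ?expr0; Cinf_field.
  exact: linear0.
have -> : dx (sf_mono R a b j.+1) = j.+1%:R *: sf_mono R a b j.
  have D : Cinf_deriv (Cinf_id R ^+ j.+1) = j.+1%:R *: Cinf_id R ^+ j.
    by rewrite -[X in Cinf_deriv X](Cinf_polyXn) Cinf_poly_deriv derivXn
      -scaler_nat Cinf_polyZ Cinf_polyXn.
  by clear IH; case: a; case: b; apply: superfunP; rewrite /= ?D ?Cinf_deriv0 ?scaler0.
by rewrite diffopZ IH scaler0.
Qed.

End Determination.

(** * Cocycles vanishing on the translations *)
Section CocycleSpace.
Variables (R : realType) (lam mu : R).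
Local Notation superfun := (superfun R).
Local Notation diffop := (diffop R).
Implicit Types (F K : superfun) (G H : osp22 R) (v A : diffop).
Implicit Types U : osp22 R -> diffop.
Local Notation gpart := (@osp_part R).
Local Notation vpart := (fun r => diffop_part r : {linear diffop -> diffop}).
Local Notation act := (fun G : osp22 R => diffop_act lam mu G : {linear diffop -> diffop}).

Definition Zpred := cocycle_pred gpart vpart (@osp_bracket R) act (@cochain_pred R).
HB.instance Definition _ := GRing.SubmodClosed.on Zpred.

Definition coboundary v : osp22 R -> diffop := delta0 gpart vpart act v.

(** By [linear_cochain], only linearity has to be checked besides the cocycle
    equation. *)
Lemma ZpredP U : reflect (linear U /\ forall p q G H F, homog p G -> homog q H ->
  delta1_term lam mu p q U G H F = 0) (U \in Zpred).
Proof.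
apply: (iffP andP) => [[/asboolP[lU _] /asboolP cU]|[lU cU]].
  by split=> //; apply/is_cocycleP.
by split; [exact: linear_cochain|apply/asboolP/is_cocycleP].
Qed.

Lemma coboundary_in v : coboundary v \in Zpred.
Proof.
apply/ZpredP; split; first exact: delta0_linear_osp.
apply/(@is_cocycleP R lam mu _ (@delta0_linear_osp R lam mu v)).
exact: coboundary_cocycle.
Qed.

Lemma coboundaryE v p G F : homog p G ->
  coboundary v G F = dens_act mu G (tw p v F) - v (dens_act lam G F).
Proof. exact: delta0_homog. Qed.

Lemma coboundaryD v w : coboundary (v + w) = coboundary v + coboundary w.
Proof.
by have := delta0_linear gpart vpart act 1 v w; rewrite !scale1r.
Qed.

Section OneCocycle.
Variable U : osp22 R -> diffop.
Hypothesis ZU : U \in Zpred.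

Lemma Z_linear : linear U. Proof. by case/ZpredP: ZU. Qed.

Lemma Z0 : U 0 = 0.
Proof. by have := Z_linear (-1) 0 0; rewrite scaler0 addr0 scaleN1r addNr. Qed.

Lemma ZZ a G : U (a *: G) = a *: U G.
Proof. by have := Z_linear a G 0; rewrite Z0 !addr0. Qed.

Lemma Z_eq p q G H F : homog p G -> homog q H ->
  U (osp_bracket G H) F =
  (-1) ^+ (p && q) *: (dens_act mu G (tw p (U H) F) - U H (dens_act lam G F))
  - (dens_act mu H (tw q (U G) F) - U G (dens_act lam H F)).
Proof.
move=> pG qH; have [_ /(_ p q G H F pG qH)] := ZpredP _ ZU.
by move/eqP; rewrite /delta1_term subr_eq0 => /eqP.
Qed.

(** If [U] vanishes on [G] and on the bracket of [G] with [H], the cocycle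
    equation says that [U H] supercommutes with [G]. *)
Lemma Z_eq_killed p q G H c (K : osp22 R) F : homog p G -> homog q H -> U G = 0 ->
  osp_bracket G H = c *: K -> U K = 0 ->
  dens_act mu G (tw p (U H) F) = U H (dens_act lam G F).
Proof.
move=> pG qH UG E UK; have := Z_eq F pG qH.
have -> : tw q (U G) = 0 by rewrite UG; exact: linear0.
have dens0 L : dens_act mu L (0 : superfun) = 0 by exact: linear0.
rewrite E ZZ UK scaler0 UG !diffop_val0 dens0 !subr0 => /esym/eqP.
by rewrite scaler_eq0 signr_eq0 subr_eq0 => /eqP.
Qed.

Lemma Z_nilinvariant p H c1 c2 c3 (K1 K2 K3 : osp22 R) : homog p H ->
  U (osp_1 R) = 0 -> U (osp_t1 R) = 0 -> U (osp_t2 R) = 0 ->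
  osp_bracket (osp_1 R) H = c1 *: K1 -> U K1 = 0 ->
  osp_bracket (osp_t1 R) H = c2 *: K2 -> U K2 = 0 ->
  osp_bracket (osp_t2 R) H = c3 *: K3 -> U K3 = 0 ->
  nilinvariant (U H).
Proof.
move=> pH U1 Ut1 Ut2 E1 UK1 E2 UK2 E3 UK3; split=> F.
- by have := Z_eq_killed F (homog_1 R) pH U1 E1 UK1; rewrite !dens_act_1.
- by have := Z_eq_killed F (homog_t1 R) pH Ut1 E2 UK2; rewrite !dens_act_t1.
- by have := Z_eq_killed F (homog_t2 R) pH Ut2 E3 UK3; rewrite !dens_act_t2.
Qed.

(** Brackets with translations lower the degree, so [U] commutes with the
    translations on X_x and X_theta1theta2, where it vanishes by [nilinvariant_eq0],
    and then on the X_xtheta_i.  The last generator is a bracket,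
    X_xx = 2 [X_xtheta1, X_xtheta1]. *)
Lemma Z_eq0 : U (osp_1 R) = 0 -> U (osp_t1 R) = 0 -> U (osp_t2 R) = 0 ->
  (forall a b j, ev0 (U (osp_x R) (sf_mono R a b j)) = 0) ->
  (forall a b j, ev0 (U (osp_t12 R) (sf_mono R a b j)) = 0) ->
  (forall a b j, ev0 (U (osp_xt1 R) (sf_mono R a b j)) = 0) ->
  (forall a b j, ev0 (U (osp_xt2 R) (sf_mono R a b j)) = 0) ->
  U = 0.
Proof.
move=> U1 Ut1 Ut2 ex e12 e1 e2.
have Ux : U (osp_x R) = 0.
  apply: nilinvariant_eq0 => //.
  exact: (Z_nilinvariant (homog_x R) U1 Ut1 Ut2 (br_1_x R) U1 (br_t1_x R) Ut1
    (br_t2_x R) Ut2).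
have U12 : U (osp_t12 R) = 0.
  apply: nilinvariant_eq0 => //.
  exact: (Z_nilinvariant (homog_t12 R) U1 Ut1 Ut2 (br_1_t12 R) U1 (br_t1_t12 R) Ut2
    (br_t2_t12 R) Ut1).
have Uxt1 : U (osp_xt1 R) = 0.
  apply: nilinvariant_eq0 => //.
  exact: (Z_nilinvariant (homog_xt1 R) U1 Ut1 Ut2 (br_1_xt1 R) Ut1 (br_t1_xt1 R) Ux
    (br_t2_xt1 R) U12).
have Uxt2 : U (osp_xt2 R) = 0.
  apply: nilinvariant_eq0 => //.
  exact: (Z_nilinvariant (homog_xt2 R) U1 Ut1 Ut2 (br_1_xt2 R) Ut2 (br_t1_xt2 R) U12
    (br_t2_xt2 R) Ux).
have Uxx : U (osp_xx R) = 0.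
  have E : osp_xx R = 2 *: osp_bracket (osp_xt1 R) (osp_xt1 R).
    by rewrite br_xt1_xt1 scalerA mulfV ?scale1r // pnatr_eq0.
  rewrite E ZZ (_ : U _ = 0) ?scaler0 //; apply: diffopP => F.
  have tw0 s : tw s (0 : diffop) = 0 by exact: linear0.
  have dens0 L : dens_act mu L (0 : superfun) = 0 by exact: linear0.
  rewrite (Z_eq F (homog_xt1 R) (homog_xt1 R)) Uxt1.
  by rewrite !tw0 !diffop_val0 !dens0 !subr0 scaler0.
apply/funext => G.
have [a [b [c [q1 [q2 [p1 [p2 [d ->]]]]]]]] := osp_vecP G.
rewrite osp_vec_decomp !Z_linear Z0 U1 Ux Uxx Uxt1 Uxt2 Ut1 Ut2 U12.
by rewrite !scaler0 !addr0.
Qed.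

End OneCocycle.

Lemma sf_antideriv (a : superfun) : exists b, dx b = a.
Proof.
case: a => a0 a1 a2 a12.
have [[b0 <-] [b1 <-]] := (Cinf_antideriv a0, Cinf_antideriv a1).
have [[b2 <-] [b12 <-]] := (Cinf_antideriv a2, Cinf_antideriv a12).
by exists (SFun b0 b1 b2 b12).
Qed.

Lemma dx_mul F K : dx (F * K) = dx F * K + F * dx K.
Proof.
by case: F => ????; case: K => ????; apply: superfunP; rewrite /=; Cinf_field.
Qed.

Lemma dx_eta_mono lm F : dx (eta_mono lm F) = eta_mono lm (dx F).
Proof.
case: lm => l m; rewrite /eta_mono /=; elim: l => [|l IH] /=; last by rewrite dx_etab1 IH.
by elim: m => //= m IH; rewrite dx_etab2 IH.
Qed.

(** Since d/dx commutes with the etabar_i, the commutator with d/dx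
    differentiates the coefficients. *)
Lemma diffop_dx_antideriv A : exists v, forall F, dx (v F) - v (dx F) = A F.
Proof.
have [s sP] := diffop_is_diffop A.
suff [v vP] : exists v : diffop, forall F, dx (v F) - v (dx F) = \sum_(t <- s) t.1 * eta_mono t.2 F.
  by exists v => F; rewrite vP sP.
elim: s {sP} => [|[a lm] s [v vP]].
  by exists 0 => F; rewrite big_nil !diffop_val0 linear0 subr0.
have [b bE] := sf_antideriv a.
exists (diffop_of (is_diffop_term b lm) + v) => F; rewrite big_cons -vP !diffop_valD.
rewrite -[diffop_of _ F]/(b * eta_mono lm F) -[diffop_of _ (dx F)]/(b * eta_mono lm (dx F)).
have -> : dx (b * eta_mono lm F + v F) = a * eta_mono lm F + b * eta_mono lm (dx F) + dx (v F).
  by rewrite linearD; congr (_ + _); rewrite -bE -dx_eta_mono; exact: dx_mul.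
by apply: superfunP => /=; ring.
Qed.

Definition mul_op (a : superfun) A : diffop :=
  diffop_of (is_diffopMl a (diffop_is_diffop A)).

End CocycleSpace.

(** * Normalization of cocycles on the translations *)
Section Normalization.
Variables (R : realType) (lam mu : R).
Local Notation superfun := (superfun R).
Local Notation diffop := (diffop R).
Implicit Types (F K : superfun) (G H : osp22 R) (v A : diffop).
Implicit Types U : osp22 R -> diffop.
Local Notation Z := (Zpred lam mu).
Local Notation cob := (coboundary lam mu).

Lemma fun_valB U W G : (U - W) G = U G - W G. Proof. by []. Qed.

Lemma half_eta1_theta1 K : half_eta1 (theta1 R * K) = 2^-1 *: K - theta1 R * half_eta1 K.
Proof. by case: K => ????; apply: superfunP; rewrite /=; Cinf_field. Qed.

Lemma half_eta2_theta2 K : half_eta2 (theta2 R * K) = 2^-1 *: K - theta2 R * half_eta2 K.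
Proof. by case: K => ????; apply: superfunP; rewrite /=; Cinf_field. Qed.

Lemma half_eta1_theta2 K : half_eta1 (theta2 R * K) = - (theta2 R * half_eta1 K).
Proof. by case: K => ????; apply: superfunP; rewrite /=; Cinf_field. Qed.

Lemma half_eta1D F K : half_eta1 (F + K) = half_eta1 F + half_eta1 K.
Proof. by case: F => ????; case: K => ????; apply: superfunP; rewrite /=; Cinf_field. Qed.

Lemma half_eta2D F K : half_eta2 (F + K) = half_eta2 F + half_eta2 K.
Proof. by case: F => ????; case: K => ????; apply: superfunP; rewrite /=; Cinf_field. Qed.

Lemma half_eta1Z a K : half_eta1 (a *: K) = a *: half_eta1 K.
Proof. by case: K => ????; apply: superfunP; rewrite /=; Cinf_field. Qed.

Lemma half_eta2Z a K : half_eta2 (a *: K) = a *: half_eta2 K.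
Proof. by case: K => ????; apply: superfunP; rewrite /=; Cinf_field. Qed.

Lemma dx_theta1 K : dx (theta1 R * K) = theta1 R * dx K.
Proof. by case: K => ????; apply: superfunP; rewrite /=; Cinf_field. Qed.

Lemma dx_theta2 K : dx (theta2 R * K) = theta2 R * dx K.
Proof. by case: K => ????; apply: superfunP; rewrite /=; Cinf_field. Qed.

Lemma sf_sign_theta1 K : sf_sign (theta1 R * K) = - (theta1 R * sf_sign K).
Proof. by case: K => ????; apply: superfunP; rewrite /=; Cinf_field. Qed.

Lemma sf_sign_theta2 K : sf_sign (theta2 R * K) = - (theta2 R * sf_sign K).
Proof. by case: K => ????; apply: superfunP; rewrite /=; Cinf_field. Qed.

Lemma dx_sign K : dx (sf_sign K) = sf_sign (dx K).
Proof. by apply: superfunP; rewrite /=; Cinf_field. Qed.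

Lemma dxZ a K : dx (a *: K) = a *: dx K. Proof. exact: linearZ. Qed.

Lemma dx_twist A : (forall F, dx (A F) = A (dx F)) -> forall F, dx (twist A F) = twist A (dx F).
Proof. by move=> Ad F; rewrite !twistE dx_sign Ad dx_sign. Qed.

(** If [A] supercommutes with [half_eta_i], then the coboundary of
    [- 2 theta_i A^sigma], with [A^sigma] the twist of [A], takes the value [A] on
    X_theta_i, because [half_eta_i] applied to [theta_i K] is
    [K / 2 - theta_i half_eta_i K]. *)
Definition theta_prim (t : superfun) A : diffop := (-2) *: mul_op t (twist A).

Lemma theta_primE t A F : theta_prim t A F = (-2) *: (t * twist A F).
Proof. by []. Qed.

Lemma twist_theta_prim t A F :
  (forall K, sf_sign (t * K) = - (t * sf_sign K)) ->
  twist (theta_prim t A) F = 2 *: (t * A F).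
Proof.
move=> st; rewrite twistE theta_primE sf_signZ st twistE !sf_signK.
by rewrite scalerN scaleNr opprK.
Qed.

Let half2 (K : superfun) : 2 *: (2^-1 *: K) = K.
Proof. by rewrite scalerA mulfV ?scale1r // pnatr_eq0. Qed.

(** The value on X_1 is removed by antiderivatives of the coefficients.  From
    then on the values on X_theta1 and X_theta2 commute with d/dx, and the value on
    X_theta_i supercommutes with X_theta_i since the bracket of this field with itself is
    X_1 / 2; so each of them is removed by [theta_prim], which preserves what
    was obtained before. *)
Lemma normalization U : U \in Z -> exists v,
  [/\ (U - cob v) (osp_1 R) = 0, (U - cob v) (osp_t1 R) = 0 & (U - cob v) (osp_t2 R) = 0].
Proof.
move=> ZU.
have ev1 : homog false (osp_1 R) := homog_1 R.
have od1 : homog true (osp_t1 R) := homog_t1 R.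
have od2 : homog true (osp_t2 R) := homog_t2 R.
have cob1 v F : cob v (osp_1 R) F = dx (v F) - v (dx F).
  by rewrite (coboundaryE _ _ _ _ ev1) !dens_act_1.
have cobt1 v F : cob v (osp_t1 R) F = half_eta1 (twist v F) - v (half_eta1 F).
  by rewrite (coboundaryE _ _ _ _ od1) !dens_act_t1.
have cobt2 v F : cob v (osp_t2 R) F = half_eta2 (twist v F) - v (half_eta2 F).
  by rewrite (coboundaryE _ _ _ _ od2) !dens_act_t2.
have [v1 v1P] := diffop_dx_antideriv (U (osp_1 R)).
pose U1 := U - cob v1.
have ZU1 : U1 \in Z by rewrite rpredB // coboundary_in.
have U1_1 : U1 (osp_1 R) = 0.
  by apply: diffopP => F; rewrite /U1 fun_valB diffop_valD diffop_valN cob1 v1P subrr.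
pose A := U1 (osp_t1 R).
have Adx F : dx (A F) = A (dx F).
  by have := Z_eq_killed ZU1 F ev1 od1 U1_1 (br_1_t1 R) U1_1; rewrite !dens_act_1.
have A1 F : half_eta1 (twist A F) = A (half_eta1 F).
  have := Z_eq ZU1 F od1 od1; rewrite br_t1_t1 (ZZ ZU1) U1_1 scaler0 diffop_val0.
  rewrite !dens_act_t1 -[U1 _]/A /= expr1 scaleN1r -opprD => /esym/eqP.
  rewrite oppr_eq0 -mulr2n -scaler_nat scaler_eq0 pnatr_eq0 /= subr_eq0.
  by move/eqP.
have A1' := half_eta1_twist A1.
pose v2 := theta_prim (theta1 R) A.
pose U2 := U1 - cob v2.
have ZU2 : U2 \in Z by rewrite rpredB // coboundary_in.
have U2_1 : U2 (osp_1 R) = 0.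
  apply: diffopP => F; rewrite /U2 fun_valB U1_1 sub0r diffop_valN cob1 !theta_primE.
  by rewrite dxZ dx_theta1 (dx_twist Adx) subrr oppr0.
have U2_t1 : U2 (osp_t1 R) = 0.
  apply: diffopP => F; rewrite /U2 fun_valB diffop_valD diffop_valN cobt1.
  rewrite twist_theta_prim; last exact: sf_sign_theta1.
  rewrite half_eta1Z half_eta1_theta1 scalerBr half2 A1' theta_primE scaleNr.
  by rewrite opprK subrK subrr.
pose B := U2 (osp_t2 R).
have Bdx F : dx (B F) = B (dx F).
  by have := Z_eq_killed ZU2 F ev1 od2 U2_1 (br_1_t2 R) U2_1; rewrite !dens_act_1.
have B1 F : half_eta1 (twist B F) = B (half_eta1 F).
  by have := Z_eq_killed ZU2 F od1 od2 U2_t1 (br_t1_t2 R) U2_1; rewrite !dens_act_t1.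
have B2 F : half_eta2 (twist B F) = B (half_eta2 F).
  have := Z_eq ZU2 F od2 od2; rewrite br_t2_t2 (ZZ ZU2) U2_1 scaler0 diffop_val0.
  rewrite !dens_act_t2 -[U2 _]/B /= expr1 scaleN1r -opprD => /esym/eqP.
  rewrite oppr_eq0 -mulr2n -scaler_nat scaler_eq0 pnatr_eq0 /= subr_eq0.
  by move/eqP.
have B1' := half_eta1_twist B1; have B2' := half_eta2_twist B2.
pose v3 := theta_prim (theta2 R) B.
exists (v1 + v2 + v3).
have -> : U - cob (v1 + v2 + v3) = U2 - cob v3.
  by rewrite !coboundaryD !opprD !addrA.
split.
- apply: diffopP => F; rewrite fun_valB U2_1 sub0r diffop_valN cob1 !theta_primE.
  by rewrite dxZ dx_theta2 (dx_twist Bdx) subrr oppr0.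
- apply: diffopP => F; rewrite fun_valB U2_t1 sub0r diffop_valN cobt1.
  rewrite twist_theta_prim; last exact: sf_sign_theta2.
  rewrite half_eta1Z half_eta1_theta2 B1' theta_primE scaleNr opprK scalerN.
  by rewrite addNr oppr0.
- apply: diffopP => F; rewrite fun_valB diffop_valD diffop_valN cobt2.
  rewrite twist_theta_prim; last exact: sf_sign_theta2.
  rewrite half_eta2Z half_eta2_theta2 scalerBr half2 B2' theta_primE scaleNr.
  by rewrite opprK subrK subrr.
Qed.

End Normalization.

(** * Constant-coefficient operators with a prescribed germ *)
Section ConstantOperators.
Variable R : realType.
Local Notation superfun := (superfun R).
Local Notation diffop := (diffop R).
Implicit Types (F K : superfun) (v A B : diffop).

Lemma nilinvariantD A B : nilinvariant A -> nilinvariant B -> nilinvariant (A + B).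
Proof.
move=> [A0 A1 A2] [B0 B1 B2].
have twD F : twist (A + B) F = twist A F + twist B F by rewrite (linearD (@twist R)).
split=> F; rewrite ?twD !diffop_valD.
- by rewrite -A0 -B0 [dx _]linearD.
- by rewrite -A1 -B1 half_eta1D.
- by rewrite -A2 -B2 half_eta2D.
Qed.

Lemma nilinvariantZ c A : nilinvariant A -> nilinvariant (c *: A).
Proof.
move=> [A0 A1 A2].
have twZ F : twist (c *: A) F = c *: twist A F by have -> : twist (c *: A) = c *: twist A by exact: linearZ.
split=> F; rewrite ?twZ !diffop_valZ.
- by rewrite -A0 dxZ.
- by rewrite -A1 half_eta1Z.
- by rewrite -A2 half_eta2Z.
Qed.

Lemma nilinvariant0 : nilinvariant (0 : diffop).
Proof.
have tw0 : twist 0 = 0 :> diffop by exact: linear0.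
split=> F; rewrite ?tw0 !diffop_val0 ?[dx 0]linear0 //;
by apply: superfunP; rewrite /=; Cinf_field.
Qed.

Lemma nilinvariant_sum (I : Type) (r : seq I) (A : I -> diffop) :
  (forall i, nilinvariant (A i)) -> nilinvariant (\sum_(i <- r) A i).
Proof.
move=> nA; elim/big_ind: _ => //; first exact: nilinvariant0.
by move=> *; exact: nilinvariantD.
Qed.

Lemma nilinvariant_comp A B : nilinvariant A -> nilinvariant B ->
  nilinvariant (diffop_comp A B).
Proof.
move=> [A0 A1 A2] [B0 B1 B2].
have twc F : twist (diffop_comp A B) F = twist A (twist B F).
  by rewrite !twistE sf_signK.
split=> F; rewrite ?twc !diffop_val_comp.
- by rewrite A0 B0.
- by rewrite A1 B1.
- by rewrite A2 B2.
Qed.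

Definition op_id : diffop := diffop_of (@is_diffop_id R).
Definition op_dx : diffop := diffop_of (is_diffop_dx R).
Definition op_etab1 : diffop := diffop_of (is_diffop_etab1 (@is_diffop_id R)).
Definition op_etab2 : diffop := diffop_of (is_diffop_etab2 (@is_diffop_id R)).

Lemma op_idE F : op_id F = F. Proof. by []. Qed.
Lemma op_dxE F : op_dx F = dx F. Proof. by []. Qed.
Lemma op_etab1E F : op_etab1 F = etab1 F. Proof. by []. Qed.
Lemma op_etab2E F : op_etab2 F = etab2 F. Proof. by []. Qed.

Lemma nilinvariant_id : nilinvariant op_id.
Proof. by split=> F; rewrite ?twistE !op_idE ?sf_signK. Qed.

Lemma nilinvariant_dx : nilinvariant op_dx.
Proof.
split=> F; rewrite ?twistE !op_dxE ?dx_sign ?sf_signK //;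
by case: F => ????; apply: superfunP; rewrite /=; Cinf_field.
Qed.

Lemma nilinvariant_etab1 : nilinvariant op_etab1.
Proof.
split=> F; rewrite ?twistE !op_etab1E ?dx_etab1 // !etab1E;
by case: F => ????; apply: superfunP; rewrite /=; Cinf_field.
Qed.

Lemma nilinvariant_etab2 : nilinvariant op_etab2.
Proof.
split=> F; rewrite ?twistE !op_etab2E ?dx_etab2 // !etab2E;
by case: F => ????; apply: superfunP; rewrite /=; Cinf_field.
Qed.

Definition op_eta (a b : bool) (j : nat) : diffop :=
  diffop_comp (if a then op_etab1 else op_id) (diffop_comp (if b then op_etab2 else op_id)
    (iter j (diffop_comp op_dx) op_id)).

Lemma op_etaE a b j F : op_eta a b j F = eta_mono (a : nat, b : nat) (iter j (@dx R) F).
Proof.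
have -> : iter j (@dx R) F = iter j (diffop_comp op_dx) op_id F.
  by elim: j => //= j ->.
by case: a; case: b.
Qed.

Lemma nilinvariant_op_eta a b j : nilinvariant (op_eta a b j).
Proof.
apply: nilinvariant_comp.
  by case: a; [exact: nilinvariant_etab1|exact: nilinvariant_id].
apply: nilinvariant_comp.
  by case: b; [exact: nilinvariant_etab2|exact: nilinvariant_id].
elim: j => [|j IH]; first exact: nilinvariant_id.
by rewrite iterS; apply: nilinvariant_comp => //; exact: nilinvariant_dx.
Qed.

Lemma iter_dx_sf_in a b j (f : Cinf R) :
  iter j (@dx R) (sf_in a b f) = sf_in a b (iter j (@Cinf_deriv R) f).
Proof.
elim: j => // j IH; rewrite !iterS IH.
by case: a {IH}; case: b; apply: superfunP => //=; exact: Cinf_deriv0.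
Qed.

Lemma iter_deriv_mono j i : iter j (@Cinf_deriv R) (Cinf_id R ^+ i) 0 =
  if j == i then j`!%:R else 0.
Proof.
rewrite -Cinf_polyXn.
have -> p : iter j (@Cinf_deriv R) (Cinf_poly p) = Cinf_poly p^`(j).
  by elim: j => // j IH; rewrite iterS IH Cinf_poly_deriv derivnS.
rewrite Cinf_poly_val horner_coef0 coef_derivn addn0 coefXn.
by case: eqP => _; rewrite ?mul0rn // ffactnn.
Qed.

(** At the origin, [etabar_1^a etabar_2^b (d/dx)^j] is dual to the monomial
    [x^j theta_1^a theta_2^b], up to a factor. *)
Lemma ev0_op_eta a b j a' b' j' : ev0 (op_eta a b j (sf_mono R a' b' j')) =
  if [&& a == a', b == b' & j == j'] then (-1) ^+ (a && b) * j`!%:R else 0.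
Proof.
rewrite op_etaE /sf_mono iter_dx_sf_in.
have := iter_deriv_mono j j'; set f := iter j _ _ => fE.
have f0 : (0 : Cinf R) 0 = 0 by [].
have fN : (- f) 0 = - f 0 by rewrite Cinf_valN.
have E : ev0 (eta_mono (a : nat, b : nat) (sf_in a' b' f)) =
    if (a == a') && (b == b') then (-1) ^+ (a && b) * f 0 else 0.
  rewrite /ev0; case: a; case: b; case: a'; case: b';
  rewrite /eta_mono /sf_in; cbn [fst snd iter nat_of_bool];
  rewrite ?etab1E ?etab2E; cbn [sf0 sf1 sf2 sf12]; rewrite ?oppr0 ?f0 ?fN;
  by rewrite /= ?expr0 ?expr1 ?mul1r ?mulN1r.
rewrite E fE; case: (a == a') => //=; case: (b == b') => //=.
by case: eqP => _; rewrite ?mulr0.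
Qed.

(** The operators [etabar_1^a etabar_2^b (d/dx)^j] commute with the
    translations, and their germs form a dual basis up to factors. *)
Lemma nilinvariant_interpolation (c : bool -> bool -> nat -> R) N :
  (forall a b j, (N <= j)%N -> c a b j = 0) ->
  exists v : diffop, nilinvariant v /\
    forall a b j, ev0 (v (sf_mono R a b j)) = c a b j.
Proof.
move=> cN.
pose d a b j := (-1) ^+ (a && b) * c a b j / j`!%:R.
pose v : diffop := \sum_(j < N) \sum_(a : bool) \sum_(b : bool) d a b j *: op_eta a b j.
exists v; split.
  do 3!(apply: nilinvariant_sum => ?); apply: nilinvariantZ.
  exact: nilinvariant_op_eta.
have vsum (I : Type) (r : seq I) (A : I -> diffop) F :
    ev0 ((\sum_(i <- r) A i) F) = \sum_(i <- r) ev0 (A i F).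
  elim: r => [|i r IH]; first by rewrite !big_nil.
  by rewrite !big_cons diffop_valD ev0D IH.
move=> a b j; rewrite /v vsum.
have term (i : nat) : ev0 ((\sum_a0 \sum_b0 d a0 b0 i *: op_eta a0 b0 i) (sf_mono R a b j))
   = if i == j then c a b j else 0.
  transitivity (\sum_(a0 : bool) \sum_(b0 : bool) d a0 b0 i *
      (if [&& a0 == a, b0 == b & i == j] then (-1) ^+ (a0 && b0) * i`!%:R else 0)).
    rewrite vsum; apply: eq_bigr => a0 _; rewrite vsum; apply: eq_bigr => b0 _.
    by rewrite diffop_valZ ev0Z ev0_op_eta.
  transitivity (d a b i * (if i == j then (-1) ^+ (a && b) * i`!%:R else 0)).
    by rewrite !big_bool; case: (a); case: (b); rewrite /= ?mulr0 ?addr0 ?add0r.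
  case: eqP => [->|_]; last by rewrite mulr0.
  have f0 : j`!%:R != 0 :> R by rewrite pnatr_eq0 -lt0n fact_gt0.
  have ss : (-1) ^+ (a && b) * (-1) ^+ (a && b) = 1 :> R by rewrite -expr2 sqrr_sign.
  rewrite /d; transitivity ((-1) ^+ (a && b) * (-1) ^+ (a && b) * c a b j * (j`!%:R^-1 * j`!%:R)).
    by ring.
  by rewrite ss mulVf // mulr1 mul1r.
under eq_bigr => i _ do rewrite term.
have [jN|Nj] := ltnP j N; last first.
  rewrite (cN _ _ _ Nj); by apply: big1 => i _; case: ifP.
rewrite (bigD1 (Ordinal jN)) //= eqxx big1 ?addr0 // => -[i ilt] ne /=.
by case: eqP => // ij; case/eqP: ne; apply: val_inj.
Qed.

End ConstantOperators.

(** * Resonances of the Euler field *)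
Section Resonances.
Variable R : realType.
Variables lam mu : R.
Implicit Types c X J Y W : bool -> bool -> nat -> R.

(** An array [c a b j] stands for a linear form on the polynomials in
    x, theta_1, theta_2, by its values on the monomials
    [x^j theta_1^a theta_2^b].  On densities of weight [lam], X_x multiplies this
    monomial by [wt a b j]. *)
Definition wt (a b : bool) (j : nat) : R := lam + j%:R + ((a : nat)%:R + (b : nat)%:R) / 2.

(** The forms obtained from [c] by composition with the actions of
    X_theta1theta2, X_xtheta1 and X_xtheta2 on densities of weight [lam]; see
    [germ_t12], [germ_xt1] and [germ_xt2]. *)
Definition seq_rot c : bool -> bool -> nat -> R := fun a b j =>
  match a, b with
  | true, false => - (2^-1 * c false true j)
  | false, true => 2^-1 * c true false j
  | _, _ => 0
  end.

Definition seq_sup1 c : bool -> bool -> nat -> R := fun a b j =>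
  if a then 2^-1 * c false b j.+1 else (lam + (j%:R + (b : nat)%:R) / 2) * c true b j.

Definition seq_sup2 c : bool -> bool -> nat -> R := fun a b j =>
  (-1) ^+ a * (if b then 2^-1 * c a false j.+1
               else (lam + (j%:R + (a : nat)%:R) / 2) * c a true j).

(** Here [X], [J], [Y], [W] are the germs of a normalized cocycle on X_x,
    X_theta1theta2, X_xtheta1 and X_xtheta2, the first five hypotheses are cocycle
    equations, and [c] is the germ of a primitive.  Off the resonance
    [mu = wt a b j], the entry of [c] is forced by [X], and the equations for
    [J], [Y], [W] follow by dividing the cocycle equations by the nonzero
    weight.  At a resonance, [c] is read from another germ: from [J] at
    the two odd monomials, from [Y] at [x^(i+1)] and at [x^j theta_1 theta_2].  In
    this last case [Y] has the factor [kap j], which vanishes exactly when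
    [lam] and [mu] are opposite half-integers. *)
Lemma resonance X J Y W N :
  (forall a b j, (mu - wt a b j) * J a b j = - seq_rot X a b j) ->
  (forall a b j, (mu - wt a b j - 2^-1) * Y a b j = - seq_sup1 X a b j) ->
  (forall a b j, (mu - wt a b j - 2^-1) * W a b j = - seq_sup2 X a b j) ->
  (forall a b j, - seq_rot Y a b j + seq_sup1 J a b j = - (2^-1 * W a b j)) ->
  (forall a b j, - seq_rot W a b j + seq_sup2 J a b j = 2^-1 * Y a b j) ->
  (mu = lam -> X false false 0 = 0 /\ J false false 0 = 0) ->
  (forall k, lam = - (k.+1%:R / 2) -> mu = k.+1%:R / 2 ->
     [/\ X true true k = 0, J true true k = 0 & Y false true k = 0]) ->
  (forall a b j, (N <= j)%N -> [/\ X a b j = 0, J a b j = 0, Y a b j = 0 & W a b j = 0]) ->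
  exists c, [/\ forall a b j, (N < j)%N -> c a b j = 0,
    forall a b j, X a b j = (mu - wt a b j) * c a b j,
    forall a b j, J a b j = - seq_rot c a b j,
    forall a b j, Y a b j = - seq_sup1 c a b j &
    forall a b j, W a b j = - seq_sup2 c a b j].
Proof.
move=> eJ eY eW eJY eJW Hdiag Hk supp.
pose kap j : R := lam + (j%:R + 1) / 2.
pose c a b j : R := if mu == wt a b j then
    match a, b, j with
    | false, false, 0 => 0
    | false, false, i.+1 => - 2 * Y true false i
    | true, true, _ => - (kap j)^-1 * Y false true j
    | true, false, _ => - 2 * J false true j
    | false, true, _ => 2 * J true false j
    end
  else X a b j / (mu - wt a b j).
have cne a b j : mu != wt a b j -> X a b j = (mu - wt a b j) * c a b j.
  by rewrite /c => ne; rewrite (negbTE ne) mulrC divfK // subr_eq0.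
(* The cocycle equations for the pairs X_theta1theta2, X_xtheta_i carry no
   factor mu - wt, so these consequences remain informative at resonances. *)
have Je j : J false false j.+1 = 0.
  have := eJY true false j; have := eJW false true j.
  rewrite /seq_rot /seq_sup1 /seq_sup2 /= expr0; lra.
have Y2f j : W true false j = - Y false true j.
  have := eJY true false j; have := eJW false true j.
  rewrite /seq_rot /seq_sup1 /seq_sup2 /= expr0; lra.
have Y2g j : W false true j = Y true false j.
  have := eJY false true j; have := eJW true false j.
  rewrite /seq_rot /seq_sup1 /seq_sup2 /= expr1; lra.
have Jh j : kap j * J true true j = 0.
  have := eJY false true j; have := eJW true false j.
  rewrite /seq_rot /seq_sup1 /seq_sup2 /= expr1 /kap; lra.
have Yh j : Y true true j = - J true false j.+1.
  have := eJW true true j; rewrite /seq_rot /seq_sup1 /seq_sup2 /= expr1; lra.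
have Wh j : W true true j = - J false true j.+1.
  have := eJY true true j; rewrite /seq_rot /seq_sup1 /seq_sup2 /=; lra.
have Ye j : Y false false j = 2 * ((lam + j%:R / 2) * J false true j).
  have := eJW false false j; rewrite /seq_rot /seq_sup1 /seq_sup2 /= expr0 addr0; lra.
have We j : W false false j = - 2 * ((lam + j%:R / 2) * J true false j).
  have := eJY false false j; rewrite /seq_rot /seq_sup1 /seq_sup2 /= addr0; lra.
(* The resonant monomial with kap j = 0 is the only one left to the
   hypothesis on opposite weights, for k = j. *)
have kap0 j : mu = wt true true j -> kap j = 0 ->
    [/\ X true true j = 0, J true true j = 0 & Y false true j = 0].
  rewrite /wt /kap /= => muE k0; apply: Hk; rewrite -natr1; lra.
have res a b j : mu = wt a b j -> X a b j = 0.
  case: a; case: b => muE.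
  - have [/eqP k0|k0] := boolP (kap j == 0); first by case: (kap0 j muE k0).
    have := eY false true j; rewrite muE /wt /seq_sup1 /= => E.
    by apply: (mulfI k0); rewrite mulr0 /kap; lra.
  - by have := eJ false true j; rewrite muE /wt /seq_rot /=; lra.
  - by have := eJ true false j; rewrite muE /wt /seq_rot /=; lra.
  - case: j muE => [muE|j muE].
      by case: Hdiag => //; rewrite muE /wt /=; lra.
    by have := eY true false j; rewrite muE /wt /seq_sup1 /= -natr1; lra.
have cres a b j : mu = wt a b j -> c a b j = match a, b, j with
    | false, false, 0 => 0
    | false, false, i.+1 => - 2 * Y true false i
    | true, true, _ => - (kap j)^-1 * Y false true j
    | true, false, _ => - 2 * J false true j
    | false, true, _ => 2 * J true false j
    end.
  by rewrite /c => <-; rewrite eqxx.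
have Xc a b j : X a b j = (mu - wt a b j) * c a b j.
  by have [muE|/cne//] := eqVneq mu (wt a b j); rewrite (res _ _ _ muE) -muE subrr mul0r.
have Jne a b j : mu != wt a b j ->
    (mu - wt a b j) * J a b j = - seq_rot X a b j -> J a b j = - seq_rot c a b j.
  move=> ne; have ne' : mu - wt a b j != 0 by rewrite subr_eq0.
  move=> E; apply: (mulfI ne'); rewrite E.
  case: (a) (b) => -[]; rewrite /seq_rot /wt /= ?Xc /wt /=; lra.
have swap j : wt false true j = wt true false j by rewrite /wt /=; lra.
have Jc a b j : J a b j = - seq_rot c a b j.
  have [muE|ne] := eqVneq mu (wt a b j); last exact: Jne.
  case: a b muE => -[] muE; rewrite /seq_rot /= ?oppr0 ?opprK.
  - have [/eqP k0|k0] := boolP (kap j == 0); first by case: (kap0 j muE k0).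
    by apply: (mulfI k0); rewrite Jh mulr0.
  - by rewrite (cres false true) ?swap //; lra.
  - by rewrite (cres true false) -?swap //; lra.
  - by case: j muE => // muE; case: Hdiag => //; rewrite muE /wt /=; lra.
have wtS a b j : wt a b j.+1 = wt a b j + 1 by rewrite /wt -natr1; lra.
have Yc a b j : Y a b j = - seq_sup1 c a b j.
  have [muE|ne] := eqVneq mu (wt a b j + 2^-1); last first.
    have ne' : mu - wt a b j - 2^-1 != 0 by rewrite -addrA -opprD subr_eq0.
    apply: (mulfI ne'); rewrite eY /seq_sup1.
    by case: (a); rewrite !Xc /wt /= -?(natr1 j); lra.
  have k2 : 2 != 0 :> R by rewrite pnatr_eq0.
  case: a b muE => -[] muE; rewrite /seq_sup1 /=.
  - by rewrite Yh (cres false true) ?wtS ?muE /wt /=; lra.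
  - by rewrite (cres false false) ?wtS ?muE /wt /=; lra.
  - have muE' : mu = wt true true j by rewrite muE /wt /=; lra.
    rewrite (cres true true) //.
    have [/eqP k0|k0] := boolP (kap j == 0); first by case: (kap0 j muE' k0) => _ _ ->; lra.
    by rewrite -/(kap j) [kap j * _]mulrA mulrN divff //; lra.
  - by rewrite Ye addr0 (cres true false) ?muE /wt /=; lra.
have Wc a b j : W a b j = - seq_sup2 c a b j.
  have [muE|ne] := eqVneq mu (wt a b j + 2^-1); last first.
    have ne' : mu - wt a b j - 2^-1 != 0 by rewrite -addrA -opprD subr_eq0.
    apply: (mulfI ne'); rewrite eW /seq_sup2.
    by case: (a); case: (b); rewrite ?expr0 ?expr1 !Xc /wt /= -?(natr1 j); lra.
  case: a b muE => -[] muE; rewrite /seq_sup2 /= ?expr0 ?expr1.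
  - by rewrite Wh (cres true false) ?wtS ?muE /wt /=; lra.
  - have muE' : mu = wt true true j by rewrite muE /wt /=; lra.
    rewrite Y2f (cres true true) //.
    have [/eqP k0|k0] := boolP (kap j == 0); first by case: (kap0 j muE' k0) => _ _ ->; lra.
    by rewrite -/(kap j) [kap j * _]mulrA mulrN divff //; lra.
  - by rewrite Y2g (cres false false) ?wtS ?muE /wt /=; lra.
  - by rewrite We addr0 (cres false true) ?muE /wt /=; lra.
have suppc a b j : (N < j)%N -> c a b j = 0.
  rewrite /c; case: j => // j; rewrite ltnS => Nj.
  have [hX hJ hY hW] := supp a b j.+1 (leqW Nj).
  have [_ hJ1 _ _] := supp true false j.+1 (leqW Nj).
  have [_ hJ2 hY2 _] := supp false true j.+1 (leqW Nj).
  have [_ _ hY1 _] := supp true false j Nj.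
  case: ifP => _; last by rewrite hX mul0r.
  by case: (a); case: (b); rewrite ?hY1 ?hY2 ?hJ1 ?hJ2 mulr0.
by exists c.
Qed.

End Resonances.

(** * The isotropy fields on germs *)
Section IsotropyAction.
Variable R : realType.
Local Notation superfun := (superfun R).
Local Notation diffop := (diffop R).
Implicit Types (F K : superfun) (v A B : diffop).

Section Homogeneous.
Variables (f : Cinf R) (j : nat).
(* The case of interest is x^j; with Euler's identity as hypothesis the
   computation is linear in the values of f and of its derivative. *)
Hypothesis fE : forall t, t * Cinf_deriv f t = j%:R * f t.

Ltac euler :=
  let t := fresh "t" in apply: CinfP => t; eapply Cinf_eval_trans; [Cinf_eval|Cinf_eval|];
  have := fE t; generalize (Cinf_val (Cinf_deriv f) t) => ?;
  generalize (Cinf_val f t) => ?; lra.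

Lemma dens_act_x_in lam a b :
  dens_act lam (osp_x R) (sf_in a b f) = wt lam a b j *: sf_in a b f.
Proof.
rewrite osp_xE -[osp_val _]/(osp_coord 0 1 0 0 0 0 0 0) /osp_coord /wt.
case: a; case: b; rewrite /sf_in dens_actE; apply: superfunP; rewrite /=; euler.
Qed.

Lemma dens_act_xt1_in lam a b : dens_act lam (osp_xt1 R) (sf_in a b f) =
  if a then 2^-1 *: sf_in false b (Cinf_id R * f)
  else (lam + (j%:R + (b : nat)%:R) / 2) *: sf_in true b f.
Proof.
rewrite osp_xt1E -[osp_val _]/(osp_coord 0 0 0 1 0 0 0 0) /osp_coord.
case: a; case: b; rewrite /sf_in dens_actE; apply: superfunP; rewrite /=; euler.
Qed.

Lemma dens_act_xt2_in lam a b : dens_act lam (osp_xt2 R) (sf_in a b f) =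
  (-1) ^+ a *: (if b then 2^-1 *: sf_in a false (Cinf_id R * f)
  else (lam + (j%:R + (a : nat)%:R) / 2) *: sf_in a true f).
Proof.
rewrite osp_xt2E -[osp_val _]/(osp_coord 0 0 0 0 1 0 0 0) /osp_coord.
case: a; case: b; rewrite /sf_in dens_actE; apply: superfunP; rewrite /= ?expr0 ?expr1; euler.
Qed.

End Homogeneous.

Lemma dens_act_t12_in lam a b (f : Cinf R) : dens_act lam (osp_t12 R) (sf_in a b f) =
  match a, b with
  | true, false => - (2^-1 *: sf_in false true f)
  | false, true => 2^-1 *: sf_in true false f
  | _, _ => 0
  end.
Proof.
rewrite osp_t12E -[osp_val _]/(osp_coord 0 0 0 0 0 0 0 1) /osp_coord.
by case: a; case: b; rewrite /sf_in dens_actE; apply: superfunP; rewrite /=; Cinf_field.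
Qed.

Lemma euler_mono j t : t * Cinf_deriv (Cinf_id R ^+ j) t = j%:R * (Cinf_id R ^+ j) t.
Proof.
rewrite -Cinf_polyXn Cinf_poly_deriv !Cinf_poly_val derivXn hornerMn !hornerXn.
rewrite mulrnAr mulr_natl; case: j => [|j]; first by rewrite !mulr0n.
by rewrite -exprS.
Qed.

(** The array of the linear form [F |-> (A F)(0)] on polynomials. *)
Definition germ A : bool -> bool -> nat -> R := fun a b j => ev0 (A (sf_mono R a b j)).

Lemma germ_x lam A a b j :
  ev0 (A (dens_act lam (osp_x R) (sf_mono R a b j))) = wt lam a b j * germ A a b j.
Proof.
by rewrite /sf_mono (dens_act_x_in (euler_mono j)) diffopZ ev0Z.
Qed.

Lemma germ_t12 lam A a b j :
  ev0 (A (dens_act lam (osp_t12 R) (sf_mono R a b j))) = seq_rot (germ A) a b j.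
Proof.
rewrite /sf_mono dens_act_t12_in /seq_rot.
by case: a; case: b; rewrite ?diffopN ?diffopZ ?ev0N ?ev0Z // (linear0 (diffop_val A)) ?(linear0 (@ev0 R)).
Qed.

Lemma germ_xt1 lam A a b j :
  ev0 (A (dens_act lam (osp_xt1 R) (sf_mono R a b j))) = seq_sup1 lam (germ A) a b j.
Proof.
rewrite /sf_mono (dens_act_xt1_in (euler_mono j)) /seq_sup1.
by case: a; rewrite diffopZ ev0Z // -exprS.
Qed.

Lemma germ_xt2 lam A a b j :
  ev0 (A (dens_act lam (osp_xt2 R) (sf_mono R a b j))) = seq_sup2 lam (germ A) a b j.
Proof.
rewrite /sf_mono (dens_act_xt2_in (euler_mono j)) /seq_sup2 diffopZ ev0Z.
by case: b; rewrite diffopZ ev0Z // -exprS.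
Qed.

Lemma germ_finite A : exists N, forall a b j, (N <= j)%N -> germ A a b j = 0.
Proof.
have [N NP] := is_diffop_flat (diffop_is_diffop A); exists N => a b j Nj.
suff /NP[] : flat N 0 (sf_mono R a b j) by [].
move=> i il; rewrite /sf_mono iter_dx_sf_in.
have f0 : iter i (@Cinf_deriv R) (Cinf_id R ^+ j) 0 = 0.
  by rewrite iter_deriv_mono; case: eqP => // ij; move: il; rewrite ij ltnNge Nj.
by case: a; case: b; split.
Qed.

(** The isotropy fields vanish at the origin, so that at this point they act
    on densities through a character: X_x by the weight and the others by 0. *)
Lemma ev0_dens_x mu K : ev0 (dens_act mu (osp_x R) K) = mu * ev0 K.
Proof.
case: K => f0 f1 f2 f12; rewrite osp_xE -[osp_val _]/(osp_coord 0 1 0 0 0 0 0 0) /osp_coord.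
rewrite dens_actE /ev0; cbn [sf0]; etransitivity; first by Cinf_eval.
by rewrite /=; ring.
Qed.

Lemma ev0_dens_t12 mu K : ev0 (dens_act mu (osp_t12 R) K) = 0.
Proof.
case: K => f0 f1 f2 f12; rewrite osp_t12E -[osp_val _]/(osp_coord 0 0 0 0 0 0 0 1) /osp_coord.
rewrite dens_actE /ev0; cbn [sf0]; etransitivity; first by Cinf_eval.
by rewrite /=; ring.
Qed.

Lemma ev0_dens_xt1 mu K : ev0 (dens_act mu (osp_xt1 R) K) = 0.
Proof.
case: K => f0 f1 f2 f12; rewrite osp_xt1E -[osp_val _]/(osp_coord 0 0 0 1 0 0 0 0) /osp_coord.
rewrite dens_actE /ev0; cbn [sf0]; etransitivity; first by Cinf_eval.
by rewrite /=; ring.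
Qed.

Lemma ev0_dens_xt2 mu K : ev0 (dens_act mu (osp_xt2 R) K) = 0.
Proof.
case: K => f0 f1 f2 f12; rewrite osp_xt2E -[osp_val _]/(osp_coord 0 0 0 0 1 0 0 0) /osp_coord.
rewrite dens_actE /ev0; cbn [sf0]; etransitivity; first by Cinf_eval.
by rewrite /=; ring.
Qed.

End IsotropyAction.

(** * Germs detect coboundaries *)
Section Triviality.
Variables (R : realType) (lam mu : R).
Local Notation superfun := (superfun R).
Local Notation diffop := (diffop R).
Implicit Types (F K : superfun) (G H : osp22 R) (v A : diffop).
Implicit Types U : osp22 R -> diffop.
Local Notation Z := (Zpred lam mu).
Local Notation cob := (coboundary lam mu).

Let ohx : homog false (osp_x R) := homog_x R.
Let oh12 : homog false (osp_t12 R) := homog_t12 R.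
Let ohx1 : homog true (osp_xt1 R) := homog_xt1 R.
Let ohx2 : homog true (osp_xt2 R) := homog_xt2 R.

Lemma germ_cob_x v a b j :
  germ (cob v (osp_x R)) a b j = (mu - wt lam a b j) * germ v a b j.
Proof.
rewrite /germ (coboundaryE _ _ _ _ ohx) ev0B ev0_dens_x germ_x /=.
by rewrite mulrBl.
Qed.

Lemma germ_cob_t12 v a b j : germ (cob v (osp_t12 R)) a b j = - seq_rot (germ v) a b j.
Proof.
by rewrite /germ (coboundaryE _ _ _ _ oh12) ev0B ev0_dens_t12 germ_t12 sub0r.
Qed.

Lemma germ_cob_xt1 v a b j : germ (cob v (osp_xt1 R)) a b j = - seq_sup1 lam (germ v) a b j.
Proof.
by rewrite /germ (coboundaryE _ _ _ _ ohx1) ev0B ev0_dens_xt1 germ_xt1 sub0r.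
Qed.

Lemma germ_cob_xt2 v a b j : germ (cob v (osp_xt2 R)) a b j = - seq_sup2 lam (germ v) a b j.
Proof.
by rewrite /germ (coboundaryE _ _ _ _ ohx2) ev0B ev0_dens_xt2 germ_xt2 sub0r.
Qed.

(** The vanishing of the linear forms that obstruct [resonance].  In the
    second clause [k] is one less than the integer of the weights. *)
Definition undetected U : Prop :=
  (mu = lam -> germ (U (osp_x R)) false false 0 = 0 /\ germ (U (osp_t12 R)) false false 0 = 0) /\
  (forall k, lam = - (k.+1%:R / 2) -> mu = k.+1%:R / 2 ->
     [/\ germ (U (osp_x R)) true true k = 0, germ (U (osp_t12 R)) true true k = 0
       & germ (U (osp_xt1 R)) false true k = 0]).

(** On coboundaries the detecting forms are multiples, respectively, of
    [mu - wt], of 0 and of [lam + (k + 1)/2], which all vanish. *)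
Lemma coboundary_undetected v : undetected (cob v).
Proof.
split=> [ml|k lk mk]; split.
- by rewrite germ_cob_x ml /wt /= !addr0 mul0r addr0 subrr mul0r.
- by rewrite germ_cob_t12 /seq_rot oppr0.
- rewrite germ_cob_x (_ : mu - _ = 0) ?mul0r // lk mk /wt -natr1 /=; lra.
- by rewrite germ_cob_t12 /seq_rot oppr0.
- rewrite germ_cob_xt1 /seq_sup1 (_ : lam + _ = 0) ?mul0r ?oppr0 // lk -natr1 /=; lra.
Qed.

Let germB A B a b j : germ (A - B) a b j = germ A a b j - germ B a b j.
Proof. by rewrite /germ diffop_valD diffop_valN ev0B. Qed.

Lemma undetected_sub U W : undetected U -> undetected W -> undetected (U - W).
Proof.
move=> [U1 U2] [W1 W2]; split=> [ml|k lk mk]; rewrite !fun_valB !germB.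
  have [u1 u2] := U1 ml; have [w1 w2] := W1 ml.
  by split; [rewrite u1 w1 subrr|rewrite u2 w2 subrr].
have [u1 u2 u3] := U2 k lk mk; have [w1 w2 w3] := W2 k lk mk.
by split; [rewrite u1 w1 subrr|rewrite u2 w2 subrr|rewrite u3 w3 subrr].
Qed.

Section GermEquations.
Variable W : osp22 R -> diffop.
Hypothesis ZW : W \in Z.

Lemma germ_x_t12 a b j : (mu - wt lam a b j) * germ (W (osp_t12 R)) a b j
    = - seq_rot (germ (W (osp_x R))) a b j.
Proof.
have := congr1 (@ev0 R) (Z_eq ZW (sf_mono R a b j) ohx oh12).
rewrite br_x_t12 (ZZ ZW) scale0r diffop_val0 (linear0 (@ev0 R)) expr0 scale1r.
rewrite !ev0B ev0_dens_x ev0_dens_t12 germ_x germ_t12.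
rewrite -[ev0 _]/(germ (W (osp_t12 R)) a b j).
by lra.
Qed.

Lemma germ_x_xt1 a b j : (mu - wt lam a b j - 2^-1) * germ (W (osp_xt1 R)) a b j
    = - seq_sup1 lam (germ (W (osp_x R))) a b j.
Proof.
have := congr1 (@ev0 R) (Z_eq ZW (sf_mono R a b j) ohx ohx1).
rewrite br_x_xt1 (ZZ ZW) diffop_valZ ev0Z expr0 scale1r.
rewrite !ev0B ev0_dens_x ev0_dens_xt1 germ_x germ_xt1.
rewrite -![ev0 _]/(germ (W (osp_xt1 R)) a b j).
by lra.
Qed.

Lemma germ_x_xt2 a b j : (mu - wt lam a b j - 2^-1) * germ (W (osp_xt2 R)) a b j
    = - seq_sup2 lam (germ (W (osp_x R))) a b j.
Proof.
have := congr1 (@ev0 R) (Z_eq ZW (sf_mono R a b j) ohx ohx2).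
rewrite br_x_xt2 (ZZ ZW) diffop_valZ ev0Z expr0 scale1r.
rewrite !ev0B ev0_dens_x ev0_dens_xt2 germ_x germ_xt2.
rewrite -![ev0 _]/(germ (W (osp_xt2 R)) a b j).
by lra.
Qed.

Lemma germ_t12_xt1 a b j :
  - seq_rot (germ (W (osp_xt1 R))) a b j + seq_sup1 lam (germ (W (osp_t12 R))) a b j
    = - (2^-1 * germ (W (osp_xt2 R)) a b j).
Proof.
have := congr1 (@ev0 R) (Z_eq ZW (sf_mono R a b j) oh12 ohx1).
rewrite br_t12_xt1 (ZZ ZW) diffop_valZ ev0Z expr0 scale1r.
rewrite !ev0B ev0_dens_t12 ev0_dens_xt1 germ_t12 germ_xt1.
rewrite -[ev0 _]/(germ (W (osp_xt2 R)) a b j).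
by lra.
Qed.

Lemma germ_t12_xt2 a b j :
  - seq_rot (germ (W (osp_xt2 R))) a b j + seq_sup2 lam (germ (W (osp_t12 R))) a b j
    = 2^-1 * germ (W (osp_xt1 R)) a b j.
Proof.
have := congr1 (@ev0 R) (Z_eq ZW (sf_mono R a b j) oh12 ohx2).
rewrite br_t12_xt2 (ZZ ZW) diffop_valZ ev0Z expr0 scale1r.
rewrite !ev0B ev0_dens_t12 ev0_dens_xt2 germ_t12 germ_xt2.
rewrite -[ev0 _]/(germ (W (osp_xt1 R)) a b j).
by lra.
Qed.

End GermEquations.

(** After [normalization] the germs satisfy the hypotheses of [resonance]; the
    array it provides is realized by an operator commuting with the translations,
    and [Z_eq0] applies to the difference. *)
Lemma undetected_trivial U : U \in Z -> undetected U -> exists v, U = cob v.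
Proof.
move=> ZU udU; have [v1 [W1 Wt1 Wt2]] := normalization ZU.
set W := U - cob v1 in W1 Wt1 Wt2.
have ZW : W \in Z by rewrite rpredB // coboundary_in.
have [udW1 udW2] : undetected W.
  by apply: undetected_sub => //; exact: coboundary_undetected.
have UE : U = W + cob v1 by rewrite /W subrK.
clearbody W.
have [N [NX NJ NY1 NY2]] : exists N, [/\
    forall a b j, (N <= j)%N -> germ (W (osp_x R)) a b j = 0,
    forall a b j, (N <= j)%N -> germ (W (osp_t12 R)) a b j = 0,
    forall a b j, (N <= j)%N -> germ (W (osp_xt1 R)) a b j = 0 &
    forall a b j, (N <= j)%N -> germ (W (osp_xt2 R)) a b j = 0].
  have [n1 h1] := germ_finite (W (osp_x R)); have [n2 h2] := germ_finite (W (osp_t12 R)).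
  have [n3 h3] := germ_finite (W (osp_xt1 R)); have [n4 h4] := germ_finite (W (osp_xt2 R)).
  exists (maxn (maxn n1 n2) (maxn n3 n4)); split=> a b j;
  rewrite !geq_max => /andP[/andP[l1 l2] /andP[l3 l4]];
  by [exact: h1|exact: h2|exact: h3|exact: h4].
have [c [c0 cX cJ cY1 cY2]] := resonance (germ_x_t12 ZW) (germ_x_xt1 ZW) (germ_x_xt2 ZW)
  (germ_t12_xt1 ZW) (germ_t12_xt2 ZW) udW1 udW2
  (fun a b j Nj => And4 (NX a b j Nj) (NJ a b j Nj) (NY1 a b j Nj) (NY2 a b j Nj)).
have [v2 [nv2 gv2]] := nilinvariant_interpolation (N := N.+1) c0.
have gv : germ v2 = c by apply/funext => a; apply/funext => b; apply/funext => j; exact: gv2.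
have ZW2 : W - cob v2 \in Z by rewrite rpredB // coboundary_in.
have cob_nil G : (forall F, cob v2 G F = 0) -> W G = 0 -> (W - cob v2) G = 0.
  by move=> cG WG; apply: diffopP => F; rewrite fun_valB WG sub0r diffop_valN cG oppr0.
case: nv2 => n0 n1 n2.
have W20 : W - cob v2 = 0.
  apply: (Z_eq0 ZW2).
  - apply: cob_nil => // F.
    by rewrite (coboundaryE _ _ _ _ (homog_1 R)) !dens_act_1 /= n0 subrr.
  - apply: cob_nil => // F.
    by rewrite (coboundaryE _ _ _ _ (homog_t1 R)) !dens_act_t1 /= n1 subrr.
  - apply: cob_nil => // F.
    by rewrite (coboundaryE _ _ _ _ (homog_t2 R)) !dens_act_t2 /= n2 subrr.
  - by move=> a b j; rewrite fun_valB -/(germ _ a b j) germB germ_cob_x gv cX subrr.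
  - by move=> a b j; rewrite fun_valB -/(germ _ a b j) germB germ_cob_t12 gv cJ subrr.
  - by move=> a b j; rewrite fun_valB -/(germ _ a b j) germB germ_cob_xt1 gv cY1 subrr.
  - by move=> a b j; rewrite fun_valB -/(germ _ a b j) germB germ_cob_xt2 gv cY2 subrr.
exists (v1 + v2); rewrite coboundaryD; move/eqP: W20; rewrite subr_eq0 => /eqP <-.
by rewrite UE addrC.
Qed.

End Triviality.

(** * Cocycles between equal weights, and the invariant operator *)
Section SuperfunComputation.
Variable R : realType.
Implicit Types f g : Cinf R.
Local Notation D := (@Cinf_deriv R).

Lemma SFun_mul f0 f1 f2 f12 g0 g1 g2 g12 : SFun f0 f1 f2 f12 * SFun g0 g1 g2 g12 =
  SFun (f0 * g0) (f0 * g1 + f1 * g0) (f0 * g2 + f2 * g0)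
    (f0 * g12 + f12 * g0 + f1 * g2 - f2 * g1) :> superfun R.
Proof. by []. Qed.
Lemma SFun_add f0 f1 f2 f12 g0 g1 g2 g12 : SFun f0 f1 f2 f12 + SFun g0 g1 g2 g12 =
  SFun (f0 + g0) (f1 + g1) (f2 + g2) (f12 + g12) :> superfun R.
Proof. by []. Qed.
Lemma SFun_opp f0 f1 f2 f12 :
  - SFun f0 f1 f2 f12 = SFun (- f0) (- f1) (- f2) (- f12) :> superfun R.
Proof. by []. Qed.
Lemma SFun_scale c f0 f1 f2 f12 :
  c *: SFun f0 f1 f2 f12 = SFun (c *: f0) (c *: f1) (c *: f2) (c *: f12) :> superfun R.
Proof. by []. Qed.
Lemma SFun_dx f0 f1 f2 f12 :
  dx (SFun f0 f1 f2 f12) = SFun (D f0) (D f1) (D f2) (D f12).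
Proof. by []. Qed.
Lemma SFun_d2 f0 f1 f2 f12 : d2 (SFun f0 f1 f2 f12) = SFun f2 (- f12) 0 0.
Proof. by []. Qed.
Lemma SFun_sign f0 f1 f2 f12 : sf_sign (SFun f0 f1 f2 f12) = SFun f0 (- f1) (- f2) f12.
Proof. by []. Qed.
Lemma SFun_etab1 f0 f1 f2 f12 :
  etab1 (SFun f0 f1 f2 f12) = SFun f1 (- D f0) f12 (- D f2).
Proof. by rewrite etab1E. Qed.
Lemma SFun_etab2 f0 f1 f2 f12 :
  etab2 (SFun f0 f1 f2 f12) = SFun f2 (- f12) (- D f0) (D f1).
Proof. by rewrite etab2E. Qed.

Definition SFunE := (SFun_mul, SFun_add, SFun_opp, SFun_scale, SFun_dx, SFun_d2, SFun_sign,
  SFun_etab1, SFun_etab2, contact_bracketE, dens_actE).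

End SuperfunComputation.

Section ExplicitCocycles.
Variable R : realType.
Local Notation superfun := (superfun R).
Local Notation diffop := (diffop R).
Implicit Types (F K : superfun) (G H : osp22 R) (v A B : diffop).
Implicit Types U W : osp22 R -> diffop.

Definition mult_cochain (c : superfun -> superfun) G : diffop := mul_op (c G) (op_id R).

Lemma mult_cochainE c G F : mult_cochain c G F = c G * F. Proof. by []. Qed.

Lemma mult_cochain_linear (c : {linear superfun -> superfun}) : linear (mult_cochain c).
Proof.
move=> a G H; apply: diffopP => F; rewrite diffop_valD diffop_valZ !mult_cochainE.
by rewrite -[osp_val (a *: G + H)]/(a *: osp_val G + osp_val H) linearP mulrDl scalerAl.
Qed.

Lemma mult_dx_in lam : mult_cochain (@dx R) \in Zpred lam lam.
Proof.
apply/ZpredP; split; first exact: (mult_cochain_linear (@dx R)).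
move=> p q G H F /homog_sf pG /homog_sf qH; rewrite /delta1_term !twE !mult_cochainE.
rewrite -[osp_val (osp_bracket _ _)]/(contact_bracket G H) -pG -qH.
case: (osp_val G) => g0 g1 g2 g12; case: (osp_val H) => h0 h1 h2 h12.
case: F => f0 f1 f2 f12 {pG qH}.
case: p; case: q; cbn [sf_part sf0 sf1 sf2 sf12 andb];
rewrite ?expr0 ?expr1 !SFunE;
by apply: superfunP; rewrite /=; Cinf_field.
Qed.

Lemma mult_eta12_in lam : mult_cochain (@etab1 R \o @etab2 R) \in Zpred lam lam.
Proof.
apply/ZpredP; split; first exact: (mult_cochain_linear (@etab1 R \o @etab2 R)).
move=> p q G H F /homog_sf pG /homog_sf qH; rewrite /delta1_term !twE !mult_cochainE.
rewrite -[osp_val (osp_bracket _ _)]/(contact_bracket G H) -pG -qH.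
case: (osp_val G) => g0 g1 g2 g12; case: (osp_val H) => h0 h1 h2 h12.
case: F => f0 f1 f2 f12 {pG qH}.
case: p; case: q; cbn [sf_part sf0 sf1 sf2 sf12 andb comp];
rewrite ?expr0 ?expr1 !SFunE;
by apply: superfunP; rewrite /=; Cinf_field.
Qed.

(** For nonzero [lam] the cocycle [tUpsilon_diag] is [2 lam] times
    multiplication by [etabar_1 etabar_2 (G)], plus the coboundary of this operator
    ([rot_cocycleE]). *)
Definition tilt_op : diffop := 2 *: mul_op (theta2 R) (op_etab1 R).

Lemma tilt_opE F : tilt_op F = 2 *: (theta2 R * etab1 F). Proof. by []. Qed.

Definition rot_cocycle (lam : R) : osp22 R -> diffop :=
  if lam == 0 then mult_cochain (@etab1 R \o @etab2 R)
  else (2 * lam) *: mult_cochain (@etab1 R \o @etab2 R) + coboundary lam lam tilt_op.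

Lemma rot_cocycle_in lam : rot_cocycle lam \in Zpred lam lam.
Proof.
rewrite /rot_cocycle; case: ifP => _; first exact: mult_eta12_in.
by rewrite rpredD ?rpredZ ?mult_eta12_in ?coboundary_in.
Qed.

Lemma rot_cocycleE lam G F : rot_cocycle lam G F = tUpsilon_diag lam G F.
Proof.
rewrite /rot_cocycle /tUpsilon_diag; case: ifP => // _.
transitivity ((2 * lam) *: (etab1 (etab2 G) * F) + coboundary lam lam tilt_op G F) => //.
rewrite /coboundary delta0E twistE !tilt_opE /theta2.
case: (osp_val G) => g0 g1 g2 g12; case: F => f0 f1 f2 f12.
cbn [sf_part sf0 sf1 sf2 sf12]; rewrite !SFunE.
by apply: superfunP; rewrite /=; Cinf_field.
Qed.

Lemma iter_etab2_even n F : iter (2 * n) (@etab2 R) F = (-1) ^+ n *: iter n (@dx R) F.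
Proof.
elim: n => [|n IH]; first by rewrite muln0 expr0 scale1r.
rewrite mulnS !iterS IH etab2_etab2.
by rewrite linearZ /= exprS mulN1r scaleNr.
Qed.

Lemma iter_etab1_even n F : iter (2 * n) (@etab1 R) F = (-1) ^+ n *: iter n (@dx R) F.
Proof.
elim: n => [|n IH]; first by rewrite muln0 expr0 scale1r.
rewrite mulnS !iterS IH etab1_etab1.
by rewrite linearZ /= exprS mulN1r scaleNr.
Qed.

(** The operator [etabar_1 etabar_2^(2 n + 1)] ([inv_opE]), written with d/dx since
    [etabar_2^2 = - d/dx].  With [k = n + 1] it intertwines the weights [- k/2] and
    [k/2]. *)
Definition inv_op (n : nat) : diffop := (-1) ^+ n *: op_eta R true true n.

Lemma inv_op_dx n F : inv_op n F = (-1) ^+ n *: etab1 (etab2 (iter n (@dx R) F)).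
Proof. by rewrite /inv_op diffop_valZ op_etaE. Qed.

Lemma inv_opE n F : inv_op n F = eta_mono (1, (2 * n).+1)%N F.
Proof.
rewrite inv_op_dx /eta_mono /= iter_etab2_even.
by rewrite -[etab2 (_ *: _)]/(etab2 _) ![etab2 (_ *: _)]linearZ ![etab1 (_ *: _)]linearZ.
Qed.

Lemma germ_inv_op n a b j : germ (inv_op n) a b j =
  if [&& a, b & j == n] then - ((-1) ^+ n * n`!%:R) else 0.
Proof.
rewrite /germ /inv_op diffop_valZ ev0Z ev0_op_eta /= expr1 mulN1r.
rewrite [n == j]eq_sym; case: a; case: b; rewrite /= ?mulr0 //.
by case: ifP => _; rewrite ?mulr0 // mulrN.
Qed.

Lemma inv_op_twist n : twist (inv_op n) = inv_op n.
Proof.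
apply: diffopP => F; rewrite twistE !inv_op_dx.
have -> : iter n (@dx R) (sf_sign F) = sf_sign (iter n (@dx R) F).
  by elim: n => // n IH; rewrite !iterS IH dx_sign.
rewrite sf_signZ; congr (_ *: _); case: (iter n _ F) => f0 f1 f2 f12.
by rewrite !SFunE; apply: superfunP; rewrite /=; Cinf_field.
Qed.

Lemma inv_op_nilinvariant n : nilinvariant (inv_op n).
Proof. exact/nilinvariantZ/nilinvariant_op_eta. Qed.

(** The coboundary of [inv_op n] is a cocycle that vanishes on the translations,
    so by [Z_eq0] it is enough to look at germs.  The germ of [inv_op n] is
    supported at [x^n theta_1 theta_2], where [mu - wt] and [lam + (n + 1)/2] are 0. *)
Lemma inv_op_coboundary n : coboundary (- (n.+1%:R / 2)) (n.+1%:R / 2) (inv_op n) = 0.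
Proof.
set lam := - _; set mu := _ / 2.
have [n0 n1 n2] := inv_op_nilinvariant n.
apply: (Z_eq0 (coboundary_in _ _ _)).
- by apply: diffopP => F; rewrite (coboundaryE _ _ _ _ (homog_1 R)) !dens_act_1 n0 subrr.
- by apply: diffopP => F; rewrite (coboundaryE _ _ _ _ (homog_t1 R)) !dens_act_t1 n1 subrr.
- by apply: diffopP => F; rewrite (coboundaryE _ _ _ _ (homog_t2 R)) !dens_act_t2 n2 subrr.
- move=> a b j; rewrite -[LHS]/(germ _ a b j) germ_cob_x germ_inv_op.
  case: a; case: b; rewrite /= ?mulr0 //; case: eqP => [->|_]; rewrite ?mulr0 //.
  by rewrite (_ : mu - _ = 0) ?mul0r // /mu /lam /wt -natr1 /=; lra.
- move=> a b j; rewrite -[LHS]/(germ _ a b j) germ_cob_t12 /seq_rot !germ_inv_op /=.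
  by case: a; case: b; rewrite ?mulr0 ?oppr0.
- move=> a b j; rewrite -[LHS]/(germ _ a b j) germ_cob_xt1 /seq_sup1 !germ_inv_op /=.
  case: a; rewrite ?mulr0 ?oppr0 //; case: b; rewrite /= ?mulr0 ?oppr0 //.
  case: eqP => [->|_]; rewrite ?mulr0 ?oppr0 //.
  by rewrite (_ : lam + _ = 0) ?mul0r ?oppr0 // /lam -natr1 /=; lra.
- move=> a b j; rewrite -[LHS]/(germ _ a b j) germ_cob_xt2 /seq_sup2 !germ_inv_op /=.
  case: a; case: b; rewrite /= ?mulr0 ?oppr0 //.
  case: eqP => [->|_]; rewrite ?mulr0 ?oppr0 //.
  by rewrite (_ : lam + _ = 0) ?mul0r ?mulr0 ?oppr0 // /lam -natr1 /=; lra.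
Qed.

Lemma inv_op_invariant n p G F : homog p G ->
  dens_act (n.+1%:R / 2) G (inv_op n F) = inv_op n (dens_act (- (n.+1%:R / 2)) G F).
Proof.
move=> pG; have := coboundaryE (- (n.+1%:R / 2)) (n.+1%:R / 2) (inv_op n) F pG.
rewrite inv_op_coboundary diffop_val0.
have -> : tw p (inv_op n) = inv_op n by case: (p) => //; exact: inv_op_twist.
by move/esym/eqP; rewrite subr_eq0 => /eqP.
Qed.

End ExplicitCocycles.

(** * Cocycles between opposite weights *)
Section ComposedCocycles.
Variable R : realType.
Local Notation superfun := (superfun R).
Local Notation diffop := (diffop R).
Implicit Types (F K : superfun) (G H : osp22 R) (v A B : diffop).
Implicit Types U W : osp22 R -> diffop.

Lemma tw_compr p A B F : twist B = B ->
  tw p (diffop_comp A B) F = tw p A (B F).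
Proof.
by move=> tB; rewrite !twE !diffop_val_comp -{1}tB twistE sf_signK.
Qed.

Lemma tw_compl p A B F : twist B = B ->
  tw p (diffop_comp B A) F = B (tw p A F).
Proof.
by move=> tB; rewrite !twE !diffop_val_comp -{1}tB twistE sf_signK; case: p.
Qed.

(** Composing with an even invariant operator, on either side, is a morphism
    of modules and so preserves cocycles. *)
Lemma cocycle_compr n U : let lam := - (n.+1%:R / 2) in let mu := n.+1%:R / 2 in
  U \in Zpred mu mu -> (fun G => diffop_comp (U G) (inv_op R n)) \in Zpred lam mu.
Proof.
move=> lam mu /ZpredP[lU cU]; apply/ZpredP; split=> [a G H|p q G H F pG qH].
  by rewrite lU diffop_compDl.
rewrite -(cU p q G H (inv_op R n F) pG qH) /delta1_term.
rewrite !(tw_compr _ _ _ (inv_op_twist R n)) !diffop_val_comp.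
by rewrite (inv_op_invariant n F pG) (inv_op_invariant n F qH).
Qed.

Lemma cocycle_compl n U : let lam := - (n.+1%:R / 2) in let mu := n.+1%:R / 2 in
  U \in Zpred lam lam -> (fun G => diffop_comp (inv_op R n) (U G)) \in Zpred lam mu.
Proof.
move=> lam mu /ZpredP[lU cU]; apply/ZpredP; split=> [a G H|p q G H F pG qH].
  by rewrite lU diffop_compDr.
have i0 : inv_op R n 0 = 0 by exact: linear0.
rewrite -[RHS]i0 -(cU p q G H F pG qH) /delta1_term.
rewrite !tw_compl ?inv_op_twist // !diffop_val_comp.
rewrite (inv_op_invariant n _ pG) (inv_op_invariant n _ qH).
by rewrite !diffopB diffopZ diffopB.
Qed.

Definition cocycle_dx (n : nat) G : diffop := diffop_comp (mult_cochain (@dx R) G) (inv_op R n).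
Definition cocycle_rot (n : nat) G : diffop := diffop_comp (rot_cocycle (n.+1%:R / 2) G) (inv_op R n).
Definition cocycle_comm (n : nat) : osp22 R -> diffop :=
  cocycle_dx n - (fun G => diffop_comp (inv_op R n) (mult_cochain (@dx R) G)).

Lemma cocycle_dx_in n : cocycle_dx n \in Zpred (- (n.+1%:R / 2)) (n.+1%:R / 2).
Proof. exact/cocycle_compr/mult_dx_in. Qed.

Lemma cocycle_rot_in n : cocycle_rot n \in Zpred (- (n.+1%:R / 2)) (n.+1%:R / 2).
Proof. exact/cocycle_compr/rot_cocycle_in. Qed.

Lemma cocycle_comm_in n : cocycle_comm n \in Zpred (- (n.+1%:R / 2)) (n.+1%:R / 2).
Proof. by rewrite rpredB ?cocycle_dx_in //; exact/cocycle_compl/mult_dx_in. Qed.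

Lemma cocycle_dxE n G F : cocycle_dx n G F = Upsilon_k n.+1 G F.
Proof.
rewrite /cocycle_dx diffop_val_comp mult_cochainE inv_opE /Upsilon_k.
by rewrite mulnS add2n subn1.
Qed.

Lemma half_neq0 n : n.+1%:R / 2 != 0 :> R.
Proof. by rewrite mulf_neq0 ?invr_neq0 ?pnatr_eq0. Qed.

Lemma etab1_inv_op n F : etab1 (inv_op R n F) = eta_mono (0, 2 * n.+1 + 1)%N F.
Proof.
have -> : (2 * n.+1 + 1)%N = (2 * n).+3 by rewrite addn1 mulnS.
by rewrite inv_opE /eta_mono /= etab1_etab1 -etab2_etab2.
Qed.

Lemma etab2_inv_op n F : etab2 (inv_op R n F) = - eta_mono (2 * n.+1 + 1, 0)%N F.
Proof.
rewrite addn1 inv_opE.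
rewrite -[eta_mono (1, _) F]/(etab1 (iter (2 * n).+1 (@etab2 R) F)).
rewrite -[eta_mono _ F]/(etab1 (iter (2 * n.+1) (@etab1 R) F)).
rewrite etab2_etab1 -iterS iter_etab1_even -iter_etab2_even.
by have -> : (2 * n.+1)%N = (2 * n).+2 by rewrite mulnS.
Qed.

Lemma cocycle_rotE n G F : cocycle_rot n G F = tUpsilon_k n.+1 G F.
Proof.
rewrite /cocycle_rot diffop_val_comp rot_cocycleE /tUpsilon_diag (negbTE (half_neq0 n)).
rewrite /tUpsilon_k etab1_inv_op etab2_inv_op mulrCA mulfV ?pnatr_eq0 // mulr1.
rewrite inv_opE; congr (_ - _).
  by rewrite mulnS add2n subn1.
congr (_ + _); rewrite mulrN; congr (- (_ * _)).
rewrite /theta2; case: (osp_val G) => g0 g1 g2 g12.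
by rewrite !SFunE; apply: superfunP; rewrite /=; Cinf_field.
Qed.

Lemma dxD F K : dx (F + K) = dx F + dx K. Proof. exact: linearD. Qed.
Lemma etab1D F K : etab1 (F + K) = etab1 F + etab1 K. Proof. exact: linearD. Qed.
Lemma etab2D F K : etab2 (F + K) = etab2 F + etab2 K. Proof. exact: linearD. Qed.
Lemma etab1Z a F : etab1 (a *: F) = a *: etab1 F. Proof. exact: linearZ. Qed.
Lemma etab2Z a F : etab2 (a *: F) = a *: etab2 F. Proof. exact: linearZ. Qed.

Lemma etab12D F K : etab1 (etab2 (F + K)) = etab1 (etab2 F) + etab1 (etab2 K).
Proof. by rewrite etab2D; exact: etab1D. Qed.

Lemma etab12Z a F : etab1 (etab2 (a *: F)) = a *: etab1 (etab2 F).
Proof. by rewrite etab2Z; exact: etab1Z. Qed.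

Lemma etab12M F K : etab1 (etab2 (F * K)) = etab1 (etab2 F) * K
  + sf_sign (etab2 F) * etab1 K + (etab1 (sf_sign F) * etab2 K + F * etab1 (etab2 K)).
Proof.
rewrite etab2M; have := etab1D (etab2 F * K) (sf_sign F * etab2 K) => ->.
by rewrite !etab1M sf_signK.
Qed.

Lemma iter_dx_mul m (g : superfun) F : dx (dx g) = 0 ->
  iter m (@dx R) (g * F) = g * iter m (@dx R) F + m%:R *: (dx g * iter m.-1 (@dx R) F).
Proof.
move=> g2; elim: m => [|m IH]; first by rewrite scale0r addr0.
rewrite iterS IH dxD dxZ !dx_mul g2 mul0r add0r -natr1 scalerDl scale1r.
rewrite -[m.+1.-1]/m -addrA addrCA; congr (_ + _); rewrite addrC; congr (_ + _).
by case: m {IH} => [|m]; rewrite ?scale0r.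
Qed.

Lemma eta_mono_1_odd n F :
  n%:R *: eta_mono (1, 2 * n.+1 - 3)%N F =
  n%:R *: (- ((-1) ^+ n *: etab1 (etab2 (iter n.-1 (@dx R) F)))).
Proof.
(* For n = 0 the exponent is truncated, but the coefficient is 0. *)
case: n => [|m]; first by rewrite !scale0r.
have -> : (2 * m.+2 - 3 = (2 * m).+1)%N by rewrite !mulnS.
rewrite -inv_opE inv_op_dx exprS mulN1r scaleNr opprK //.
Qed.

(** By the Leibniz rule: for [G] in osp(2|2), [G''] is constant and
    [etabar_1 etabar_2 (G')] is 0, so that only three terms of the commutator are
    left. *)
Lemma cocycle_commE n G F : cocycle_comm n G F = bUpsilon_k n.+1 G F.
Proof.
have [c [g2E g3E e12E]] : exists c, [/\ dx (dx G) = c *: 1, dx (dx (dx G)) = 0 &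
    etab1 (etab2 (dx G)) = 0].
  have [a [b [c [q1 [q2 [p1 [p2 [d ->]]]]]]]] := osp_vecP G.
  rewrite -[osp_val _]/(osp_coord a b c q1 q2 p1 p2 d) /osp_coord.
  by exists (2 * c); rewrite !SFunE; split; apply: superfunP; rewrite /=; Cinf_field.
transitivity (dx G * inv_op R n F - inv_op R n (dx G * F)) => //.
rewrite /bUpsilon_k -natr1 addrK.
have -> : n%:R *: (dx (dx G) * eta_mono (1, 2 * n.+1 - 3)%N F) =
    dx (dx G) * (n%:R *: eta_mono (1, 2 * n.+1 - 3)%N F) by rewrite sf_scaleAr.
rewrite eta_mono_1_odd.
have -> : (2 * n.+1 - 1 = (2 * n).+1)%N by rewrite mulnS.
rewrite -[eta_mono (_, 0)%N F]/(etab1 (iter (2 * n) (@etab1 R) F)).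
rewrite -[eta_mono (0, _)%N F]/(etab2 (iter (2 * n) (@etab2 R) F)).
rewrite iter_etab1_even iter_etab2_even !inv_op_dx (iter_dx_mul _ _ g3E).
rewrite etab12D etab12Z etab12M e12E mul0r add0r g2E !dx_sign etab1Z etab2Z.
have -> : etab2 (sf_sign (dx G)) = - sf_sign (etab2 (dx G)).
  by case: (dx G) => ????; rewrite !SFunE; apply: superfunP; rewrite /=; Cinf_field.
have mulc (K : superfun) : c *: 1 * K = c *: K by rewrite -scalerAl mul1r.
rewrite !mulc etab12Z -!sf_scaleAr mulNr.
set X1 := dx G * _; set X2 := etab1 (etab2 (iter n.-1 _ _)).
set X3 := sf_sign (etab2 (dx G)) * _; set X4 := etab1 (sf_sign (dx G)) * _.
case: X1 => ????; case: X2 => ????; case: X3 => ????; case: X4 => ????.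
by rewrite !SFunE; apply: superfunP; rewrite /=; Cinf_field.
Qed.

End ComposedCocycles.

(** * Cohomology as the dual of the detecting forms *)
Section QuotientByForms.
Variables (R : fieldType) (V : lmodType R) (W : submodClosed V).

Lemma quotmod_pi_surj (x : quotmod W) : exists v, quotmod_pi W v = x.
Proof. by exists (repr (x : Quotient.quot _)); exact: quotmod_pi_repr. Qed.

(** The forms [phi i] have [W] as common kernel, so that they embed the quotient
    in the space of row vectors; vectors [e j] on which they are diagonal show that this
    embedding is onto and that the classes of the [e j] span. *)
Lemma quotmod_dual_basis n (phi : 'I_n -> V -> R) (e : 'I_n -> V) (d : 'I_n -> R) :
  (forall i, linear_for *%R (phi i)) ->
  (forall v, v \in W <-> (forall i, phi i v = 0)) ->
  (forall i, d i != 0) ->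
  (forall i j, phi i (e j) = if i == j then d i else 0) ->
  lmod_isomorphic (quotmod W) 'rV[R]_n /\
  forall x, exists c : 'I_n -> R, x = \sum_i c i *: quotmod_pi W (e i).
Proof.
move=> lphi kphi dne phie.
have phiB i x y : phi i (x - y) = phi i x - phi i y.
  by rewrite addrC -scaleN1r lphi mulN1r addrC.
pose lift (x : quotmod W) := sval (cid (quotmod_pi_surj x)).
have liftK x : quotmod_pi W (lift x) = x by rewrite /lift; case: cid.
pose f (x : quotmod W) : 'rV[R]_n := \row_i phi i (lift x).
have f_pi v : f (quotmod_pi W v) = \row_i phi i v.
  apply/rowP => i; rewrite !mxE; apply/eqP; rewrite -subr_eq0 -phiB; apply/eqP.
  by move: i; apply/kphi/quotmod_piE; rewrite liftK.
have lf : linear f.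
  move=> a x y; rewrite -(liftK x) -(liftK y) -quotmod_pi_linear !f_pi.
  by apply/rowP => i; rewrite !mxE lphi.
pose comb (c : 'I_n -> R) := \sum_j c j *: e j.
have phi_comb c i : phi i (comb c) = c i * d i.
  have phi0 : phi i 0 = 0 by rewrite -(subrr 0) phiB subrr.
  transitivity (\sum_j c j * phi i (e j)).
    by rewrite /comb; elim/big_rec2: _ => [//|j x y _ <-]; rewrite lphi.
  rewrite (bigD1 i) //= phie eqxx big1 ?addr0 // => j ji.
  by rewrite phie eq_sym (negbTE ji) mulr0.
have piE x : x = quotmod_pi W (comb (fun j => phi j (lift x) / d j)).
  rewrite -[LHS]liftK; apply/quotmod_piE/kphi => i.
  by rewrite phiB phi_comb divfK // subrr.
split; last first.
  move=> x; exists (fun j => phi j (lift x) / d j); rewrite {1}[LHS]piE /comb.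
  by rewrite linear_sum; apply: eq_bigr => j _; rewrite linearZ.
pose fl : {linear quotmod W -> 'rV[R]_n} := HB.pack f (GRing.isLinear.Build R _ _ _ f lf).
exists fl, (fun r : 'rV[R]_n => quotmod_pi W (comb (fun j => r 0 j / d j))) => [x|r] /=.
  rewrite [RHS]piE; congr (quotmod_pi W (comb _)); apply/funext => j.
  by rewrite /f mxE.
by rewrite f_pi; apply/rowP => i; rewrite mxE phi_comb divfK.
Qed.

End QuotientByForms.

Section Cohomology.
Variables (R : realType) (lam mu : R).
Local Notation superfun := (superfun R).
Local Notation diffop := (diffop R).
Local Notation Z1 := (Z1diff lam mu).
Implicit Types z w : Z1.

Lemma Z1_in z : cocycle_val z \in Zpred lam mu.
Proof. by case: z. Qed.

Definition Z1_of U (ZU : U \in Zpred lam mu) : Z1 := Cocycle ZU.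

Lemma coboundary_predP z :
  z \in @coboundary_pred _ _ _ (@osp_part R) (fun r => diffop_part r : {linear diffop -> diffop})
  (@osp_bracket R) (fun G : osp22 R => diffop_act lam mu G : {linear diffop -> diffop})
  (@cochain_pred R) <-> undetected lam mu (cocycle_val z).
Proof.
split=> [/asboolP[v ->]|ud]; first exact: coboundary_undetected.
by have [v vE] := undetected_trivial (Z1_in z) ud; apply/asboolP; exists v.
Qed.

Lemma H1_class_eq z w : undetected lam mu (cocycle_val (z - w)) -> H1diff_class z = H1diff_class w.
Proof. by move=> ud; apply/quotmod_piE/coboundary_predP. Qed.

Lemma ev0_part_true (K : superfun) : ev0 (sf_part true K) = 0.
Proof. by []. Qed.

Lemma sf_part_mono p a b j :
  sf_part p (sf_mono R a b j) = if a (+) b == p then sf_mono R a b j else 0.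
Proof. by case: p; case: a; case: b. Qed.

Lemma germ_odd_part (A : diffop) r a b j : a (+) b != r -> germ (diffop_part r A) a b j = 0.
Proof.
rewrite /germ diffop_partE !sf_part_mono.
have A0 : A 0 = 0 by exact: linear0.
have s0 p : sf_part p (0 : superfun) = 0 by exact: linear0.
by case: r; case: a; case: b => //= _; rewrite A0 ?s0 ?addr0 ?add0r; exact: ev0_part_true.
Qed.

(** In each detecting form, the parities of the field and of the monomial agree,
    so that an odd cocycle yields an odd function, whose value at the origin is 0. *)
Lemma odd_undetected U : U \in Zpred lam mu ->
  hom_part (@osp_part R) (fun r => diffop_part r : {linear diffop -> diffop}) true U = U ->
  undetected lam mu U.
Proof.
move=> /ZpredP[lU _] oU.
have E q G : homog q G -> U G = diffop_part (q (+) true) (U G).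
  by move=> qG; rewrite -{1}oU; exact: hom_part_homog.
by split=> [_|k _ _]; split; rewrite (E _ _ (homog_x R), E _ _ (homog_t12 R), E _ _ (homog_xt1 R));
  exact: germ_odd_part.
Qed.

Lemma H1_class0 : H1diff_class (0 : Z1) = 0.
Proof.
exact: (linear0 (@quotmod_pi _ _ (@coboundary_pred _ _ _ (@osp_part R)
  (fun r => diffop_part r : {linear diffop -> diffop}) (@osp_bracket R)
  (fun G : osp22 R => diffop_act lam mu G : {linear diffop -> diffop}) (@cochain_pred R)))).
Qed.

Lemma H1_purely_even : purely_even lam mu.
Proof.
move=> h [z oz <-].
rewrite -H1_class0; apply: H1_class_eq; rewrite subr0; exact: odd_undetected (Z1_in z) oz.
Qed.

End Cohomology.

Section DetectingValues.
Variable R : realType.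
Local Notation superfun := (superfun R).
Local Notation diffop := (diffop R).
Implicit Types F : superfun.

Ltac ev0_field :=
  rewrite /ev0 !SFunE; cbn [sf0]; etransitivity; [Cinf_eval|]; by rewrite /=; field.

Lemma ev0_rot_x (lam : R) F : ev0 (rot_cocycle lam (osp_x R) F) = 0.
Proof.
rewrite rot_cocycleE osp_xE -[osp_val _]/(osp_coord 0 1 0 0 0 0 0 0) /osp_coord.
rewrite /tUpsilon_diag /theta2; case: F => f0 f1 f2 f12; case: ifP => _; ev0_field.
Qed.

Lemma ev0_rot_xt1 (lam : R) F : ev0 (rot_cocycle lam (osp_xt1 R) F) = 0.
Proof.
rewrite rot_cocycleE osp_xt1E -[osp_val _]/(osp_coord 0 0 0 1 0 0 0 0) /osp_coord.
rewrite /tUpsilon_diag /theta2; case: F => f0 f1 f2 f12; case: ifP => _; ev0_field.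
Qed.

(** The factor by which the value of [rot_cocycle lam] on X_theta1theta2 acts
    at the origin. *)
Definition rot_weight (lam : R) : R := if lam == 0 then - 1 else - (2 * lam).

Lemma rot_weight_neq0 lam : rot_weight lam != 0.
Proof.
rewrite /rot_weight; case: (eqVneq lam 0) => [_|ne]; rewrite oppr_eq0 ?oner_eq0 //.
by rewrite mulf_neq0 // pnatr_eq0.
Qed.

Lemma ev0_rot_t12 (lam : R) F : ev0 (rot_cocycle lam (osp_t12 R) F) = rot_weight lam * ev0 F.
Proof.
rewrite rot_cocycleE osp_t12E -[osp_val _]/(osp_coord 0 0 0 0 0 0 0 1) /osp_coord.
rewrite /tUpsilon_diag /theta2 /rot_weight.
by case: F => f0 f1 f2 f12; case: ifP => _; ev0_field.
Qed.

Lemma dx_x : dx (osp_x R) = 1.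
Proof.
rewrite osp_xE -[osp_val _]/(osp_coord 0 1 0 0 0 0 0 0) /osp_coord SFun_dx.
by apply: superfunP; rewrite /=; Cinf_field.
Qed.

Lemma dx_t12 : dx (osp_t12 R) = 0.
Proof.
rewrite osp_t12E -[osp_val _]/(osp_coord 0 0 0 0 0 0 0 1) /osp_coord SFun_dx.
by apply: superfunP; rewrite /=; Cinf_field.
Qed.

Lemma dx_xt1 : dx (osp_xt1 R) = theta1 R.
Proof.
rewrite osp_xt1E -[osp_val _]/(osp_coord 0 0 0 1 0 0 0 0) /osp_coord SFun_dx /theta1.
by apply: superfunP; rewrite /=; Cinf_field.
Qed.

Lemma theta1_mono b j : theta1 R * sf_mono R false b j = sf_mono R true b j.
Proof.
rewrite /sf_mono; set f := _ ^+ j.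
by case: b; rewrite /sf_in /theta1 SFun_mul; apply: superfunP; rewrite /=; Cinf_field.
Qed.

Lemma ev0_theta1 F : ev0 (theta1 R * F) = 0.
Proof. by rewrite /theta1; case: F => f0 f1 f2 f12; ev0_field. Qed.

(** The only nonzero entry of the germ of [inv_op n]. *)
Definition inv_germ n : R := - ((-1) ^+ n * n`!%:R).

Lemma inv_germ_neq0 n : inv_germ n != 0.
Proof.
by rewrite oppr_eq0 mulf_neq0 ?signr_eq0 // pnatr_eq0 -lt0n fact_gt0.
Qed.

Lemma ev0_inv_op_mono n : ev0 (inv_op R n (sf_mono R true true n)) = inv_germ n.
Proof. by rewrite -[LHS]/(germ _ _ _ _) germ_inv_op eqxx. Qed.

Lemma germ_dx_x n a b j : germ (cocycle_dx n (osp_x R)) a b j = germ (inv_op R n) a b j.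
Proof. by rewrite /germ /cocycle_dx diffop_val_comp mult_cochainE dx_x mul1r. Qed.

Lemma germ_dx_t12 n a b j : germ (cocycle_dx n (osp_t12 R)) a b j = 0.
Proof.
by rewrite /germ /cocycle_dx diffop_val_comp mult_cochainE dx_t12 mul0r; exact: linear0.
Qed.

Lemma germ_dx_xt1 n a b j : germ (cocycle_dx n (osp_xt1 R)) a b j = 0.
Proof.
by rewrite /germ /cocycle_dx diffop_val_comp mult_cochainE dx_xt1 ev0_theta1.
Qed.

Lemma germ_rot_x n a b j : germ (cocycle_rot n (osp_x R)) a b j = 0.
Proof. by rewrite /germ /cocycle_rot diffop_val_comp ev0_rot_x. Qed.

Lemma germ_rot_t12 n a b j : germ (cocycle_rot n (osp_t12 R)) a b j =
  rot_weight (n.+1%:R / 2) * germ (inv_op R n) a b j.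
Proof. by rewrite /germ /cocycle_rot diffop_val_comp ev0_rot_t12. Qed.

Lemma germ_rot_xt1 n a b j : germ (cocycle_rot n (osp_xt1 R)) a b j = 0.
Proof. by rewrite /germ /cocycle_rot diffop_val_comp ev0_rot_xt1. Qed.

Lemma cocycle_comm_val n G F : cocycle_comm n G F =
  dx G * inv_op R n F - inv_op R n (dx G * F).
Proof. by []. Qed.

Lemma germ_comm_x n a b j : germ (cocycle_comm n (osp_x R)) a b j = 0.
Proof. by rewrite /germ cocycle_comm_val dx_x !mul1r subrr; exact: linear0. Qed.

Lemma germ_comm_t12 n a b j : germ (cocycle_comm n (osp_t12 R)) a b j = 0.
Proof.
rewrite /germ cocycle_comm_val dx_t12 !mul0r.
have -> : inv_op R n 0 = 0 by exact: linear0.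
by rewrite subrr; exact: linear0.
Qed.

Lemma germ_comm_xt1 n : germ (cocycle_comm n (osp_xt1 R)) false true n = - inv_germ n.
Proof.
by rewrite /germ cocycle_comm_val dx_xt1 theta1_mono ev0B ev0_theta1 sub0r ev0_inv_op_mono.
Qed.

End DetectingValues.

(** * Dimensions and bases *)
Section Bases.
Variable R : realType.

Lemma germ_linear lam mu (G : osp22 R) a b j :
  linear_for *%R (fun z : Z1diff lam mu => germ (cocycle_val z G) a b j).
Proof.
move=> c z w; rewrite -[cocycle_val (c *: z + w) G]/(c *: cocycle_val z G + cocycle_val w G).
by rewrite /germ diffop_valD diffop_valZ ev0D ev0Z.
Qed.

Lemma undetected_diag (lam : R) U : undetected lam lam U <->
  germ (U (osp_x R)) false false 0 = 0 /\ germ (U (osp_t12 R)) false false 0 = 0.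
Proof.
split=> [[h _]|h]; first exact: h.
split=> // k lk mk; exfalso.
have := ltr0Sn R k; rewrite lk in mk; lra.
Qed.

Lemma undetected_res (n : nat) (U : osp22 R -> diffop R) :
  undetected (- (n.+1%:R / 2)) (n.+1%:R / 2) U <->
  [/\ germ (U (osp_x R)) true true n = 0, germ (U (osp_t12 R)) true true n = 0
     & germ (U (osp_xt1 R)) false true n = 0].
Proof.
have n0 := ltr0Sn R n.
split=> [[_ h]|h]; first exact: h.
split=> [e|k _ mk]; first by exfalso; lra.
suff -> : k = n by [].
have : n.+1%:R = k.+1%:R :> R by lra.
by move/eqP; rewrite eqr_nat eqSS => /eqP.
Qed.

Lemma undetected_generic (lam mu : R) U : mu - lam <> 0 ->
  (forall k : nat, (0 < k)%N -> (lam, mu) <> (- (k%:R / 2), k%:R / 2)) ->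
  undetected lam mu U.
Proof.
move=> ne nres; split=> [e|k lk mk]; first by case: ne; rewrite e subrr.
by case: (nres k.+1); rewrite // lk mk.
Qed.

Definition diag_basis (lam : R) : seq (Z1diff lam lam) :=
  [:: Z1_of (mult_dx_in lam); Z1_of (rot_cocycle_in lam)].

Lemma H1_diag (lam : R) : lmod_isomorphic (H1diff lam lam) 'rV[R]_2 /\
  forall h : H1diff lam lam, exists c : 'I_2 -> R,
    h = \sum_i c i *: H1diff_class (diag_basis lam)`_i.
Proof.
pose phi (i : 'I_2) (z : Z1diff lam lam) :=
  germ (cocycle_val z (nth (osp_1 R) [:: osp_x R; osp_t12 R] i)) false false 0.
apply: (@quotmod_dual_basis _ _ _ 2 phi (fun i => (diag_basis lam)`_i)
   (fun i => [:: 1; rot_weight lam]`_i)).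
- by move=> i; exact: germ_linear.
- move=> z; split=> [/coboundary_predP/undetected_diag[h1 h2]|h].
    by case=> [[|[|//]] ?].
  by apply/coboundary_predP/undetected_diag; split; [exact: (h 0)|exact: (h 1)].
- by case=> [[|[|//]] ?] /=; rewrite ?oner_eq0 ?rot_weight_neq0.
- have e1 : ev0 (sf_mono R false false 0) = 1 by rewrite /sf_mono expr0.
  case=> [[|[|//]] i2] [[|[|//]] j2]; rewrite /phi.
  + rewrite -[LHS]/(ev0 (dx (osp_x R) * sf_mono R false false 0)).
    by rewrite dx_x mul1r e1.
  + exact: ev0_rot_x.
  + rewrite -[LHS]/(ev0 (dx (osp_t12 R) * sf_mono R false false 0)).
    by rewrite dx_t12 mul0r; exact: linear0.
  + rewrite -[LHS]/(ev0 (rot_cocycle lam (osp_t12 R) (sf_mono R false false 0))).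
    by rewrite ev0_rot_t12 e1 mulr1.
Qed.

Definition res_basis (n : nat) : seq (Z1diff (- (n.+1%:R / 2)) (n.+1%:R / 2 : R)) :=
  [:: Z1_of (cocycle_dx_in R n); Z1_of (cocycle_rot_in R n); Z1_of (cocycle_comm_in R n)].

Lemma H1_res (n : nat) : let lam : R := - (n.+1%:R / 2) in let mu : R := n.+1%:R / 2 in
  lmod_isomorphic (H1diff lam mu) 'rV[R]_3 /\
  forall h : H1diff lam mu, exists c : 'I_3 -> R,
    h = \sum_i c i *: H1diff_class (res_basis n)`_i.
Proof.
move=> lam mu.
pose phi (i : 'I_3) (z : Z1diff lam mu) :=
  germ (cocycle_val z (nth (osp_1 R) [:: osp_x R; osp_t12 R; osp_xt1 R] i)) (nth true [:: true; true; false] i) true n.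
apply: (@quotmod_dual_basis _ _ _ 3 phi (fun i => (res_basis n)`_i)
   (fun i => [:: inv_germ R n; rot_weight mu * inv_germ R n; - inv_germ R n]`_i)).
- by move=> i; exact: germ_linear.
- move=> z; split=> [/coboundary_predP/undetected_res[h1 h2 h3]|h].
    by case=> [[|[|[|//]]] ?].
  apply/coboundary_predP/undetected_res.
  by split; [exact: (h (@Ordinal 3 0 isT))|exact: (h (@Ordinal 3 1 isT))|exact: (h (@Ordinal 3 2 isT))].
- have ne := inv_germ_neq0 R n.
  case=> [[|[|[|//]]] ?] /=; [exact: ne| |by rewrite oppr_eq0].
  by apply: mulf_neq0; [exact: rot_weight_neq0|].
- have e1 : germ (inv_op R n) true true n = inv_germ R n by rewrite germ_inv_op eqxx.
  case=> [[|[|[|//]]] i2] [[|[|[|//]]] j2]; rewrite /phi.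
  + by rewrite -[RHS]/(inv_germ R n) -e1; exact: germ_dx_x.
  + exact: germ_rot_x.
  + exact: germ_comm_x.
  + exact: germ_dx_t12.
  + by rewrite -[RHS]/(rot_weight mu * inv_germ R n) -e1; exact: germ_rot_t12.
  + exact: germ_comm_t12.
  + exact: germ_dx_xt1.
  + exact: germ_rot_xt1.
  + exact: germ_comm_xt1.
Qed.

Lemma H1_generic (lam mu : R) : mu - lam <> 0 ->
  (forall k : nat, (0 < k)%N -> (lam, mu) <> (- (k%:R / 2), k%:R / 2)) ->
  lmod_isomorphic (H1diff lam mu) 'rV[R]_0.
Proof.
move=> ne nres.
suff [] : lmod_isomorphic (H1diff lam mu) 'rV[R]_0 /\ forall h : H1diff lam mu,
    exists c : 'I_0 -> R, h = \sum_i c i *: H1diff_class (0 : Z1diff lam mu) by [].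
apply: (@quotmod_dual_basis _ _ _ 0 (fun _ _ => 0) (fun _ => 0) (fun _ => 1)).
- by case.
- by move=> z; split=> // _; apply/coboundary_predP; exact: undetected_generic.
- by case.
- by case.
Qed.

End Bases.

Theorem theorem3p1 (R : realType) (lam mu : R) :
  [/\ purely_even lam mu,
      [/\ mu - lam = 0 -> lmod_isomorphic (H1diff lam mu) 'rV[R]_2,
          (forall k : nat, (0 < k)%N -> (lam, mu) = (- (k%:R / 2), k%:R / 2) ->
            lmod_isomorphic (H1diff lam mu) 'rV[R]_3) &
          (mu - lam <> 0 ->
           (forall k : nat, (0 < k)%N -> (lam, mu) <> (- (k%:R / 2), k%:R / 2)) ->
            lmod_isomorphic (H1diff lam mu) 'rV[R]_0)],
      (mu = lam -> exists u v : Z1diff lam mu,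
        [/\ forall (G : osp22 R) (F : superfun R), u G F = Upsilon_diag G F,
            forall (G : osp22 R) (F : superfun R), v G F = tUpsilon_diag lam G F &
            forall h : H1diff lam mu, exists a b : R,
              h = a *: H1diff_class u + b *: H1diff_class v]) &
      (forall k : nat, (0 < k)%N -> (lam, mu) = (- (k%:R / 2), k%:R / 2) ->
        exists u v w : Z1diff lam mu,
        [/\ forall (G : osp22 R) (F : superfun R), u G F = Upsilon_k k G F,
            forall (G : osp22 R) (F : superfun R), v G F = tUpsilon_k k G F,
            forall (G : osp22 R) (F : superfun R), w G F = bUpsilon_k k G F &
            forall h : H1diff lam mu, exists a b c : R,
              h = a *: H1diff_class u + b *: H1diff_class v
                  + c *: H1diff_class w])].
Proof.
split; [exact: H1_purely_even|split| |].
- by move=> /eqP; rewrite subr_eq0 => /eqP->; case: (H1_diag lam).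
- by move=> [//|n] _ [-> ->]; case: (H1_res R n).
- exact: H1_generic.
- move=> ->; exists (Z1_of (mult_dx_in lam)), (Z1_of (rot_cocycle_in lam)).
  split=> [G F|G F|h]; [by []|exact: rot_cocycleE|].
  have [c ->] := (H1_diag lam).2 h; exists (c ord0), (c (lift ord0 ord0)).
  by rewrite !big_ord_recl big_ord0 addr0.
- move=> [//|n] _ [-> ->].
  exists (Z1_of (cocycle_dx_in R n)), (Z1_of (cocycle_rot_in R n)), (Z1_of (cocycle_comm_in R n)).
  split=> [G F|G F|G F|h]; [exact: cocycle_dxE|exact: cocycle_rotE|exact: cocycle_commE|].
  have [c ->] := (H1_res R n).2 h.
  exists (c ord0), (c (lift ord0 ord0)), (c (lift ord0 (lift ord0 ord0))).
  by rewrite !big_ord_recl big_ord0 addr0 addrA.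
Qed.
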